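(* Let $d\in\{2,3\}$, $p\ge1$, $\epsilon>0$, and let $0<c_0\le C_0$ be constants. For $j\in\{1,\dots,d\}$ and $t\ge2$ set $$\Omega_j(t):=\{\mathbf{x}=(x_1,\dots,x_d)\in\mathbb{R}^d : c_0\,t^p\ln^{1+\epsilon}t\le|x_j|\le C_0\,t^p\ln^{1+\epsilon}t\}.$$ Let $u_0\in H^1(\mathbb{R}^d)$ and let $u=u(\mathbf{x},t)$, $u\in C(\mathbb{R}:H^1(\mathbb{R}^d))$, be the solution of the Zakharov-Kuznetsov equation $\partial_tu+\partial_{x_1}\Delta u+u\,\partial_{x_1}u=0$ with $u(0)=u_0$. Then $$\lim_{t\to\infty}\int_{\Omega_j(t)}u^2(\mathbf{x},t)\,d\mathbf{x}=0,\qquad j=1,\dots,d.$$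
   Context: Here $u$ is real valued and $\Delta$ is the Laplacian in $\mathbb{R}^d$. The equation is globally well-posed in $H^1(\mathbb{R}^d)$ for $d=2,3$ (a known result); ''the solution'' is the unique global one given by that theory. It conserves the $L^2$ norm and its $H^1$ norm is bounded uniformly in time. The notation $\ln^{a}t$ means $(\ln t)^a$. *)

(* Defs.v *)
From HB Require Import structures.
From mathcomp Require Import all_boot all_order all_algebra.
From mathcomp Require Import all_classical all_reals all_analysis.

Set Implicit Arguments.
Unset Strict Implicit.
Unset Printing Implicit Defensive.

Import Order.TTheory GRing.Theory Num.Theory.
Import numFieldNormedType.Exports.

Local Open Scope classical_set_scope.
Local Open Scope ring_scope.

Definition rV_display : measure_display. Proof. exact. Qed.

(* The sigma-algebra on R^n is generated by the coordinate maps, each into R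
   with its Borel sets; this is the Borel sigma-algebra of R^n. *)
Section measurable_rV.
Context (R : realType) (n : nat).

Let coord (i : 'I_n) (x : 'rV[R]_n) : measurableTypeR R := x ord0 i.

Let rV_set0 : g_sigma_preimage coord set0.
Proof. exact: sigma_algebra0. Qed.

Let rV_setC A : g_sigma_preimage coord A -> g_sigma_preimage coord (~` A).
Proof. exact: sigma_algebraC. Qed.

Let rV_bigcup (F : (set 'rV[R]_n)^nat) :
  (forall i, g_sigma_preimage coord (F i)) ->
  g_sigma_preimage coord (\bigcup_i (F i)).
Proof. exact: sigma_algebra_bigcup. Qed.

HB.instance Definition _ := @isMeasurable.Build rV_display
  'rV[R]_n (g_sigma_preimage coord) rV_set0 rV_setC rV_bigcup.

Lemma measurable_coord (i : 'I_n) :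
  measurable_fun [set: 'rV[R]_n]
    (fun x => x ord0 i : measurableTypeR R).
Proof.
move=> _ Y mY; rewrite setTI; apply: sub_sigma_algebra => /=.
rewrite -bigcup_seq/=; exists i => /=; first by rewrite mem_index_enum.
by exists Y => //; rewrite setTI.
Qed.

Lemma measurable_fun_rV d (T : measurableType d) (f : T -> 'rV[R]_n) :
  (forall i, measurable_fun [set: T]
    (fun t => f t ord0 i : measurableTypeR R)) ->
  measurable_fun [set: T] f.
Proof.
move=> mf.
have sub : g_sigma_preimage (fun i => coord i \o f) `<=` measurable.
  apply: smallest_sub; first exact: sigma_algebra_measurable.
  rewrite -bigcup_seq/=; apply: bigcup_sub => i _.
  by move=> _ [B mB <-]; exact: mf.
move=> _ A mA; apply: sub.
rewrite (@g_sigma_preimage_comp _ _ n 'rV[R]_n coord T f).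
by exists A.
Qed.

End measurable_rV.

Section lebesgue_rV_cons.
Local Open Scope ereal_scope.
Context (R : realType) (n : nat).

Definition rV_cons (p : measurableTypeR R * 'rV[R]_n) : 'rV[R]_n.+1 :=
  \row_(i < n.+1) if unlift ord0 i is Some j then p.2 ord0 j else p.1.

Lemma measurable_rV_cons : measurable_fun [set: _] rV_cons.
Proof.
apply: measurable_fun_rV => i.
have [j ->|->] := unliftP ord0 i.
  rewrite [X in measurable_fun _ X](_ : _ =
    (fun x : 'rV[R]_n => x ord0 j : measurableTypeR R) \o snd).
    exact: measurableT_comp (measurable_coord j) measurable_snd.
  by apply/funext => p; rewrite mxE liftK.
rewrite [X in measurable_fun _ X](_ : _ = fst); first exact: measurable_fst.
by apply/funext => p; rewrite mxE unlift_none.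
Qed.

Variable mu : {sigma_finite_measure set 'rV[R]_n -> \bar R}.

Definition lebesgue_cons : set 'rV[R]_n.+1 -> \bar R :=
  pushforward (@lebesgue_measure R \x mu) rV_cons.

Let lebesgue_cons0 : lebesgue_cons set0 = 0.
Proof. by rewrite /lebesgue_cons /pushforward preimage_set0 measure0. Qed.

Let lebesgue_cons_ge0 A : 0 <= lebesgue_cons A.
Proof. by rewrite /lebesgue_cons /pushforward; apply: measure_ge0. Qed.

Let lebesgue_cons_sigma_additive : semi_sigma_additive lebesgue_cons.
Proof.
move=> F mF tF mUF; rewrite /lebesgue_cons /pushforward preimage_bigcup.
apply: measure_semi_sigma_additive.
- by move=> k; rewrite -[X in measurable X]setTI; exact: measurable_rV_cons.
- apply/trivIsetP => /= i j _ _ ij; rewrite -preimage_setI.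
  by move/trivIsetP : tF => /(_ _ _ _ _ ij) ->//; rewrite preimage_set0.
- by rewrite -preimage_bigcup -[X in measurable X]setTI;
    exact: measurable_rV_cons.
Qed.

HB.instance Definition _ := isMeasure.Build _ _ _ lebesgue_cons
  lebesgue_cons0 lebesgue_cons_ge0 lebesgue_cons_sigma_additive.

Let lebesgue_cons_sigma_finite : sigma_finite setT lebesgue_cons.
Proof.
have /sigma_finiteP[F [TF ndF Foo]] := sigma_finiteT (@lebesgue_measure R).
have /sigma_finiteP[G [TG ndG Goo]] := sigma_finiteT mu.
pose H k : set 'rV[R]_n.+1 :=
  (fun x => x ord0 ord0 : measurableTypeR R) @^-1` F k `&`
  (fun x => \row_i x ord0 (lift ord0 i)) @^-1` G k.
have HE k : rV_cons @^-1` H k = F k `*` G k.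
  apply/seteqP; rewrite /H; split=> -[x y] /=.
    rewrite mxE unlift_none => -[Fx Gy]; split=> //=.
    rewrite (_ : y = \row_i (rV_cons (x, y)) ord0 (lift ord0 i))//.
    by apply/rowP => i; rewrite !mxE liftK.
  move=> [/= Fx Gy]; rewrite mxE unlift_none; split=> //.
  rewrite (_ : \row_i _ = y)//.
  by apply/rowP => i; rewrite !mxE liftK.
exists H.
  apply/seteqP; split=> // x _.
  have [i _ Fi] : (\bigcup_i F i) (x ord0 ord0 : measurableTypeR R) by rewrite -TF.
  have [j _ Gj] : (\bigcup_i G i) (\row_i x ord0 (lift ord0 i)) by rewrite -TG.
  exists (maxn i j) => //; split.
    by have /subsetPset := ndF _ _ (leq_maxl i j); exact.
  by have /subsetPset := ndG _ _ (leq_maxr i j); exact.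
move=> k; have [mF Fk] := Foo k; have [mG Gk] := Goo k; split; last first.
  rewrite /lebesgue_cons /pushforward HE product_measure1E//.
  by rewrite lte_mul_pinfty// ge0_fin_numE.
apply: measurableI.
  by rewrite -[X in measurable X]setTI; exact: measurable_coord.
rewrite -[X in measurable X]setTI; apply: measurable_fun_rV => // i.
rewrite [X in measurable_fun _ X](_ : _ =
  (fun x : 'rV[R]_n.+1 => x ord0 (lift ord0 i) : measurableTypeR R)).
  exact: measurable_coord.
by apply/funext => x; rewrite mxE.
Qed.

HB.instance Definition _ := Measure_isSigmaFinite.Build _ _ _ lebesgue_cons
  lebesgue_cons_sigma_finite.

End lebesgue_rV_cons.

Fixpoint lebesgue_rV (R : realType) (n : nat) :
    {sigma_finite_measure set 'rV[R]_n -> \bar R} :=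
  match n with
  | 0 => [the {sigma_finite_measure set 'rV[R]_0 -> \bar R} of dirac (0 : 'rV[R]_0)]
  | n'.+1 => [the {sigma_finite_measure set 'rV[R]_n'.+1 -> \bar R} of
               lebesgue_cons (lebesgue_rV R n')]
  end.

Lemma lebesgue_rV_box (R : realType) (n : nat)
    (A : 'I_n -> set (measurableTypeR R)) :
  (forall i, measurable (A i)) ->
  lebesgue_rV R n [set x | forall i, A i (x ord0 i)] =
  (\prod_(i < n) @lebesgue_measure R (A i))%E.
Proof.
elim: n A => [|n IHn] A mA.
  rewrite big_ord0 /= diracE (_ : _ \in _ = true)//.
  by apply: mem_set => -[].
rewrite big_ord_recl -IHn//.
have mB : measurable [set x : 'rV[R]_n | forall i, A (lift ord0 i) (x ord0 i)].
  rewrite (_ : mkset _ = \bigcap_i (fun x : 'rV[R]_n =>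
    x ord0 i : measurableTypeR R) @^-1` A (lift ord0 i)).
    apply: fin_bigcap_measurable => // i _.
    by rewrite -[X in measurable X]setTI; exact: measurable_coord.
  by apply/seteqP; split=> x /= Ax i; [move=> _; exact: Ax|exact: Ax].
rewrite -product_measure1E//=.
rewrite /lebesgue_cons /pushforward; congr (_ _).
apply/seteqP; split=> -[x y] /=.
  move=> Axy; split=> [|i /=].
    by have := Axy ord0; rewrite mxE unlift_none.
  by have := Axy (lift ord0 i); rewrite mxE liftK.
move=> [/= Ax Ay] i; rewrite mxE.
by have [j ->|->] := unliftP ord0 i; [exact: Ay|].
Qed.

Section sobolev.
Context (R : realType) (n : nat).
Local Notation X := 'rV[R]_n.
Local Notation leb := (lebesgue_rV R n).
Implicit Types (f g phi : X -> R) (i j : 'I_n).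

Definition partial j phi : X -> R := 'D_(delta_mx ord0 j : X) phi.

Definition laplacian phi : X -> R := fun x => \sum_i partial i (partial i phi) x.

Definition smooth phi :=
  forall (s : seq 'I_n) x, differentiable (foldr partial phi s) x.

(* C_c^oo(R^n) *)
Definition test_function phi :=
  smooth phi /\ compact (closure [set x | phi x != 0]).

(* measurable functions with finite L^2 norm, not identified up to null sets *)
Definition L2 f := f \in Lfun leb 2%:E.

(* g is the j-th partial derivative of f in the sense of distributions; only
   used for f, g in L2, so that the integrands are integrable *)
Definition is_weak_partial j f g := forall phi, test_function phi ->
  \int[leb]_x (f x * partial j phi x) = - \int[leb]_x (g x * phi x).

Definition H1 f := L2 f /\ forall j, exists2 g, L2 g & is_weak_partial j f g.

(* a representative of the weak partial derivative, determined up to a null set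
   when f is in H1 *)
Definition wpartial j f : X -> R :=
  xget (cst 0) [set g | L2 g /\ is_weak_partial j f g].

Definition H1norm f : \bar R :=
  (('N[leb]_2%:E[EFin \o f] `^ 2 +
    \sum_j 'N[leb]_2%:E[EFin \o wpartial j f] `^ 2) `^ 2^-1)%E.

End sobolev.

(* The space dimension is d.+1, so that ord0 is the index of x_1; u x t is
   u(x, t). *)
Section zakharov_kuznetsov.
Context (R : realType) (d : nat).
Local Notation X := 'rV[R]_d.+1.
Local Notation leb := (lebesgue_rV R d.+1).
Implicit Types u : X -> R -> R.

(* u in C(R : H^1(R^d)) *)
Definition continuous_H1 u :=
  (forall t, H1 (u ^~ t)) /\
  (forall t, H1norm (fun x => u x s - u x t) @[s --> t] --> 0%E).

(* d_t u + d_1 (Laplacian u) + u d_1 u = 0 in the sense of distributions on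
   R^d, at every time; the three derivatives in d_1 Laplacian are moved onto
   the test function, which turns the sign of that term *)
Definition ZK_equation u := forall phi, test_function phi -> forall t : R,
  is_derive t (1 : R) (fun s => \int[leb]_x (u x s * phi x))
    (\int[leb]_x (u x t * partial ord0 (laplacian phi) x)
     - \int[leb]_x (u x t * wpartial ord0 (u ^~ t) x * phi x)).

Definition ZK_solution (u0 : X -> R) u :=
  [/\ continuous_H1 u, ZK_equation u & {ae leb, forall x, u x 0 = u0 x}].

Definition L2_conserved (u0 : X -> R) u := forall t,
  ('N[leb]_2%:E[EFin \o u ^~ t] = 'N[leb]_2%:E[EFin \o u0])%E.

Definition H1_bounded u := exists M : R, forall t, (H1norm (u ^~ t) <= M%:E)%E.

Definition Omega (c0 C0 p eps : R) (j : 'I_d.+1) (t : R) : set X :=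
  [set x | c0 * (t `^ p * ln t `^ (1 + eps)) <= `|x ord0 j|
             <= C0 * (t `^ p * ln t `^ (1 + eps))].

End zakharov_kuznetsov.

(* Main.v *)
(* A smooth compactly supported cutoff chi of width L = c0 t^p (ln t)^(1+eps)
   vanishes on Omega_j(t), so by mass conservation the integral of u(t)^2 on
   Omega_j(t) is at most the mass minus the integral of chi u(t)^2. The latter
   localized mass varies at rate O(1/L): every term of its time derivative
   carries a derivative of chi and is bounded by the H1 norm of u, which is
   uniformly bounded in time. Hence it moves by O(t/L) = O(1/ln t) between the
   times 0 and t, while at time 0 it tends to the total mass as L grows.

   The equation only holds weakly and u(s) is only in H1, so the argument is run
   on the mollification of u(s) at scale 4^-k. The nonlinear term then has a
   commutator error: it is a sup norm of order 2^k times an L1 norm of order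
   4^-k, hence it vanishes when k grows, in dimension at most 3. *)
Require Import Defs.
From mathcomp Require Import all_boot all_order all_algebra.
From mathcomp Require Import all_classical all_reals all_analysis.
From mathcomp Require Import ring lra measurable_realfun.

Set Implicit Arguments.
Unset Strict Implicit.
Unset Printing Implicit Defensive.

Import Order.TTheory GRing.Theory Num.Theory.
Import numFieldNormedType.Exports.

Local Open Scope classical_set_scope.
Local Open Scope ring_scope.

(** * Translation invariance and the L2 modulus of continuity *)

(** The equation is used only through translates of smooth kernels. Testing it on the mollifier
    centred at [q] makes the mollified solution differentiable in time at every [q], so the virial
    computation is calculus on smooth bounded functions, and the solution enters through squared L2
    norms of itself and of its gradient. The obstacle is the cubic term: integrated by parts, it
    pairs a derivative of the cutoff with the cube of the mollified solution, which must be bounded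
    independently of the scale although the available sup bound grows like 2^k. That growth is a
    geometric mean: the gradient bound makes the squared L2 error at scale 4^-k of order 16^-k, the
    squared norm of the mollifier is of order 64^k in dimension three, and the square root of the
    product is 2^k. The increments of the cubic integral between scales are then of order 2^-k and
    can be summed. Cauchy-Schwarz is replaced by weighted arithmetic-geometric inequalities, each
    with a weight that balances the two sides, so squared norms suffice. *)

Section boxes.
Context (R : realType) (n : nat).
Local Notation X := 'rV[R]_n.
Local Notation leb := (lebesgue_rV R n).

Definition ocbox (a b : 'I_n -> R) : set X :=
  [set x | forall i, (`]a i, b i]%classic : set R) (x ord0 i)].

Definition ocboxes : set (set X) := [set ocbox ab.1 ab.2 | ab in setT].

Lemma ocboxE a b : ocbox a b = \bigcap_i
  (fun x : X => x ord0 i : measurableTypeR R) @^-1` `]a i, b i].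
Proof. by apply/seteqP; split=> x /= H i; [move=> _|]; exact: H. Qed.

Lemma measurable_ocbox a b : measurable (ocbox a b).
Proof.
rewrite ocboxE; apply: fin_bigcap_measurable => // i _.
by rewrite -[X in measurable X]setTI; exact: measurable_coord.
Qed.

Lemma ocboxesI : setI_closed ocboxes.
Proof.
move=> _ _ [[a b] _ <-] [[a' b'] _ <-] /=.
exists (fun i => Num.max (a i) (a' i), fun i => Num.min (b i) (b' i)) => //=.
apply/seteqP; split=> x /=.
  move=> H; split=> i; have := H i; rewrite /= !in_itv/= gt_max le_min;
    by case/andP => /andP[? ?] /andP[? ?]; apply/andP.
move=> [H H'] i; move: (H i) (H' i); rewrite /= !in_itv/= gt_max le_min.
by move=> /andP[-> ->] /andP[-> ->].
Qed.

Definition cube (r : R) : set X := ocbox (fun=> - r) (fun=> r).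

Lemma measurable_cube r : measurable (cube r).
Proof. exact: measurable_ocbox. Qed.

Lemma bigcup_cube : \bigcup_k cube k%:R = [set: X].
Proof.
apply/seteqP; split=> // x _.
pose M := \sum_i `|x ord0 i|.
have [k Mk] : exists k : nat, M < k%:R.
  by exists (Num.truncn M).+1; rewrite truncnS_gt.
exists k => // i; rewrite /= in_itv /=.
have : `|x ord0 i| < k%:R.
  by apply: le_lt_trans Mk; rewrite /M (bigD1 i)//= lerDl sumr_ge0.
by rewrite ltr_norml => /andP[-> /ltW].
Qed.

Lemma cube_nd : nondecreasing_seq (fun k : nat => cube k%:R).
Proof.
move=> k m km; apply/subsetPset => x H i; move: (H i); rewrite /= !in_itv/=.
move=> /andP[h1 h2]; have km' : k%:R <= m%:R :> R by rewrite ler_nat.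
by rewrite (le_lt_trans _ h1) ?lerN2//= (le_trans h2).
Qed.

(** A slab, where one coordinate lies in []u, v]], is the union over k of boxes whose other sides
    are []-k, k]], and slabs generate the sigma-algebra. *)
Lemma measurable_rVE : @measurable _ X = <<s ocboxes >>.
Proof.
apply/seteqP; split; last first.
  apply: smallest_sub; first exact: sigma_algebra_measurable.
  by move=> _ [ab _ <-]; exact: measurable_ocbox.
apply: smallest_sub; first exact: smallest_sigma_algebra.
rewrite -bigcup_seq/=; apply: bigcup_sub => i _ _ [B mB <-].
pose c (x : X) : R := x ord0 i.
have := @sigma_algebra_image _ _ setT c <<s ocboxes >>
  (smallest_sigma_algebra setT ocboxes).
set H := image_set_system _ _ _ => sH.
have : <<s R.-ocitv.-measurable >> `<=` H.
  apply: smallest_sub => // _ [[u v] _ <-].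
  rewrite /H /image_set_system /= setTI.
  have -> : c @^-1` `]u, v] = \bigcup_k ocbox
     (fun j => if j == i then u else - k%:R)
     (fun j => if j == i then v else k%:R).
    apply/seteqP; split=> x /=.
      move=> cx; have [k _ xk] : (\bigcup_k cube k%:R) x by rewrite bigcup_cube.
      by exists k => // j; case: eqP => [->//|_]; exact: xk.
    by move=> [k _ /(_ i)]; rewrite eqxx.
  apply: sigma_algebra_bigcup => k; apply: sub_sigma_algebra.
  by eexists (_, _).
by move=> /(_ B mB).
Qed.

Lemma lebesgue_ocbox (a b : 'I_n -> R) :
  leb (ocbox a b) = (\prod_(i < n) (Num.max 0 (b i - a i))%:E)%E.
Proof.
rewrite (@lebesgue_rV_box R n (fun i => `]a i, b i]%classic))//.
apply: eq_bigr => i _.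
rewrite lebesgue_measure_itv/= lte_fin -EFinB.
case: ltP => ab; congr (_%:E); [rewrite max_r//|rewrite max_l//].
  by rewrite subr_ge0 ltW.
by rewrite subr_le0.
Qed.

Lemma lebesgue_ocbox_lty (a b : 'I_n -> R) : (leb (ocbox a b) < +oo)%E.
Proof. by rewrite lebesgue_ocbox prodEFin ltry. Qed.

(** Boxes generate, are stable under intersection, and the cubes among them exhaust the space with
    finite measure. This is the source of translation invariance. *)
Lemma lebesgue_rV_unique (m : {measure set X -> \bar R}) :
  (forall a b, m (ocbox a b) = leb (ocbox a b)) ->
  forall A, measurable A -> m A = leb A.
Proof.
move=> mleb; apply: (@measure_unique _ _ _ ocboxes (fun k => cube k%:R)).
- exact: measurable_rVE.
- exact: ocboxesI.
- by move=> k; eexists (_, _).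
- exact: bigcup_cube.
- by move=> _ [[a b] _ <-].
- by move=> k; rewrite mleb lebesgue_ocbox_lty.
Qed.

End boxes.

Section translation.
Context (R : realType) (n : nat).
Local Notation X := 'rV[R]_n.
Local Notation leb := (lebesgue_rV R n).

Lemma measurable_shift (z : X) : measurable_fun [set: X] (fun x => x + z).
Proof.
apply: measurable_fun_rV => i.
under eq_fun do rewrite mxE.
by apply: measurable_funD => //; exact: measurable_coord.
Qed.

Lemma measurable_rVD : measurable_fun [set: X * X] (fun p => p.1 + p.2).
Proof.
apply: measurable_fun_rV => i; under eq_fun do rewrite mxE.
by apply: measurable_funD; [exact: measurableT_comp (measurable_coord i) measurable_fst|
  exact: measurableT_comp (measurable_coord i) measurable_snd].
Qed.

Lemma pushforward_shift (z : X) (A : set X) : measurable A ->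
  pushforward leb (fun x : X => x + z) A = leb A.
Proof.
move: A.
pose m : {measure set X -> \bar R} := measure_function_pushforward__canonical__measure_function_Measure leb (measurable_shift z).
apply: (lebesgue_rV_unique (m := m)) => a b.
transitivity (leb (ocbox (fun i => a i - z ord0 i) (fun i => b i - z ord0 i))).
  congr (leb _); apply/seteqP; split=> x H i; move: (H i);
    rewrite /= !in_itv/= mxE; by rewrite ltrBlDr lerBrDr.
by rewrite !lebesgue_ocbox; apply: eq_bigr => i _; congr (Num.max 0 _)%:E; ring.
Qed.

Lemma ge0_integral_shift (z : X) (f : X -> \bar R) : measurable_fun setT f ->
  (forall x, 0 <= f x)%E ->
  (\int[leb]_x f ((x : X) + z)%R = \int[leb]_x f x)%E.
Proof.
move=> mf f0; have := @ge0_integral_pushforward _ _ X X R _ (measurable_shift z) leb setT f.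
rewrite preimage_setT => <- //.
apply: eq_measure_integral; first exact: measurable_shift.
by move=> mz A mA _; exact: pushforward_shift.
Qed.

Lemma integral_shift (z : X) (f : X -> \bar R) : measurable_fun setT f ->
  (\int[leb]_x f ((x : X) + z)%R = \int[leb]_x f x)%E.
Proof.
move=> mf; rewrite integralE [RHS]integralE; congr (_ - _)%E.
  rewrite -[RHS](@ge0_integral_shift z (f^\+)%E)//; last exact: measurable_funepos.
  by apply: eq_integral => x _; rewrite !funeposE.
rewrite -[RHS](@ge0_integral_shift z (f^\-)%E)//; last exact: measurable_funeneg.
by apply: eq_integral => x _; rewrite !funenegE.
Qed.

Lemma Rintegral_shift (z : X) (f : X -> R) : measurable_fun setT f ->
  \int[leb]_x f ((x : X) + z) = \int[leb]_x f x.
Proof.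
move=> mf; congr fine; apply: (@integral_shift z (EFin \o f)).
exact/measurable_EFinP.
Qed.

(** The squared L2 norm. Working with squares replaces the triangle inequality by (a + b)^2 <= 2 a^2
    + 2 b^2, at the cost of factors 2. *)
Definition sq (f : X -> R) : \bar R := (\int[leb]_x ((f x) ^+ 2)%:E)%E.

Lemma sq_ge0 f : (0 <= sq f)%E.
Proof. by apply: integral_ge0 => x _; rewrite lee_fin sqr_ge0. Qed.

Lemma measurable_sq (f : X -> R) : measurable_fun setT f ->
  measurable_fun setT (fun x => ((f x) ^+ 2)%:E).
Proof. by move=> mf; apply/measurable_EFinP; exact: measurable_funX. Qed.

Lemma sq_le (f g : X -> R) : measurable_fun setT f -> measurable_fun setT g ->
  (forall x, `|f x| <= `|g x|) -> (sq f <= sq g)%E.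
Proof.
move=> mf mg fg; apply: ge0_le_integral => //.
- by move=> x _; rewrite lee_fin sqr_ge0.
- exact: measurable_sq.
- exact: measurable_sq.
- by move=> x _; rewrite lee_fin -[leLHS]real_normK ?num_real// -[leRHS]real_normK ?num_real// lerXn2r ?nnegrE.
Qed.

Lemma sqD (f g : X -> R) : measurable_fun setT f -> measurable_fun setT g ->
  (sq (fun x => f x + g x)%R <= 2%:E * sq f + 2%:E * sq g)%E.
Proof.
move=> mf mg; rewrite /sq -!ge0_integralZl//; do ?[exact: measurable_sq|by move=> x _; rewrite lee_fin sqr_ge0].
rewrite -ge0_integralD//; last 4 first.
- by move=> x _; rewrite -EFinM lee_fin mulr_ge0 ?sqr_ge0.
- by apply: measurable_funeM; exact: measurable_sq.
- by move=> x _; rewrite -EFinM lee_fin mulr_ge0 ?sqr_ge0.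
- by apply: measurable_funeM; exact: measurable_sq.
apply: ge0_le_integral => //.
- by move=> x _; rewrite lee_fin sqr_ge0.
- by apply: measurable_sq; exact: measurable_funD.
- by apply: emeasurable_funD; apply: measurable_funeM; exact: measurable_sq.
- move=> x _; rewrite -!EFinM -EFinD lee_fin -subr_ge0.
  rewrite (_ : _ - _ = (f x - g x) ^+ 2) ?sqr_ge0//; ring.
Qed.

Lemma sqZ (c : R) (f : X -> R) : measurable_fun setT f ->
  sq (fun x => c * f x) = ((c ^+ 2)%:E * sq f)%E.
Proof.
move=> mf; rewrite /sq -ge0_integralZl//; last 3 first.
- exact: measurable_sq.
- by move=> x _; rewrite lee_fin sqr_ge0.
- by rewrite lee_fin sqr_ge0.
by apply: eq_integral => x _; rewrite exprMn.
Qed.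

Lemma sq_shift (z : X) (f : X -> R) : measurable_fun setT f ->
  sq (fun x : X => f (x + z)) = sq f.
Proof.
move=> mf; rewrite /sq (@ge0_integral_shift z (fun x => ((f x) ^+ 2)%:E))//.
  exact: measurable_sq.
by move=> x; rewrite lee_fin sqr_ge0.
Qed.

End translation.

Section translation_continuity.
Context (R : realType) (n : nat).
Local Notation X := 'rV[R]_n.
Local Notation leb := (lebesgue_rV R n).

Definition L2_translation_continuous (f : X -> R) := measurable_fun setT f /\
  forall e : R, 0 < e -> exists2 r, 0 < r & forall z : X,
    (forall i, `|z ord0 i| <= r) -> (sq (fun x : X => f (x + z) - f x)%R <= e%:E)%E.

Local Notation L2cont := L2_translation_continuous.

Lemma measurable_tau (f : X -> R) (z : X) : measurable_fun setT f ->
  measurable_fun setT (fun x : X => f (x + z)).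
Proof. by move=> mf; exact: measurableT_comp mf (measurable_shift z). Qed.

Lemma sqB (f g : X -> R) : measurable_fun setT f -> measurable_fun setT g ->
  (sq (fun x => f x - g x)%R <= 2%:E * sq f + 2%:E * sq g)%E.
Proof.
move=> mf mg; have := sqD mf (measurable_funN mg).
rewrite (_ : sq (-%R \o g) = sq g)//.
by rewrite /sq; apply: eq_integral => x _ /=; rewrite sqrrN.
Qed.

Lemma sqBC (f g : X -> R) : sq (fun x => f x - g x) = sq (fun x => g x - f x).
Proof. by rewrite /sq; apply: eq_integral => x _ /=; rewrite -sqrrN opprB. Qed.

(** The increment of f is that of g plus the difference of f - g at two points, and translation
    invariance bounds the latter without reference to the shift. *)
Lemma L2_translation_lim (f : X -> R) : measurable_fun setT f ->
  (forall e : R, 0 < e -> exists2 g, L2cont g & (sq (fun x => f x - g x)%R <= e%:E)%E) ->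
  L2cont f.
Proof.
move=> mf H; split=> // e e0.
(* The fractions 1/12 and 1/8 absorb the factors of [sqD] and [sqB]: 8/12 + 2/8 < 1. *)
have [g [mg gg] fg] := H (e / 12) (divr_gt0 e0 (ltr0Sn _ 11)).
have [r r0 {}gg] := gg (e / 8) (divr_gt0 e0 (ltr0Sn _ 7)).
exists r => // z /gg {}gg.
have m1 : measurable_fun setT (fun x => f x - g x) by exact: measurable_funB.
rewrite (_ : (fun x : X => f (x + z) - f x) = (fun x : X =>
   ((f (x + z) - g (x + z)) - (f x - g x)) + (g (x + z) - g x))); last first.
  by apply/funext => x; ring.
apply: le_trans; first apply: sqD.
- by apply: measurable_funB => //; exact: (measurable_tau z m1).
- by apply: measurable_funB => //; exact: measurable_tau.
apply: (@le_trans _ _ (2%:E * (2%:E * (e / 12)%:E + 2%:E * (e / 12)%:E) + 2%:E * (e / 8)%:E)%E).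
  apply: leeD; last by rewrite lee_pmul2l.
  rewrite lee_pmul2l//; apply: le_trans; first exact: (sqB (measurable_tau z m1) m1).
  by rewrite (sq_shift z m1); apply: leeD; rewrite lee_pmul2l.
by rewrite -!(EFinM, EFinD) lee_fin; lra.
Qed.

Lemma L2_translationD (f g : X -> R) : L2cont f -> L2cont g -> L2cont (fun x => f x + g x).
Proof.
move=> [mf gf] [mg gg]; split; first exact: measurable_funD.
move=> e e0.
have [r r0 {}gf] := gf (e / 4) (divr_gt0 e0 (ltr0Sn _ 3)).
have [s s0 {}gg] := gg (e / 4) (divr_gt0 e0 (ltr0Sn _ 3)).
exists (Num.min r s); first by rewrite lt_min r0.
move=> z zrs.
have {}gf : (sq (fun x : X => f (x + z) - f x)%R <= (e / 4)%:E)%E.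
  by apply: gf => i; rewrite (le_trans (zrs i))// ge_min lexx.
have {}gg : (sq (fun x : X => g (x + z) - g x)%R <= (e / 4)%:E)%E.
  by apply: gg => i; rewrite (le_trans (zrs i))// ge_min lexx orbT.
rewrite (_ : (fun x : X => _) = (fun x : X => (f (x + z) - f x) + (g (x + z) - g x))).
  apply: le_trans; first apply: sqD; do ?[by apply: measurable_funB => //; exact: measurable_tau].
  apply: (@le_trans _ _ (2%:E * (e / 4)%:E + 2%:E * (e / 4)%:E)%E).
    by apply: leeD; rewrite lee_pmul2l.
  by rewrite -!EFinM -EFinD lee_fin; lra.
by apply/funext => x; ring.
Qed.

Lemma L2_translationZ (c : R) (f : X -> R) : L2cont f -> L2cont (fun x => c * f x).
Proof.
move=> [mf gf]; split; first exact: measurable_funM.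
move=> e e0.
have [r r0 {}gf] := gf (e / (c ^+ 2 + 1)) (divr_gt0 e0 (ltr_pwDr ltr01 (sqr_ge0 c))).
exists r => // z /gf {}gf.
rewrite (_ : (fun x : X => _) = (fun x : X => c * (f (x + z) - f x))); last first.
  by apply/funext => x; ring.
rewrite sqZ; last by apply: measurable_funB => //; exact: measurable_tau.
apply: (@le_trans _ _ ((c ^+ 2)%:E * (e / (c ^+ 2 + 1))%:E)%E).
  by apply: lee_wpmul2l => //; rewrite lee_fin sqr_ge0.
rewrite -EFinM lee_fin mulrCA ler_piMr ?(ltW e0)//.
by rewrite ler_pdivrMr ?mul1r ?lerDl// ltr_pwDr// sqr_ge0.
Qed.

Lemma L2_translation0 : L2cont (fun=> 0).
Proof.
split=> // e e0; exists 1 => // z _.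
rewrite /sq integral0_eq ?lee_fin ?(ltW e0)// => x _.
by rewrite subrr expr0n.
Qed.

Lemma L2_translation_sum (I : Type) (s : seq I) (f : I -> X -> R) : (forall i, L2cont (f i)) ->
  L2cont (fun x => \sum_(i <- s) f i x).
Proof.
move=> gf; elim: s => [|i s IH].
  by under eq_fun do rewrite big_nil; exact: L2_translation0.
by under eq_fun do rewrite big_cons; exact: L2_translationD.
Qed.

(** The product is the volume of a box whose sides are all shortened by [e]; [max 0] accounts for
    sides that become empty. It bounds from below the overlap of a box with a translate. *)
Lemma cvg_prod_maxB (I : Type) (s : seq I) (l : I -> R) :
  (\prod_(i <- s) Num.max 0 (l i - e)) @[e --> 0] --> \prod_(i <- s) Num.max 0 (l i).
Proof.
elim: s => [|i s IH].
  by rewrite big_nil; under eq_fun do rewrite big_nil; exact: cvg_cst.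
rewrite big_cons; under eq_fun do rewrite big_cons.
apply: cvgM => //.
have h : (fun e : R => Num.max (0 : R) (l i - e)) @ (0 : R) --> Num.max (0 : R) (l i - 0).
  apply: (@continuous_max R R (cst (0 : R)) (fun e : R => l i - e) (0 : R)).
    exact: cst_continuous.
  by apply: continuousB; [exact: cst_continuous|move=> ?; exact: cvg_id].
by rewrite subr0 in h.
Qed.

(** The squared distance between the indicators of a box and of its translate is the sum of the two
    volumes minus twice the volume of the overlap. The overlap is again a box, each side being
    shortened by the absolute value of that coordinate of the shift. *)
Lemma L2_translation_ocbox (a b : 'I_n -> R) : L2cont \1_(ocbox a b).
Proof.
split; first exact: measurable_indic (measurable_ocbox _ _).
move=> e e0.
pose l i := b i - a i.
have /cvgrPdist_le /(_ (e / 2) (divr_gt0 e0 (ltr0Sn _ 1))) := @cvg_prod_maxB 'I_n (index_enum 'I_n) l.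
move=> /nbhs_ballP[r /= r0 H].
have r20 : 0 < r / 2 by rewrite divr_gt0.
exists (r / 2) => // z zr.
pose a' i := a i - z ord0 i; pose b' i := b i - z ord0 i.
have Q' x : \1_(ocbox a b) (x + z) = \1_(ocbox a' b') x :> R.
  rewrite !indicE; congr (_%:R); apply: congr1; apply/idP/idP => /set_mem xQ; apply: mem_set => i;
  move: (xQ i); rewrite /= !in_itv/= /a' /b' mxE; by rewrite ltrBlDr lerBrDr.
pose a2 i := Num.max (a i) (a' i); pose b2 i := Num.min (b i) (b' i).
have QI : ocbox a b `&` ocbox a' b' = ocbox a2 b2.
  apply/seteqP; split=> x /=.
    move=> [Q1 Q2] i; move: (Q1 i) (Q2 i); rewrite /= !in_itv/= gt_max le_min.
    by move=> /andP[-> ->] /andP[-> ->].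
  move=> H1; split=> i; have := H1 i; rewrite /= !in_itv/= gt_max le_min;
    by case/andP => /andP[? ?] /andP[? ?]; apply/andP.
rewrite (_ : (fun x : X => _) = (fun x : X => \1_(ocbox a' b') x - \1_(ocbox a b) x)); last first.
  by apply/funext => x; rewrite Q'.
set F := fun x : X => _.
have mQ : measurable (ocbox a b) by exact: measurable_ocbox.
have mQ' : measurable (ocbox a' b') by exact: measurable_ocbox.
have mI : measurable (ocbox a2 b2) by exact: measurable_ocbox.
have mF : measurable_fun setT F by apply: measurable_funB; exact: measurable_indic.
have : (sq F + 2%:E * leb (ocbox a2 b2) = leb (ocbox a b) + leb (ocbox a' b'))%E.
  have int_indic A : measurable A -> leb A = (\int[leb]_x (\1_A x)%:E)%E.
    by move=> mA; rewrite integral_indic// setIT.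
  rewrite !int_indic// -ge0_integralZl//; last first.
  - by apply/measurable_EFinP; exact: measurable_indic.
  rewrite -!ge0_integralD//.
  - apply: eq_integral => x _; rewrite /F -QI indicI /= -!(EFinM, EFinD); congr (_%:E).
    rewrite !indicE; case: (_ \in _); case: (_ \in _) => /=; ring.
  all: try by apply/measurable_EFinP; exact: measurable_indic.
  all: try by move=> x _; rewrite ?lee_fin ?sqr_ge0// -EFinM lee_fin mulr_ge0// indicE.
  all: try exact: measurable_sq.
  by apply: measurable_funeM; apply/measurable_EFinP; exact: measurable_indic.
have -> : leb (ocbox a' b') = leb (ocbox a b).
  by rewrite !lebesgue_ocbox; apply: eq_bigr => i _; congr (Num.max 0 _)%:E; rewrite /a' /b'; ring.
have : (\prod_i Num.max 0 (l i) - e / 2 <= \prod_i Num.max 0 (b2 i - a2 i)).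
  have /H : ball (0 : R) r (r / 2).
    by rewrite /ball /= sub0r normrN gtr0_norm// ltr_pdivrMr// ltr_pMr// ltr1n.
  rewrite ler_norml => /andP[_]; rewrite lerBlDr -lerBlDl => /le_trans; apply.
  apply: ler_prod => i _; apply/andP; split; first by rewrite le_max lexx.
  rewrite ge_max le_max lexx/= le_max; apply/orP; right.
  have := zr i; rewrite ler_norml /l /a2 /b2 /a' /b' => /andP[z1 z2].
  by rewrite /Num.max /Num.min; case: ifP => _; case: ifP => _; lra.
rewrite !lebesgue_ocbox !prodEFin; move: (sq_ge0 F).
case: (sq F) => [t| |]//= _; rewrite -?(EFinM, EFinD) => H1 [H2].
by rewrite lee_fin; lra.
Qed.

End translation_continuity.

Import HBNNSimple.

(** * From boxes to all square-integrable functions *)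

Section translation_approximation.
Context (R : realType) (n : nat).
Local Notation X := 'rV[R]_n.
Local Notation leb := (lebesgue_rV R n).
Local Notation cube n N := (@cube _ n N).
Local Notation L2cont := (@L2_translation_continuous R n).

Lemma sq_indicB (A B : set X) : measurable A -> measurable B -> A `<=` B ->
  (sq (fun x => \1_B x - \1_A x)%R + leb A = leb B)%E.
Proof.
move=> mA mB AB.
have int_indic C : measurable C -> leb C = (\int[leb]_x (\1_C x)%:E)%E.
  by move=> mC; rewrite integral_indic// setIT.
rewrite !int_indic//.
have mD : measurable_fun setT (fun x : X => \1_B x - \1_A x : R).
  by apply: measurable_funB; exact: measurable_indic.
rewrite /sq -ge0_integralD//; last 3 first.
- by move=> x _; rewrite lee_fin sqr_ge0.
- exact: measurable_sq.
- by apply/measurable_EFinP; exact: measurable_indic.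
apply: eq_integral => x _; rewrite -EFinD; congr (_%:E); rewrite !indicE.
case: (boolP (x \in A)) => [/set_mem/AB/mem_set ->|_]; first by rewrite subrr expr0n add0r.
by case: (_ \in _); rewrite subr0 ?expr1n ?expr0n addr0.
Qed.

(** The sets with this property form a lambda-system that contains the boxes. Truncation by a cube
    keeps the measures finite, as the passage to increasing unions requires. *)
Lemma L2_translation_indic_cube (N : R) (A : set X) : measurable A -> L2cont \1_(A `&` cube n N).
Proof.
rewrite measurable_rVE; move: A.
pose H := [set A : set X | measurable A /\ L2cont \1_(A `&` cube n N)].
suff : <<s (@ocboxes R n) >> `<=` H by move=> + A => /[apply] -[].
have mQ := @measurable_cube R n N.
apply: lambda_system_subset => //; first exact: ocboxesI.
- split => //.
  + by split=> //; rewrite setTI; exact: L2_translation_ocbox.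
  + move=> A B BA [mA gA] [mB gB]; split; first exact: measurableD.
    rewrite (_ : \1_ _ = (fun x => \1_(A `&` cube n N) x + (-1) * \1_(B `&` cube n N) x)).
      by apply: L2_translationD => //; exact: L2_translationZ.
    apply/funext => x; rewrite !indicE setDE !in_setI in_setC.
    case: (boolP (x \in B)) => [/set_mem/BA/mem_set ->|_]; rewrite /= ?andbF ?andbT /=;
      case: (x \in cube n N); case: (x \in A) => /=; ring.
  + move=> F ndF GF.
    have mF i : measurable (F i) by case: (GF i).
    have mU : measurable (\bigcup_i F i) by exact: bigcup_measurable.
    split=> //; apply: L2_translation_lim; first by exact/measurable_indic/measurableI.
    move=> e e0.
    have ndFQ : nondecreasing_seq (fun i => F i `&` cube n N).
      by move=> i k ik; apply/subsetPset; apply: setSI; apply/subsetPset; exact: ndF.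
    have : leb (F i `&` cube n N) @[i --> \oo] --> leb (\bigcup_i (F i `&` cube n N)).
      apply: nondecreasing_cvg_mu => //; first by move=> i; exact: measurableI.
      by apply: bigcup_measurable => i _; exact: measurableI.
    rewrite -setI_bigcupl.
    have Ufin : (leb (\bigcup_i F i `&` cube n N) < +oo)%E.
      apply: le_lt_trans (lebesgue_ocbox_lty (fun=> - N) (fun=> N)).
      by apply: le_measure; rewrite ?inE//; exact: measurableI.
    have : leb (\bigcup_i F i `&` cube n N) \is a fin_num by rewrite ge0_fin_numE.
    case E : (leb _) => [v| |]// _.
    move=> /fine_cvgP[_] /cvgrPdist_le /(_ _ e0) [k _ /(_ _ (leqnn k)) /= Hk].
    exists \1_(F k `&` cube n N); first by case: (GF k).
    have := @sq_indicB (F k `&` cube n N) (\bigcup_i F i `&` cube n N)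
       (measurableI _ _ (mF k) mQ) (measurableI _ _ mU mQ).
    rewrite E => /(_ (setSI (bigcup_sup I))).
    move: Hk; case: (leb (F k `&` _)) (measure_ge0 leb (F k `&` cube n N)) => [w| |]//=;
      case: (sq _) (sq_ge0 (fun x : X => \1_(\bigcup_i F i `&` cube n N) x - \1_(F k `&` cube n N) x)) => [t| |]//= _ _.
    by rewrite -EFinD lee_fin ler_norml => /andP[_ h] [?]; lra.
- move=> _ [[a b] _ <-] /=; split; first exact: measurable_ocbox.
  have := @ocboxesI R n (ocbox a b) (cube n N).
  case; [by eexists (_, _)|by eexists (_, _)|move=> [a' b'] _ /= <-].
  exact: L2_translation_ocbox.
Qed.

(** Simple approximations from below, cut off to growing cubes, converge to f in L2 by dominated
    convergence, with f^2 as the dominating function. *)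
Lemma L2_translation_ge0 (f : X -> R) : measurable_fun setT f -> (forall x, 0 <= f x) ->
  (sq f < +oo)%E -> L2cont f.
Proof.
move=> mf f0 foo; apply: L2_translation_lim => // e e0.
have mEf : measurable_fun setT (EFin \o f) by exact/measurable_EFinP.
pose g := nnsfun_approx measurableT mEf.
pose h k (x : X) := g k x * \1_(cube n k%:R) x.
have gh k : L2cont (h k).
  pose s : seq R := finmap.enum_fset (fset_set (range (g k))).
  rewrite (_ : h k = (fun x => \sum_(y <- s)
      (y * \1_(g k @^-1` [set y] `&` cube n k%:R) x))).
    apply: L2_translation_sum => y; apply: L2_translationZ; apply: L2_translation_indic_cube.
    by rewrite -[X in measurable X]setTI; exact: measurable_funP.
  apply/funext => x; rewrite /h fimfunE fsbig_finite//= mulr_suml; apply: eq_bigr => y _.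
  by rewrite indicI/= mulrA.
have mh k : measurable_fun setT (h k) by case: (gh k).
have gf k (x : X) : g k x <= f x.
  by rewrite -lee_fin nnsfun_approxE; apply: le_approx => // y _; rewrite lee_fin.
have hf k (x : X) : 0 <= h k x <= f x.
  rewrite /h indicE; case: (_ \in _); rewrite ?mulr1 ?mulr0 ?lexx ?f0// gf andbT.
  exact: fun_ge0.
have hcvg (x : X) : h k x @[k --> \oo] --> f x.
  have gc : g k x @[k --> \oo] --> f x.
    have := @cvg_nnsfun_approx _ _ _ _ measurableT _ mEf (fun y _ => f0 y) x I.
    by move=> /fine_cvgP[_].
  have [N _ xN] : (\bigcup_k cube n k%:R) x by rewrite bigcup_cube.
  apply: cvg_trans gc; apply: near_eq_cvg; near=> k.
  rewrite /h indicE (_ : _ \in _ = true) ?mulr1//; apply: mem_set.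
  have Nk : (N <= k)%N by near: k; exact: nbhs_infty_ge.
  by have /subsetPset := @cube_nd R n N k Nk; apply.
have ig : leb.-integrable setT (fun x => ((f x) ^+ 2)%:E).
  apply/integrableP; split; first exact: measurable_sq.
  by under eq_integral do rewrite gee0_abs ?lee_fin ?sqr_ge0//.
have := @dominated_convergence _ _ _ leb setT measurableT
  (fun k x => ((f x - h k x) ^+ 2)%:E) (fun=> 0%E) (fun x => ((f x) ^+ 2)%:E).
case=> //.
- by move=> k; apply: measurable_sq; exact: measurable_funB.
- apply: aeW => x _; apply: cvg_EFin; first exact: nearW.
  rewrite -[X in _ --> X](_ : (f x - f x) ^+ 2 = 0); last by rewrite subrr expr0n.
  apply: (@cvg_comp _ _ _ (fun k => f x - h k x) (fun y : R => y ^+ 2)).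
    by apply: cvgB => //; exact: cvg_cst.
  exact: exprn_continuous.
- apply: aeW => x k _; rewrite gee0_abs ?lee_fin ?sqr_ge0//.
  have /andP[h1 h2] := hf k x.
  by rewrite lerXn2r ?nnegrE// ?subr_ge0// lerBlDr lerDl.
move=> _ _; rewrite integral0 => /fine_cvgP[+ /cvgrPdist_le /(_ _ e0)].
move=> [N1 _ H1] [N2 _ H2].
exists (h (maxn N1 N2)) => //.
have := H1 (maxn N1 N2) (leq_maxl _ _); have := H2 (maxn N1 N2) (leq_maxr _ _).
rewrite /= sub0r normrN => h2 h1; rewrite -[leLHS]fineK// lee_fin.
exact: le_trans (ler_norm _) h2.
Unshelve. all: end_near. Qed.

Lemma L2_translation_continuousE (f : X -> R) : measurable_fun setT f ->
  (sq f < +oo)%E -> L2cont f.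
Proof.
move=> mf foo.
have part (g : X -> R) : measurable_fun setT g -> (forall x, 0 <= g x <= `|f x|) -> L2cont g.
  move=> mg gf; apply: L2_translation_ge0 => //; first by move=> x; case/andP: (gf x).
  apply: le_lt_trans foo; apply: sq_le => // x.
  by have /andP[g0 ?] := gf x; rewrite ger0_norm.
rewrite (_ : f = fun x => Num.max (f x) 0 + (-1) * Num.max (- f x) 0).
  apply: L2_translationD; last apply: L2_translationZ; apply: part.
  - exact: measurable_maxr.
  - by move=> x; rewrite le_max lexx orbT/= ge_max ler_norm normr_ge0.
  - by apply: measurable_maxr => //; exact: measurable_funN.
  - by move=> x; rewrite le_max lexx orbT/= ge_max -normrN ler_norm normr_ge0.
by apply/funext => x; rewrite /Num.max; do 2 case: ifPn; lra.
Qed.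

End translation_approximation.

(** * Kernels, cutoffs and mollifiers *)

Section bump.
Context (R : realType).
Implicit Types (p : {poly R}) (m : nat) (x : R).

(* The functions P(x) (1 - x^2)^-m exp(-1/(1 - x^2)) on ]-1, 1[ form a class
   closed under differentiation; [a] is the pair (P, m). *)
Definition bumpf (a : {poly R} * nat) (x : R) : R :=
  if `|x| < 1 then a.1.[x] * (1 - x ^+ 2)^-1 ^+ a.2 * expR (- (1 - x ^+ 2)^-1) else 0.

(** With V = 1 - x^2 and W = 1/V one has W' = 2 x W^2, so the derivative of P W^m exp(-W) is (P' V^2
    + 2 m x P V - 2 x P) W^(m+2) exp(-W). *)
Definition bump_deriv (a : {poly R} * nat) : {poly R} * nat :=
  ((a.1)^`() * (1 - 'X ^+ 2) ^+ 2 + (2 * a.2%:R)%:P * 'X * a.1 * (1 - 'X ^+ 2)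
   - 2%:P * 'X * a.1, a.2.+2%N).

(** For v > 0, exp(-1/v) <= k! v^k. The choice k = m + 2 absorbs the pole of order m and leaves v^2;
    this quadratic decay makes the derivative vanish at the end points. *)
Lemma bump_small a : exists2 C, 0 <= C &
  forall x, `|bumpf a x| <= C * (if `|x| < 1 then (1 - x ^+ 2) ^+ 2 else 0).
Proof.
case: a => p m.
pose P := \sum_(i < size p) `|p`_i|; pose k := m.+2.
exists (P * k`!%:R); first by rewrite mulr_ge0// sumr_ge0.
move=> x; rewrite /bumpf; case: ifPn => x1; last by rewrite normr0 mulr0.
have x21 : x ^+ 2 < 1 by rewrite -[x ^+ 2]real_normK ?num_real// expr_lt1.
set v := 1 - x ^+ 2; have v0 : 0 < v by rewrite subr_gt0.
have pP : `|p.[x]| <= P.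
  rewrite horner_coef; apply: le_trans (ler_norm_sum _ _ _) _.
  apply: ler_sum => i _; rewrite normrM ler_piMr// normrX exprn_ile1//.
  exact: ltW.
have eP : expR (- v^-1) <= k`!%:R * v ^+ k.
  rewrite expRN; have vk : 0 < k`!%:R * v ^+ k by rewrite mulr_gt0 ?exprn_gt0// ltr0n fact_gt0.
  rewrite -[leRHS]invrK lef_pV2 ?posrE ?expR_gt0 ?invr_gt0//.
  apply: le_trans (@expR_ge1Dxn _ _ m.+1 (ltW _)); last by rewrite invr_gt0.
  by rewrite invfM mulrC exprVn lerDr.
rewrite !normrM normrX (ger0_norm (expR_ge0 _)) [`|v^-1|]ger0_norm ?invr_ge0 ?(ltW v0)//.
rewrite -!mulrA; apply: ler_pM => //; first by rewrite mulr_ge0 ?expR_ge0// exprn_ge0// invr_ge0 ltW.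
apply: le_trans (ler_wpM2l _ eP) _; first by rewrite exprn_ge0// invr_ge0 ltW.
rewrite mulrCA ler_wpM2l// exprVn /k -addn2 exprD mulKf// ?expf_neq0 ?gt_eqF//.
Qed.

Lemma bump_bounded a : exists C, forall x, `|bumpf a x| <= C.
Proof.
have [C C0 H] := bump_small a; exists C => x; apply: le_trans (H x) _.
rewrite ler_piMr//; case: ifPn => // x1.
have x2 : x ^+ 2 <= 1 by rewrite -[x ^+ 2]real_normK ?num_real// exprn_ile1// ltW.
by rewrite exprn_ile1 ?subr_ge0// lerBlDr lerDl sqr_ge0.
Qed.

Lemma bump_deriv_ring m (W V P P' E x : R) : W * V = 1 ->
  P * W ^+ m * (E * - (2 * x * W ^+ 2)) + E * (P * (m%:R * W ^+ m.-1 * (2 * x * W ^+ 2)) + W ^+ m * P')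
  = (P' * V ^+ 2 + 2 * m%:R * x * P * V - 2 * x * P) * W ^+ m.+2 * E.
Proof.
move=> WV; rewrite -(addn2 m) exprD; set Y := W ^+ m.
have -> : P * (m%:R * W ^+ m.-1 * (2 * x * W ^+ 2)) = P * (2 * x) * (m%:R * Y * W).
  by rewrite {}/Y; case: m => [|k]; [rewrite !mul0r !mulr0|rewrite (exprS W k); ring].
transitivity (E * (P' * Y * (W * V) ^+ 2 + 2 * m%:R * x * P * Y * W * (W * V) - 2 * x * P * Y * W ^+ 2)).
  by rewrite WV; ring.
by ring.
Qed.

Lemma is_derive_bump_in a x : `|x| < 1 -> is_derive x 1 (bumpf a) (bumpf (bump_deriv a) x).
Proof.
case: a => p m x1.
have x21 : x ^+ 2 < 1 by rewrite -[x ^+ 2]real_normK ?num_real// expr_lt1.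
have v0 : 1 - x ^+ 2 != 0 by rewrite gt_eqF// subr_gt0.
pose v (y : R) := 1 - y ^+ 2; pose w (y : R) := (v y)^-1.
have dv : is_derive x 1 v (- (2 * x)).
  apply: is_derive_eq; rewrite /GRing.scale/=; ring.
have dw : is_derive x 1 w (2 * x * w x ^+ 2).
  apply: DeriveDef; first by apply: derivableV.
  rewrite deriveV// derive_val/= /w /GRing.scale/=; rewrite exprVn; ring.
apply: (@near_eq_is_derive _ _ _ (fun y => p.[y] * w y ^+ m * expR (- w y))).
  have : \forall y \near x, `|y| < 1.
    exact: (@cvgr_norm_lt R R R (nbhs x) _ id x cvg_id 1 x1).
  by apply: filterS => y y1; rewrite /bumpf y1.
rewrite /bumpf x1 /=.
have dm : is_derive x 1 (fun y => w y ^+ m) (m%:R * w x ^+ m.-1 * (2 * x * w x ^+ 2)).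
  rewrite (_ : (fun y => _) = w ^+ m); last by apply/funext => y; rewrite exprfctE.
  by apply: (is_derive_eq (@is_deriveX R R w m x 1 _ dw)).
have de : is_derive x 1 (fun y => expR (- w y)) (expR (- w x) * (- (2 * x * w x ^+ 2))).
  by apply: (@is_derive1_comp R expR (fun y => - w y)).
have h := is_deriveM (is_deriveM (is_derive_poly p x) dm) de.
apply: (is_derive_eq h).
have wv : w x * (1 - x ^+ 2) = 1 by rewrite /w mulVf.
transitivity (p.[x] * w x ^+ m * (expR (- w x) * - (2 * x * w x ^+ 2)) +
    expR (- w x) * (p.[x] * (m%:R * w x ^+ m.-1 * (2 * x * w x ^+ 2)) + w x ^+ m * p^`().[x])) => //.
rewrite (bump_deriv_ring _ _ _ _ _ wv); congr (_ * _ * _).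
by rewrite /bump_deriv !(hornerD, hornerN, hornerM, hornerX, hornerXn, hornerC, horner_exp).
Qed.

(** Outside the open interval the claimed derivative is 0. There [bump_small] bounds the increment
    by a multiple of h^2, so the difference quotient is O(h). *)
Lemma is_derive_bump a x : is_derive x 1 (bumpf a) (bumpf (bump_deriv a) x).
Proof.
have [|x1] := ltP `|x| 1; first exact: is_derive_bump_in.
have b0 c : bumpf c x = 0 by rewrite /bumpf ltNge x1.
rewrite b0; have [C C0 HC] := bump_small a.
have key h : `|h| <= 1 -> `|bumpf a (h + x)| <= C * (9 * `|h| ^+ 2).
  move=> h1; apply: le_trans (HC _) _; rewrite ler_wpM2l//.
  case: ifPn => hx; last by rewrite mulr_ge0.
  have hx2 : (h + x) ^+ 2 < 1 by rewrite -[_ ^+ 2]real_normK ?num_real// expr_lt1.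
  have x2 : 1 <= x ^+ 2 by rewrite -[x ^+ 2]real_normK ?num_real// expr_ge1.
  (* Since x^2 >= 1, this is at most x^2 - (h + x)^2 = -h (2 (h + x) - h), where |h + x| < 1 and |h|
     <= 1. *)
  have : 0 <= 1 - (h + x) ^+ 2 <= 3 * `|h|.
    rewrite subr_ge0 (ltW hx2)/=.
    apply: (@le_trans _ _ (- h * ((h + x) *+ 2 - h))).
      by rewrite lerBlDr; apply: le_trans x2 _; rewrite le_eqVlt; apply/orP; left; apply/eqP; ring.
    apply: le_trans (ler_norm _) _; rewrite normrM normrN mulrC ler_wpM2r//.
    apply: le_trans (ler_normB _ _) _.
    rewrite normrMn; move: hx h1; lra.
  move=> /andP[k0 k1]; have := lerXn2r 2 k0 (mulr_ge0 (ler0n _ 3) (normr_ge0 h)) k1.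
  by rewrite exprMn -natrX.
suff H : (fun h => h^-1 *: ((bumpf a \o shift x) (h *: 1) - bumpf a x)) @ 0^' --> (0 : R).
  by apply: DeriveDef; [apply/cvg_ex; exists 0|apply/cvg_lim].
apply/cvgrPdist_le => /= e e0; near=> h.
rewrite sub0r normrN b0 subr0 /= [_%:A]mulr1 normrM normfV.
have h0 : h != 0 by near: h; exact: nbhs_dnbhs_neq.
rewrite ler_pdivrMl ?normr_gt0//.
apply: le_trans (key h _) _.
  by near: h; apply: dnbhs0_le.
rewrite expr2 [leRHS]mulrC !mulrA ler_wpM2r//.
have : `|h| <= e / (C * 9 + 1) by near: h; apply: dnbhs0_le; rewrite divr_gt0// ltr_wpDl// mulr_ge0.
rewrite ler_pdivlMr; last by rewrite ltr_wpDl// mulr_ge0.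
by move=> /(le_trans _); apply; rewrite mulrC ler_wpM2l// lerDl.
Unshelve. all: end_near. Qed.

End bump.

Section kernels.
Context (R : realType) (n : nat).
Local Notation X := 'rV[R]_n.
Implicit Types (a : 'I_n -> {poly R} * nat).

(* Tensor products of the one-dimensional bumps are closed under all partial
   derivatives, which makes them smooth by construction. *)
Definition kern (c r : R) a (x : X) : R := c * \prod_i bumpf (a i) (x ord0 i / r).

Definition kern_deriv (j : 'I_n) a : 'I_n -> {poly R} * nat :=
  fun i => if i == j then bump_deriv (a i) else a i.

Lemma differentiable_bump (b : {poly R} * nat) y : differentiable (bumpf b) y.
Proof. by apply/derivable1_diffP; apply: ex_derive; exact: is_derive_bump. Qed.

Lemma continuous_bump (b : {poly R} * nat) : continuous (bumpf b).
Proof. by move=> y; apply: differentiable_continuous; exact: differentiable_bump. Qed.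

Lemma measurable_bump (b : {poly R} * nat) : measurable_fun setT (bumpf b).
Proof. by apply: continuous_measurable_fun; exact: continuous_bump. Qed.

Lemma measurable_kern c r a : measurable_fun setT (kern c r a).
Proof.
apply: measurable_funM => //; apply: measurable_prod => i _.
apply: (measurableT_comp (measurable_bump (a i))).
by apply: measurable_funM => //; exact: measurable_coord.
Qed.

Lemma differentiable_kern c r a x : differentiable (kern c r a) x.
Proof.
rewrite /kern; apply: differentiableM; first exact: differentiable_cst.
elim: (index_enum 'I_n) => [|i s IH].
  by under eq_fun do rewrite big_nil; exact: differentiable_cst.
under eq_fun do rewrite big_cons.
apply: differentiableM => //.
apply: (@differentiable_comp _ _ _ _ (fun x : X => x ord0 i / r) (bumpf (a i))).
  by apply: differentiableM; [exact: differentiable_coord|exact: differentiable_cst].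
exact: differentiable_bump.
Qed.

(** Restriction to a line makes the rules of one-variable calculus available for directional
    derivatives. *)
Lemma is_derive_line (f : X -> R) (x v : X) (df : R) :
  is_derive (0 : R) 1 (fun h : R => f (h *: v + x)) df -> is_derive x v f df.
Proof.
move=> [H <-]; apply: DeriveDef; first exact/derivable1P.
rewrite /derive; apply: (congr1 (fun F : R -> R => lim (F h @[h --> 0^']))).
by apply/funext => h /=; rewrite addr0 scale0r add0r [_%:A]mulr1.
Qed.

Lemma is_derive_kern (j : 'I_n) c r a (x : X) :
  is_derive x (delta_mx ord0 j : X) (kern c r a) (kern (c / r) r (kern_deriv j a) x).
Proof.
apply: is_derive_line.
pose P := c * \prod_(i | i != j) bumpf (a i) (x ord0 i / r).
rewrite (_ : (fun h : R => _) = (fun h => P * bumpf (a j) ((h + x ord0 j) / r))).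
  have d1 : is_derive (0 : R) 1 (fun h : R => (h + x ord0 j) / r) r^-1.
    rewrite (_ : (fun h : R => _) = (r^-1 \*: (id + cst (x ord0 j)))).
      apply: (is_derive_eq (is_deriveZ _ (is_deriveD (is_derive_id _ _) (is_derive_cst _ _ _)))).
      by rewrite addr0 [LHS]mulr1.
    by apply/funext => h; rewrite /= mulrC.
  have d2 := is_derive_bump (a j) ((0 + x ord0 j) / r).
  have d3 := @is_derive1_comp R (bumpf (a j)) (fun h => (h + x ord0 j) / r) 0 _ _ d2 d1.
  apply: (is_derive_eq (is_deriveZ P d3)).
  rewrite /GRing.scale/= /kern (bigD1 j)//= /kern_deriv eqxx add0r /P.
  rewrite [in RHS](eq_bigr (fun i => bumpf (a i) (x ord0 i / r))); last by move=> i /negbTE ->.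
  by ring.
apply/funext => h; rewrite /kern (bigD1 j)//= !mxE !eqxx /= mulr1 /P.
rewrite (eq_bigr (fun i => bumpf (a i) (x ord0 i / r))); last first.
  by move=> i /negbTE ij; rewrite !mxE ij andbF mulr0 add0r.
by ring.
Qed.

Lemma partial_kern (j : 'I_n) c r a : partial j (kern c r a) = kern (c / r) r (kern_deriv j a).
Proof. by apply/funext => x; exact: (@derive_val _ _ _ _ _ _ _ (is_derive_kern j c r a x)). Qed.

Lemma kern_derivC i j a : kern_deriv i (kern_deriv j a) = kern_deriv j (kern_deriv i a).
Proof. by apply/funext => k; rewrite /kern_deriv; do 2 case: ifP. Qed.

Lemma partial_kernC i j c r a :
  partial i (partial j (kern c r a)) = partial j (partial i (kern c r a)).
Proof. by rewrite !partial_kern kern_derivC. Qed.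

Lemma kern_bounded a : exists2 C, 0 <= C & forall c r x, `|kern c r a x| <= `|c| * C.
Proof.
have /choice [C HC] : forall i, exists C, forall x, `|bumpf (a i) x| <= C.
  by move=> i; exact: bump_bounded.
exists (\prod_i C i).
  by apply: prodr_ge0 => i _; exact: le_trans (normr_ge0 _) (HC i 0).
move=> c r x; rewrite /kern normrM ler_wpM2l// normr_prod.
by apply: ler_prod => i _; rewrite normr_ge0 HC.
Qed.

Lemma kern_support c r a (x : X) i : 0 < r -> r <= `|x ord0 i| -> kern c r a x = 0.
Proof.
move=> r0 rx; rewrite /kern (bigD1 i)//= /bumpf.
by rewrite ltNge normrM normfV (gtr0_norm r0) ler_pdivlMr// mul1r rx/= mul0r mulr0.
Qed.

Lemma kern_smooth c r a : smooth (kern c r a).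
Proof.
move=> s; have [c' [a' ->]] : exists c' a', foldr (@partial R n) (kern c r a) s = kern c' r a'.
  elim: s => [|i s [c' [a' IH]]]; first by exists c, a.
  by exists (c' / r), (kern_deriv i a'); rewrite /= IH partial_kern.
by move=> x; exact: differentiable_kern.
Qed.

Lemma compact_support (f : X -> R) M : (forall x, f x != 0 -> forall i, `|x ord0 i| <= M) ->
  compact (closure [set x | f x != 0]).
Proof.
move=> fM.
have cK : compact [set v : X | forall i, `[- M, M]%classic (v ord0 i)].
  by apply: (@rV_compact _ _ (fun=> `[- M, M]%classic)) => i; exact: segment_compact.
apply: (subclosed_compact _ cK); first exact: closed_closure.
apply: (@subset_trans _ (closure [set v : X | forall i, `[- M, M]%classic (v ord0 i)])).
  by apply: closure_subset => x /fM H i /=; rewrite in_itv/= -ler_norml.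
rewrite -(closure_id _).1//; apply: compact_closed => //.
Qed.

Lemma partial_shift (j : 'I_n) (f : X -> R) (q : X) :
  partial j (fun x => f (x - q)) = fun x => partial j f (x - q).
Proof.
apply/funext => x; rewrite /partial /derive.
apply: (congr1 (fun F : R -> R => lim (F h @[h --> 0^']))).
by apply/funext => h /=; rewrite addrA.
Qed.

Lemma foldr_partial_shift (s : seq 'I_n) (f : X -> R) (q : X) :
  foldr (@partial R n) (fun x => f (x - q)) s = fun x => foldr (@partial R n) f s (x - q).
Proof. by elim: s => //= i s ->; rewrite partial_shift. Qed.

(** These translates are the test functions put into the equation and into the definition of weak
    derivatives. *)
Lemma test_function_shift c r a q : 0 < r -> test_function (fun x => kern c r a (x - q)).
Proof.
move=> r0; split.
  move=> s x; rewrite foldr_partial_shift.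
  apply: (@differentiable_comp _ _ _ _ (fun x => x - q) (foldr (@partial R n) (kern c r a) s)).
    by apply: differentiableB => //; exact: differentiable_cst.
  exact: kern_smooth.
pose M := \sum_i `|q ord0 i| + r.
apply: (@compact_support _ M) => x + i; apply: contraNT; rewrite -ltNge => Mx.
rewrite (@kern_support _ _ _ _ i)// !mxE.
have : `|q ord0 i| <= \sum_i `|q ord0 i| by rewrite (bigD1 i)//= lerDl sumr_ge0.
have := lerB_dist (x ord0 i) (q ord0 i); move: Mx; rewrite /M; lra.
Qed.

End kernels.

Lemma le_integral_EFin d (T : measurableType d) (R : realType)
    (mu : {measure set T -> \bar R}) (f g : T -> R) :
  measurable_fun setT f -> measurable_fun setT g ->
  (forall x, 0 <= f x) -> (forall x, f x <= g x) ->
  (\int[mu]_x (f x)%:E <= \int[mu]_x (g x)%:E)%E.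
Proof.
move=> mf mg f0 fg; apply: ge0_le_integral => //.
- by move=> x _; rewrite lee_fin.
- exact/measurable_EFinP.
- exact/measurable_EFinP.
- by move=> x _; rewrite lee_fin.
Qed.

Lemma integralZl_EFin d (T : measurableType d) (R : realType)
    (mu : {measure set T -> \bar R}) (c : R) (f : T -> R) :
  measurable_fun setT f -> (forall x, 0 <= f x) -> 0 <= c ->
  (\int[mu]_x (c * f x)%:E = c%:E * \int[mu]_x (f x)%:E)%E.
Proof.
move=> mf f0 c0; under eq_integral do rewrite EFinM.
rewrite ge0_integralZl//; last by move=> x _; rewrite lee_fin.
exact/measurable_EFinP.
Qed.

(** * Cutoffs and mollifiers built from one bump *)

Section cutoff.
Context (R : realType).

(** The factor exp(1) makes the maximum, attained at 0, equal to 1. *)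
Definition bump1 : {poly R} * nat := ((expR 1)%:P, 0%N).

Lemma bump1E x : bumpf bump1 x = if `|x| < 1 then expR (1 - (1 - x ^+ 2)^-1) else 0.
Proof. by rewrite /bumpf /= hornerC expr0 mulr1 -expRD. Qed.

Lemma bump1_sqr (x : R) : `|x| < 1 -> 0 < 1 - x ^+ 2 <= 1.
Proof.
move=> x1; rewrite subr_gt0 lerBlDr lerDl sqr_ge0 andbT.
by rewrite -[x ^+ 2]real_normK ?num_real// expr_lt1.
Qed.

Lemma bump1_ge0 x : 0 <= bumpf bump1 x.
Proof. by rewrite bump1E; case: ifP => // _; exact: expR_ge0. Qed.

Lemma bump1_le1 x : bumpf bump1 x <= 1.
Proof.
rewrite bump1E; case: ifP => // /bump1_sqr /andP[v0 v1].
by rewrite -[leRHS]expR0 ler_expR subr_le0 invf_ge1.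
Qed.

Lemma bump1_0 : bumpf bump1 0 = 1.
Proof. by rewrite bump1E normr0 ltr01 expr0n subr0 invr1 subrr expR0. Qed.

Lemma bump1N x : bumpf bump1 (- x) = bumpf bump1 x.
Proof. by rewrite !bump1E normrN sqrrN. Qed.

(** Here x^2 <= 1/2, hence 1/(1 - x^2) <= 2. It serves to bound the mass of the cutoff from
    below. *)
Lemma bump1_half x : `|x| <= 2^-1 -> expR (- 1) <= bumpf bump1 x.
Proof.
move=> x2; rewrite bump1E ifT; last by apply: le_lt_trans x2 _; lra.
rewrite ler_expR.
have : x ^+ 2 <= 2^-1 by rewrite -[x ^+ 2]real_normK ?num_real//; move: x2 (normr_ge0 x); nra.
move=> xx; suff : (1 - x ^+ 2)^-1 <= 2 by lra.
by rewrite -[leRHS]invrK lef_pV2 ?posrE; lra.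
Qed.

Context (n : nat).
Local Notation X := 'rV[R]_n.
Local Notation leb := (lebesgue_rV R n).

(* locked, like [moll], because unification otherwise unfolds it down to
   the product *)
Definition cutoff (r : R) : X -> R := locked (kern 1 r (fun=> bump1)).

Lemma cutoffE r : cutoff r = kern 1 r (fun=> bump1).
Proof. by rewrite /cutoff -lock. Qed.

Lemma cutoff_ge0 r x : 0 <= cutoff r x.
Proof. by rewrite cutoffE /kern mul1r prodr_ge0// => i _; exact: bump1_ge0. Qed.

Lemma cutoff_le1 r x : cutoff r x <= 1.
Proof.
rewrite cutoffE /kern mul1r; apply: prodr_ile1 => i _.
by rewrite bump1_ge0 bump1_le1.
Qed.

Lemma cutoffN r x : cutoff r (- x) = cutoff r x.
Proof.
by rewrite !cutoffE /kern; congr (_ * _); apply: eq_bigr => i _; rewrite mxE mulNr bump1N.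
Qed.

Lemma measurable_cutoff r : measurable_fun setT (cutoff r).
Proof. by rewrite cutoffE; exact: measurable_kern. Qed.

Lemma cutoff_cvg1 (x : X) : cutoff r x @[r --> +oo] --> (1 : R).
Proof.
under eq_fun do rewrite cutoffE /kern mul1r.
elim: (index_enum 'I_n) => [|i s IH].
  by under eq_fun do rewrite big_nil; exact: cvg_cst.
under eq_fun do rewrite big_cons.
suff A : bumpf bump1 (x ord0 i / r) @[r --> +oo] --> (1 : R).
  by have := cvgM A IH; rewrite mulr1; exact.
rewrite -bump1_0; apply: (@cvg_comp _ _ _ (fun r => x ord0 i / r) (bumpf bump1) _ (nbhs (0 : R))).
  apply/cvgrPdist_le => e e0; exists (Num.max 0 (`|x ord0 i| / e)).
  split=> [|r]; first by rewrite num_real.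
  rewrite gt_max => /andP[r0 /ltW xr].
  by rewrite /= sub0r normrN normrM normfV (gtr0_norm r0) ler_pdivrMr// mulrC -ler_pdivrMr.
exact: continuous_bump.
Qed.

Definition mass (r : R) : R := \int[leb]_x cutoff r x.

Lemma cutoff_lty r : 0 < r -> (\int[leb]_x (cutoff r x)%:E < +oo)%E.
Proof.
move=> r0; apply: le_lt_trans (lebesgue_ocbox_lty (fun i : 'I_n => - r) (fun=> r)).
rewrite [leRHS](_ : _ = (\int[leb]_x (\1_(ocbox (fun=> - r) (fun=> r)) x)%:E)%E); last first.
  by rewrite integral_indic ?setIT//; exact: measurable_ocbox.
apply: le_integral_EFin.
- exact: measurable_cutoff.
- by apply: measurable_indic; exact: measurable_ocbox.
- exact: cutoff_ge0.
move=> x; rewrite indicE; case: (boolP (x \in _)) => [_|]; first exact: cutoff_le1.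
move=> /negP xQ; suff [i ri] : exists i, r <= `|x ord0 i| by rewrite cutoffE (kern_support _ _ r0 ri).
apply: contrapT => /forallNP H; apply: xQ; apply: mem_set => i /=.
rewrite in_itv/=; by have /negP := H i; rewrite -ltNge ltr_norml => /andP[-> /ltW ->].
Qed.

Lemma mass_ge r : 0 < r -> (expR (- 1) * r) ^+ n <= mass r.
Proof.
move=> r0; rewrite -lee_fin /mass /Rintegral fineK; last first.
  rewrite ge0_fin_numE ?cutoff_lty//; apply: integral_ge0 => x _.
  by rewrite lee_fin cutoff_ge0.
pose Q : set X := ocbox (fun=> - (r / 2)) (fun=> r / 2).
have mQ : measurable Q by exact: measurable_ocbox.
apply: (@le_trans _ _ (\int[leb]_x (expR (- 1) ^+ n * \1_Q x)%:E)%E).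
  rewrite integralZl_EFin; [|exact: measurable_indic|by move=> x; rewrite indicE|by rewrite exprn_ge0// expR_ge0].
  have LQ : leb Q = (r ^+ n)%:E.
    rewrite lebesgue_ocbox prodEFin prodr_const card_ord max_r; last lra.
    by rewrite (_ : r / 2 - - (r / 2) = r)//; lra.
  rewrite integral_indic// setIT -[X in (_ <= _ * X)%E]/(leb Q) LQ -EFinM lee_fin.
  by rewrite exprMn.
apply: le_integral_EFin.
- by apply: measurable_funM => //; exact: measurable_indic.
- exact: measurable_cutoff.
- by move=> x; rewrite mulr_ge0 ?exprn_ge0 ?expR_ge0// indicE.
move=> x; rewrite indicE; case: (boolP (x \in _)) => [|_]; last by rewrite mulr0 cutoff_ge0.
move=> /set_mem xQ; rewrite mulr1 cutoffE /kern mul1r.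
rewrite -[in leLHS](card_ord n) -prodr_const; apply: ler_prod => i _.
rewrite expR_ge0/=; apply: bump1_half; rewrite normrM normfV (gtr0_norm r0).
rewrite ler_pdivrMr// ler_norml; have := xQ i; rewrite /= in_itv/= => /andP[? ?].
by apply/andP; split; lra.
Qed.

Lemma mass_gt0 r : 0 < r -> 0 < mass r.
Proof. by move=> r0; apply: lt_le_trans (mass_ge r0); rewrite exprn_gt0// mulr_gt0// expR_gt0. Qed.

Definition moll (r : R) : X -> R := locked (kern (mass r)^-1 r (fun=> bump1)).

Lemma mollE r x : moll r x = (mass r)^-1 * cutoff r x.
Proof. by rewrite /moll -lock cutoffE /kern mul1r. Qed.

Lemma moll_ge0 r x : 0 < r -> 0 <= moll r x.
Proof. by move=> r0; rewrite mollE mulr_ge0 ?cutoff_ge0// invr_ge0 ltW// mass_gt0. Qed.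

Lemma mollN r x : moll r (- x) = moll r x.
Proof. by rewrite !mollE cutoffN. Qed.

Lemma measurable_moll r : measurable_fun setT (moll r).
Proof. by rewrite /moll -lock; exact: measurable_kern. Qed.

Lemma integral_moll r : 0 < r -> (\int[leb]_x (moll r x)%:E = 1)%E.
Proof.
move=> r0; under eq_integral do rewrite mollE.
rewrite integralZl_EFin; [|exact: measurable_cutoff|exact: cutoff_ge0|by rewrite invr_ge0 ltW// mass_gt0].
have -> : (\int[leb]_x (cutoff r x)%:E = (mass r)%:E)%E.
  rewrite /mass /Rintegral fineK// ge0_fin_numE ?cutoff_lty//.
  by apply: integral_ge0 => x _; rewrite lee_fin cutoff_ge0.
by rewrite -EFinM mulVf// gt_eqF// mass_gt0.
Qed.

Lemma moll_le r x : 0 < r -> moll r x <= expR 1 ^+ n / r ^+ n.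
Proof.
move=> r0; rewrite mollE; apply: (@le_trans _ _ (mass r)^-1).
  by rewrite ler_piMr ?cutoff_le1// invr_ge0 ltW// mass_gt0.
rewrite -[leRHS]invrK lef_pV2 ?posrE ?mass_gt0//; last first.
  by rewrite invr_gt0 divr_gt0 ?exprn_gt0// expR_gt0.
by apply: le_trans (mass_ge r0); rewrite exprMn invfM invrK expRN exprVn.
Qed.

Lemma sq_moll_le r : 0 < r -> (sq (moll r) <= (expR 1 ^+ n / r ^+ n)%:E)%E.
Proof.
move=> r0; rewrite -[leRHS]mule1 -(integral_moll r0) -integralZl_EFin.
- apply: le_integral_EFin.
  + by apply: measurable_funX; exact: measurable_moll.
  + by apply: measurable_funM => //; exact: measurable_moll.
  + by move=> x; exact: sqr_ge0.
  + by move=> x; rewrite expr2 ler_wpM2r ?moll_le// moll_ge0.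
- exact: measurable_moll.
- by move=> x; exact: moll_ge0.
- by rewrite divr_ge0 ?exprn_ge0 ?expR_ge0// ltW.
Qed.

Lemma moll_support r (x : X) i : 0 < r -> r <= `|x ord0 i| -> moll r x = 0.
Proof. by rewrite /moll -lock; exact: kern_support. Qed.

Lemma partial_cutoff_le : exists2 C, 0 <= C &
  forall j r x, 0 < r -> `|partial j (cutoff r) x| <= C / r.
Proof.
have /choice [C HC] : forall j, exists C, 0 <= C /\
   forall c r x, `|kern c r (@kern_deriv R n j (fun=> bump1)) x| <= `|c| * C.
  by move=> j; have [C ? ?] := kern_bounded (@kern_deriv R n j (fun=> bump1)); exists C.
exists (\sum_j C j); first by rewrite sumr_ge0// => j _; case: (HC j).
move=> j r x r0; rewrite cutoffE partial_kern; apply: le_trans ((HC j).2 _ _ _) _.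
rewrite mul1r normfV gtr0_norm// mulrC ler_wpM2r ?invr_ge0 ?(ltW r0)//.
by rewrite (bigD1 j)//= lerDl sumr_ge0// => i _; case: (HC i).
Qed.

(** Two derivatives give 1/r^2, relaxed to 1/r by r >= 1, so that first and second derivatives obey
    bounds of the same form. *)
Lemma partial2_cutoff_le : exists2 C, 0 <= C &
  forall i j r x, 1 <= r -> `|partial i (partial j (cutoff r)) x| <= C / r.
Proof.
have /choice [C HC] : forall ij : 'I_n * 'I_n, exists C, 0 <= C /\
   forall c r x, `|kern c r (kern_deriv ij.1 (@kern_deriv R n ij.2 (fun=> bump1))) x| <= `|c| * C.
  by move=> ij; have [C ? ?] := kern_bounded (kern_deriv ij.1 (@kern_deriv R n ij.2 (fun=> bump1))); exists C.
exists (\sum_ij C ij); first by rewrite sumr_ge0// => j _; case: (HC j).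
move=> i j r x r1; have r0 : 0 < r by exact: lt_le_trans r1.
rewrite cutoffE !partial_kern; apply: le_trans ((HC (i, j)).2 _ _ _) _.
rewrite mul1r normrM normfV gtr0_norm// mulrC.
apply: (@le_trans _ _ (C (i, j) * r^-1)).
  by rewrite ler_wpM2l ?(HC _).1// ler_piMr ?invr_ge0 ?(ltW r0)// invf_le1.
rewrite ler_wpM2r ?invr_ge0 ?(ltW r0)//.
by rewrite (bigD1 (i, j))//= lerDl sumr_ge0// => k _; case: (HC k).
Qed.

End cutoff.

(** * Correlation with a kernel *)

Section integrable_EFin.
Context d (T : measurableType d) (R : realType) (mu : {measure set T -> \bar R}).
Implicit Types f g : T -> R.

Lemma integrableD_EFin f g : mu.-integrable setT (EFin \o f) ->
  mu.-integrable setT (EFin \o g) -> mu.-integrable setT (EFin \o (fun x => f x + g x)).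
Proof. by move=> fi gi; have := integrableD measurableT fi gi. Qed.

Lemma integrableB_EFin f g : mu.-integrable setT (EFin \o f) ->
  mu.-integrable setT (EFin \o g) -> mu.-integrable setT (EFin \o (fun x => f x - g x)).
Proof. by move=> fi gi; have := integrableB measurableT fi gi. Qed.

Lemma integrableZ_EFin (c : R) f : mu.-integrable setT (EFin \o f) ->
  mu.-integrable setT (EFin \o (fun x => c * f x)).
Proof. by move=> fi; have := integrableZl measurableT c fi. Qed.

Lemma ge0_integrable_EFin f : measurable_fun setT f -> (forall x, 0 <= f x) ->
  (\int[mu]_x (f x)%:E < +oo)%E -> mu.-integrable setT (EFin \o f).
Proof.
move=> mf f0 foo; apply/integrableP; split; first exact/measurable_EFinP.
by under eq_integral do rewrite gee0_abs ?lee_fin//.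
Qed.

End integrable_EFin.

Section square_integrable.
Context (R : realType) (n : nat).
Local Notation X := 'rV[R]_n.
Local Notation leb := (lebesgue_rV R n).

Lemma integrable_sq (f : X -> R) : measurable_fun setT f -> (sq f < +oo)%E ->
  leb.-integrable setT (EFin \o (fun x => f x ^+ 2)).
Proof.
move=> mf foo; apply/integrableP; split; first exact: measurable_sq.
by under eq_integral do rewrite /= ger0_norm ?sqr_ge0//.
Qed.

Lemma integrable_le (f g : X -> R) : measurable_fun setT f ->
  leb.-integrable setT (EFin \o g) -> (forall x, `|f x| <= g x) ->
  leb.-integrable setT (EFin \o f).
Proof.
move=> mf ig fg; apply: (le_integrable _ _ _ ig) => //; first exact/measurable_EFinP.
move=> x _ /=; rewrite lee_fin; apply: le_trans (fg x) _; exact: ler_norm.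
Qed.

Lemma integrable_mul (f g : X -> R) : measurable_fun setT f -> measurable_fun setT g ->
  (sq f < +oo)%E -> (sq g < +oo)%E -> leb.-integrable setT (EFin \o (fun x => f x * g x)).
Proof.
move=> mf mg foo goo.
apply: (@integrable_le _ (fun x => f x ^+ 2 + g x ^+ 2)).
- exact: measurable_funM.
- by apply: integrableD_EFin => //; exact: integrable_sq.
- move=> x; rewrite normrM -[f x ^+ 2]real_normK ?num_real// -[g x ^+ 2]real_normK ?num_real//.
  have := normr_ge0 (f x); have := normr_ge0 (g x); nra.
Qed.

Lemma Rintegral_sq (f : X -> R) (A : R) : (sq f <= A%:E)%E -> \int[leb]_x (f x ^+ 2) <= A.
Proof.
move=> fA; have f0 := sq_ge0 f; rewrite -lee_fin /Rintegral fineK//.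
by rewrite ge0_fin_numE// (le_lt_trans fA) ?ltry.
Qed.

(** The substitute for Cauchy-Schwarz; each use picks the weight [a] that makes a A and B / a
    comparable. *)
Lemma Rintegral_AMGM (f g : X -> R) (a A B : R) :
  measurable_fun setT f -> measurable_fun setT g -> 0 < a ->
  (sq f <= A%:E)%E -> (sq g <= B%:E)%E ->
  `|\int[leb]_x (f x * g x)| <= (a * A + a^-1 * B) / 2.
Proof.
move=> mf mg a0 fA gB.
have foo : (sq f < +oo)%E by rewrite (le_lt_trans fA) ?ltry.
have goo : (sq g < +oo)%E by rewrite (le_lt_trans gB) ?ltry.
have ifg := integrable_mul mf mg foo goo.
apply: le_trans (le_normr_Rintegral _ ifg) _ => //.
have i1 : leb.-integrable setT (EFin \o (fun x => (a / 2) * f x ^+ 2)).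
  by apply: integrableZ_EFin => //; exact: integrable_sq.
have i2 : leb.-integrable setT (EFin \o (fun x => (a^-1 / 2) * g x ^+ 2)).
  by apply: integrableZ_EFin => //; exact: integrable_sq.
apply: (@le_trans _ _ (\int[leb]_x ((a / 2) * f x ^+ 2 + (a^-1 / 2) * g x ^+ 2))).
  apply: le_Rintegral => //.
  - by move/integrable_norm : ifg; apply.
  - exact: integrableD_EFin.
  - move=> x _; rewrite normrM -[f x ^+ 2]real_normK ?num_real// -[g x ^+ 2]real_normK ?num_real//.
    set u := `|f x|; set v := `|g x|; rewrite -subr_ge0.
    have -> : a / 2 * u ^+ 2 + a^-1 / 2 * v ^+ 2 - u * v = a / 2 * (u - a^-1 * v) ^+ 2.
      by field; rewrite gt_eqF.
    by rewrite mulr_ge0 ?sqr_ge0// divr_ge0// ltW.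
rewrite RintegralD// !RintegralZl//; do ?exact: integrable_sq.
have := Rintegral_sq fA; have := Rintegral_sq gB => h1 h2.
rewrite mulrDl; apply: lerD.
  by rewrite mulrAC ler_wpM2r// ler_wpM2l// ltW.
by rewrite mulrAC ler_wpM2r// ler_wpM2l// invr_ge0 ltW.
Qed.

(** The variance, that is the integral of (g - m)^2 w with m the mean of g, is nonnegative. When the
    right side is finite, g w is integrable because |g| <= g^2 + 1. *)
Lemma jensen_sq (g w : X -> R) : measurable_fun setT g -> measurable_fun setT w ->
  (forall x, 0 <= w x) -> (\int[leb]_x (w x)%:E = 1)%E ->
  (((\int[leb]_x (g x * w x)) ^+ 2)%:E <= \int[leb]_x ((g x ^+ 2) * w x)%:E)%E.
Proof.
move=> mg mw w0 w1.
have [goo|] := ltP (\int[leb]_x ((g x ^+ 2) * w x)%:E)%E +oo%E; last first.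
  by rewrite leye_eq => /eqP ->; exact: leey.
have mg2w : measurable_fun setT (fun x => g x ^+ 2 * w x).
  by apply: measurable_funM => //; exact: measurable_funX.
have iw : leb.-integrable setT (EFin \o w).
  by apply: ge0_integrable_EFin => //; rewrite w1 ltry.
have ig2w : leb.-integrable setT (EFin \o (fun x => g x ^+ 2 * w x)).
  by apply: ge0_integrable_EFin => // x; rewrite mulr_ge0 ?sqr_ge0.
have igw : leb.-integrable setT (EFin \o (fun x => g x * w x)).
  apply: (@integrable_le _ (fun x => g x ^+ 2 * w x + w x)).
  - exact: measurable_funM.
  - exact: integrableD_EFin.
  - move=> x; rewrite normrM (ger0_norm (w0 x)) -[X in _ <= _ + X]mul1r -mulrDl ler_wpM2r//.
    rewrite -[g x ^+ 2]real_normK ?num_real//; have := normr_ge0 (g x); nra.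
set m := \int[leb]_x _.
have -> : (\int[leb]_x (g x ^+ 2 * w x)%:E = (\int[leb]_x (g x ^+ 2 * w x))%:E)%E.
  rewrite /Rintegral fineK// ge0_fin_numE//; apply: integral_ge0 => x _.
  by rewrite lee_fin mulr_ge0 ?sqr_ge0.
rewrite lee_fin -subr_ge0.
have i1 : leb.-integrable setT (EFin \o (fun x => (2 * m) * (g x * w x))).
  exact: integrableZ_EFin.
have i2 : leb.-integrable setT (EFin \o (fun x => (m ^+ 2) * w x)).
  exact: integrableZ_EFin.
have i3 : leb.-integrable setT (EFin \o (fun x => g x ^+ 2 * w x - (2 * m) * (g x * w x))).
  exact: integrableB_EFin.
have : 0 <= \int[leb]_x ((g x ^+ 2 * w x - (2 * m) * (g x * w x)) + m ^+ 2 * w x).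
  apply: Rintegral_ge0 => x _.
  rewrite (_ : _ + _ = (g x - m) ^+ 2 * w x); last by ring.
  by rewrite mulr_ge0 ?sqr_ge0.
rewrite RintegralD// RintegralB// !RintegralZl// -/m.
rewrite [X in _ + m ^+ 2 * X](_ : _ = 1); last by rewrite /Rintegral w1.
by congr (_ <= _); ring.
Qed.

(** Tonelli applies to the positive and negative parts, and the real integral is [fine] of their
    difference. *)
Lemma measurable_Rintegral2 (h : X * X -> R) : measurable_fun setT h ->
  measurable_fun setT (fun q => \int[leb]_y h (q, y)).
Proof.
move=> mh.
have mp : measurable_fun setT (fun q => \int[leb]_y (Num.max (h (q, y)) 0)%:E)%E.
  apply: (@measurable_fun_fubini_tonelli_F _ _ X X R leb (fun p => (Num.max (h p) 0)%:E)).
    by apply/measurable_EFinP; apply: measurable_maxr.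
  by move=> p; rewrite lee_fin le_max lexx orbT.
have mn : measurable_fun setT (fun q => \int[leb]_y (Num.max (- h (q, y)) 0)%:E)%E.
  apply: (@measurable_fun_fubini_tonelli_F _ _ X X R leb (fun p => (Num.max (- h p) 0)%:E)).
    by apply/measurable_EFinP; apply: measurable_maxr => //; exact: measurable_funN.
  by move=> p; rewrite lee_fin le_max lexx orbT.
rewrite (_ : (fun q => _) = (fun q => fine (\int[leb]_y (Num.max (h (q, y)) 0)%:E - \int[leb]_y (Num.max (- h (q, y)) 0)%:E)%E)).
  by apply: measurableT_comp => //; exact: emeasurable_funB.
apply/funext => q; rewrite /Rintegral integralE; congr (fine (_ - _)%E).
  by apply: eq_integral => y _; rewrite funeposE/= EFin_max.
by apply: eq_integral => y _; rewrite funenegE/= EFin_max.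
Qed.

End square_integrable.

Section convolution.
Context (R : realType) (n : nat).
Local Notation X := 'rV[R]_n.
Local Notation leb := (lebesgue_rV R n).

(* the correlation of f and k, i.e. the convolution of f with k(- .) *)
Definition correl (f k : X -> R) (q : X) : R := \int[leb]_y (f y * k ((y : X) - q)).

(** Hiding the parameters gives a single class, stable under partial derivatives, that contains the
    cutoffs, the mollifiers and all their derivatives. *)
Definition is_kern (k : X -> R) := exists c r a, 0 < r /\ k = kern c r a.

Lemma is_kern_partial j k : is_kern k -> is_kern (partial j k).
Proof. by move=> [c [r [a [r0 ->]]]]; exists (c / r), r, (kern_deriv j a); rewrite partial_kern. Qed.

Lemma is_kern_moll r : 0 < r -> is_kern (@moll R n r).
Proof. by move=> r0; exists (@mass R n r)^-1, r, (fun=> bump1 R); rewrite /moll -lock. Qed.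

Lemma is_kern_cutoff r : 0 < r -> is_kern (@cutoff R n r).
Proof. by move=> r0; exists 1, r, (fun=> bump1 R); rewrite cutoffE. Qed.

Lemma is_kern_measurable k : is_kern k -> measurable_fun setT k.
Proof. by move=> [c [r [a [r0 ->]]]]; exact: measurable_kern. Qed.

Lemma is_kern_derive j k (x : X) : is_kern k ->
  is_derive x (delta_mx ord0 j : X) k (partial j k x).
Proof. by move=> [c [r [a [r0 ->]]]]; rewrite partial_kern; exact: is_derive_kern. Qed.

Lemma is_kern_partialC i j k : is_kern k -> partial i (partial j k) = partial j (partial i k).
Proof. by move=> [c [r [a [r0 ->]]]]; exact: partial_kernC. Qed.

Lemma is_kern_test k (q : X) : is_kern k -> test_function (fun x => k (x - q)).
Proof. by move=> [c [r [a [r0 ->]]]]; exact: test_function_shift. Qed.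

Lemma is_kern_bound k : is_kern k -> exists M r, [/\ 0 <= M, 0 < r &
  forall x, `|k x| <= M /\ (k x != 0 -> forall i, `|x ord0 i| < r)].
Proof.
move=> [c [r [a [r0 ->]]]]; have [C C0 HC] := kern_bounded a.
exists (`|c| * C), r; split => //; first by rewrite mulr_ge0.
move=> x; split; first exact: HC.
by move=> + i; apply: contraNT; rewrite -leNgt => /(kern_support c a r0) ->.
Qed.

Definition ball_box (q : X) (r : R) : set X := ocbox (fun i => q ord0 i - r) (fun i => q ord0 i + r).

Lemma measurable_ball_box q r : measurable (ball_box q r).
Proof. exact: measurable_ocbox. Qed.

Lemma sq_indic_lty (q : X) r : (sq (\1_(ball_box q r) : X -> R) < +oo)%E.
Proof.
apply: le_lt_trans (lebesgue_ocbox_lty (fun i => q ord0 i - r) (fun i => q ord0 i + r)).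
rewrite [leRHS](_ : _ = \int[leb]_x (\1_(ball_box q r) x)%:E)%E; last first.
  by rewrite integral_indic ?setIT//; exact: measurable_ball_box.
have mi : measurable_fun setT (\1_(ball_box q r) : X -> R).
  by apply: measurable_indic; exact: measurable_ball_box.
apply: le_integral_EFin => //.
- exact: measurable_funX.
- by move=> x; rewrite indicE; case: (_ \in _); rewrite ?expr1n ?expr0n.
Qed.

Lemma mem_ball_box (q y : X) r : (forall i, `|(y - q) ord0 i| < r) -> y \in ball_box q r.
Proof.
move=> H; apply: mem_set => i /=; rewrite in_itv/=.
by have := H i; rewrite !mxE ltr_norml => /andP[h1 h2]; apply/andP; split; lra.
Qed.

Lemma measurable_tauN (f : X -> R) (q : X) : measurable_fun setT f ->
  measurable_fun setT (fun x : X => f (x - q)).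
Proof. exact: measurable_tau. Qed.

Lemma sq_kern_lty k : is_kern k -> (sq k < +oo)%E.
Proof.
move=> kk; have [M [r [M0 r0 HM]]] := is_kern_bound kk.
have mi : measurable_fun setT (\1_(ball_box 0 r) : X -> R).
  by apply: measurable_indic; exact: measurable_ball_box.
apply: (@le_lt_trans _ _ (sq (fun x : X => M * \1_(ball_box 0 r) x))).
  apply: sq_le; [exact: is_kern_measurable|exact: measurable_funM|].
  move=> x; have [kM kr] := HM x; rewrite normrM (ger0_norm M0).
  have [->|k0] := eqVneq (k x) 0; first by rewrite normr0 mulr_ge0.
  rewrite indicE mem_ball_box ?normr1 ?mulr1//.
  by move=> i; rewrite subr0; exact: kr.
by rewrite sqZ// lte_mul_pinfty ?lee_fin ?sqr_ge0// sq_indic_lty.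
Qed.

Lemma sq_kern_shift k (q : X) : is_kern k -> sq (fun x : X => k (x - q)) = sq k.
Proof. by move=> /is_kern_measurable mk; exact: sq_shift. Qed.

Lemma integrable_correl f k (q : X) : measurable_fun setT f -> (sq f < +oo)%E -> is_kern k ->
  leb.-integrable setT (EFin \o (fun y : X => f y * k (y - q))).
Proof.
move=> mf foo kk; apply: integrable_mul => //.
  by apply: measurable_tauN; exact: is_kern_measurable.
by rewrite sq_kern_shift// sq_kern_lty.
Qed.

Lemma measurable_correl f k : measurable_fun setT f -> measurable_fun setT k ->
  measurable_fun setT (correl f k).
Proof.
move=> mf mk; apply: (@measurable_Rintegral2 R n (fun p => f p.2 * k (p.2 - p.1))).
apply: measurable_funM; first exact: measurableT_comp mf measurable_snd.
have m2 : measurable_fun [set: X * X] (fun p => p.2 - p.1).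
  apply: measurable_fun_rV => i; under eq_fun do rewrite !mxE.
  by apply: measurable_funB; [exact: measurableT_comp (measurable_coord i) measurable_snd|
    exact: measurableT_comp (measurable_coord i) measurable_fst].
exact: measurableT_comp mk m2.
Qed.

Lemma correl_bounded f k (A B : R) q : measurable_fun setT f -> is_kern k ->
  (sq f <= A%:E)%E -> (sq k <= B%:E)%E -> forall a, 0 < a ->
  `|correl f k q| <= (a * A + a^-1 * B) / 2.
Proof.
move=> mf kk fA kB a a0; apply: Rintegral_AMGM => //.
  by apply: measurable_tauN; exact: is_kern_measurable.
by rewrite sq_kern_shift.
Qed.

(** Combined with [is_derive_correl], this says that the derivative of the mollification is the
    mollification of the weak derivative. *)
Lemma correl_weak_partial j f g k q : is_weak_partial j f g -> is_kern k ->
  correl f (partial j k) q = - correl g k q.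
Proof.
move=> fg kk; have := fg _ (is_kern_test q kk).
by rewrite partial_shift.
Qed.

Lemma kern_line_derive j k (p : X) (s : R) : is_kern k ->
  is_derive s (1 : R) (fun s : R => k (p - s *: delta_mx ord0 j))
    (- partial j k (p - s *: delta_mx ord0 j)).
Proof.
move=> kk; set v : X := delta_mx ord0 j.
have d1 : is_derive (- s) (1 : R) (fun t : R => k (p + t *: v)) (partial j k (p - s *: v)).
  have [H E] := is_kern_derive j (p - s *: v) kk.
  have fE : (fun h : R => h^-1 *: (((fun t : R => k (p + t *: v)) \o shift (- s)) (h *: 1) - k (p + (- s) *: v)))
     = (fun h : R => h^-1 *: ((k \o shift (p - s *: v)) (h *: v) - k (p - s *: v))).
    apply/funext => h /=; rewrite [_%:A]mulr1 scalerDl scaleNr.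
    by congr (_ *: (k _ - _)); rewrite addrCA.
  by apply: DeriveDef; [rewrite /derivable fE|rewrite /derive fE].
have d2 : is_derive s (1 : R) (fun s : R => - s) (- 1) by exact: is_deriveNid.
have := @is_derive1_comp R (fun t : R => k (p + t *: v)) (fun s : R => - s) s _ _ d1 d2.
rewrite mulrN1 (_ : _ \o _ = (fun s : R => k (p - s *: v)))//.
by apply/funext => t /=; rewrite scaleNr.
Qed.

(** Differentiation under the integral; the sign comes from q entering the kernel as y - q. *)
Lemma is_derive_correl j f k q : measurable_fun setT f -> (sq f < +oo)%E -> is_kern k ->
  is_derive q (delta_mx ord0 j : X) (correl f k) (- correl f (partial j k) q).
Proof.
move=> mf foo kk; apply: is_derive_line; set v : X := delta_mx ord0 j.
pose F (s : R) (y : X) := f y * k (y - (s *: v + q)).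
have dF (s : R) (y : X) : is_derive s (1 : R) (F^~ y) (f y * - partial j k (y - (s *: v + q))).
  have h := is_deriveZ (f y) (kern_line_derive j (y - q) s kk).
  rewrite (_ : F^~ y = f y \*: (fun s : R => k ((y - q) - s *: v))); last first.
    by apply/funext => t; rewrite /F opprD addrCA addrC.
  by apply: (is_derive_eq h); rewrite opprD [in RHS]addrCA [in RHS]addrC.
have [M [r [M0 r0 HM]]] := is_kern_bound (is_kern_partial j kk).
(* While the shift stays in []-1, 1[], the support of the kernel stays in one box of half-side r +
   1. *)
pose G (y : X) := M * (`|f y| * \1_(ball_box q (r + 1)) y).
have mi : measurable_fun setT (\1_(ball_box q (r + 1)) : X -> R).
  by apply: measurable_indic; exact: measurable_ball_box.
have G0 y : 0 <= G y by rewrite /G !mulr_ge0// indicE.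
have iG : leb.-integrable setT (EFin \o G).
  apply: integrableZ_EFin; apply: integrable_mul => //.
  - exact: measurableT_comp.
  - apply: le_lt_trans foo; apply: sq_le => //; first exact: measurableT_comp.
    by move=> x; rewrite normr_id.
  - exact: sq_indic_lty.
have GF (x : R) y : `]-1, 1[%classic x -> setT y -> `|partial1of2 F x y| <= G y.
  rewrite /= in_itv/= -ltr_norml => x1 _; rewrite /partial1of2 derive1E derive_val.
  rewrite /G normrM normrN mulrCA ler_wpM2l//.
  have [pM pr] := HM (y - (x *: v + q)).
  have [->|p0] := eqVneq (partial j k (y - (x *: v + q))) 0; first by rewrite normr0 mulr_ge0// indicE.
  rewrite indicE mem_ball_box ?mulr1// => i.
  have := pr p0 i; rewrite !mxE => h.
  have : `|x * (delta_mx ord0 j : X) ord0 i| <= `|x|.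
    by rewrite normrM ler_piMr// mxE; case: (_ && _); rewrite ?normr1 ?normr0.
  move: h; rewrite mxE; set u := x * _; rewrite !ltr_norml => /andP[h1 h2].
  by rewrite ler_norml => /andP[h3 h4]; apply/andP; split; lra.
have iF (x : R) : `]-1, 1[%classic x -> leb.-integrable setT (EFin \o F x).
  by move=> _; exact: integrable_correl.
have I0 : (`]-1, 1[%classic : set R) 0 by rewrite /= in_itv/= ltrN10 ltr01.
have dF1 (x : R) (y : X) : `]-1, 1[%classic x -> setT y -> derivable (F^~ y) x 1.
  by move=> _ _; apply: ex_derive.
have D1 := derivable_under_integral measurableT I0 iF dF1 G0 iG GF.
have D2 := differentiation_under_integral measurableT I0 iF dF1 G0 iG GF.
apply: DeriveDef; first exact: D1.
rewrite -derive1E; apply: etrans D2 _.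
transitivity (\int[leb]_y (-1 * (f y * partial j k ((y : X) - q)))).
  apply: eq_Rintegral => y _; rewrite /partial1of2 derive1E derive_val scale0r add0r.
  by rewrite mulrN mulN1r.
by rewrite RintegralZl ?mulN1r//; exact: integrable_correl (is_kern_partial _ _).
Qed.

End convolution.

(** * Mollification in L2 *)

Section mollification.
Context (R : realType) (n : nat).
Local Notation X := 'rV[R]_n.
Local Notation leb := (lebesgue_rV R n).

(** The mean over shifts z, weighted by the mollifier, of the squared L2 norm of f(. + z) - f. It
    controls both the mollification error and the commutator of mollification with products. *)
Definition moll_variation (r : R) (f : X -> R) : \bar R :=
  (\int[leb]_q \int[leb]_y ((f y - f q) ^+ 2 * moll r ((y : X) - q))%:E)%E.

Lemma measurable_comp_subr (k : X -> R) : measurable_fun setT k ->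
  measurable_fun setT (fun p : X * X => k (p.2 - p.1)).
Proof.
move=> mk; have m2 : measurable_fun [set: X * X] (fun p => p.2 - p.1).
  apply: measurable_fun_rV => i; under eq_fun do rewrite !mxE.
  by apply: measurable_funB; [exact: measurableT_comp (measurable_coord i) measurable_snd|
    exact: measurableT_comp (measurable_coord i) measurable_fst].
exact: measurableT_comp mk m2.
Qed.

Lemma measurable_comp_addr (k : X -> R) : measurable_fun setT k ->
  measurable_fun setT (fun p : X * X => k (p.1 + p.2)).
Proof. by move=> mk; exact: measurableT_comp mk (@measurable_rVD R n). Qed.

(** Substituting y = q + z and exchanging the integrals turns the inner one into a squared increment
    norm times the weight of z. The weight vanishes for shifts beyond r and has total mass 1. *)
Lemma moll_variation_le r (f : X -> R) (D : R) : 0 < r -> measurable_fun setT f ->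
  (forall z : X, (forall i, `|z ord0 i| <= r) -> (sq (fun x : X => f (x + z) - f x)%R <= D%:E)%E) ->
  (moll_variation r f <= D%:E)%E.
Proof.
move=> r0 mf H.
have mm := @measurable_moll R n r.
have m0 (p : X * X) : 0 <= (f (p.1 + p.2) - f p.1) ^+ 2 * moll r p.2.
  by apply: mulr_ge0; [exact: sqr_ge0|exact: moll_ge0].
have m1 : measurable_fun setT (fun p : X * X => (f (p.1 + p.2) - f p.1) ^+ 2 * moll r p.2).
  apply: measurable_funM; last exact: measurableT_comp mm measurable_snd.
  apply: measurable_funX; apply: measurable_funB; first exact: measurable_comp_addr.
  exact: measurableT_comp mf measurable_fst.
have E1 : moll_variation r f =
    (\int[leb]_q \int[leb]_z ((f ((q : X) + (z : X)) - f q) ^+ 2 * moll r z)%:E)%E.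
  apply: eq_integral => q _.
  have := @ge0_integral_shift R n q (fun y => ((f y - f q) ^+ 2 * moll r ((y : X) - q))%:E).
  move=> <-.
  - by apply: eq_integral => z _; rewrite addrK (addrC (z : X) q).
  - apply/measurable_EFinP; apply: measurable_funM; last exact: measurable_tauN.
    by apply: measurable_funX; exact: measurable_funB.
  - by move=> y; rewrite lee_fin mulr_ge0 ?sqr_ge0// moll_ge0.
rewrite E1 (@fubini_tonelli _ _ X X R leb leb (fun p => ((f (p.1 + p.2) - f p.1) ^+ 2 * moll r p.2)%:E)); last 2 first.
- exact/measurable_EFinP.
- by move=> p; rewrite lee_fin; exact: m0.
have D0 : 0 <= D.
  rewrite -lee_fin; apply: le_trans (H 0 _); first exact: sq_ge0.
  by move=> i; rewrite mxE normr0 ltW.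
apply: (@le_trans _ _ (\int[leb]_z (D * moll r z)%:E)%E); last first.
  rewrite integralZl_EFin; [|exact: mm|by move=> x; exact: moll_ge0|exact: D0].
  by rewrite (integral_moll n r0) mule1.
apply: ge0_le_integral; first exact: measurableT.
- by move=> z _; apply: integral_ge0 => q _; rewrite lee_fin; exact: (m0 (q, z)).
- apply: (@measurable_fun_fubini_tonelli_G _ _ X X R leb (fun p => ((f (p.1 + p.2) - f p.1) ^+ 2 * moll r p.2)%:E)).
    exact/measurable_EFinP.
  by move=> p; rewrite lee_fin; exact: m0.
- by apply/measurable_EFinP; apply: measurable_funM; [exact: measurable_cst|exact: mm].
move=> z _ /=.
rewrite [leLHS](_ : _ = (moll r z)%:E * sq (fun x : X => f (x + z) - f x)%R)%E; last first.
  rewrite -integralZl_EFin; last exact: moll_ge0.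
  - by apply: eq_integral => q _; rewrite mulrC.
  - apply: measurable_funX; apply: measurable_funB; [exact: measurable_tau|exact: mf].
  - by move=> x; exact: sqr_ge0.
have [rz|/negP zr] := boolP [forall i, `|z ord0 i| <= r].
  rewrite [in leRHS]mulrC EFinM; apply: (@lee_wpmul2l R (moll r z)%:E); first by rewrite lee_fin; exact: moll_ge0.
  by apply: H => i; exact: (forallP rz).
have [i ri] : exists i, r <= `|z ord0 i|.
  by move/negP: zr; rewrite negb_forall => /existsP[i]; rewrite -ltNge => /ltW ?; exists i.
by rewrite (moll_support r0 ri) mul0e mulr0.
Qed.

Lemma correl_moll_sub r (f : X -> R) q : 0 < r -> measurable_fun setT f -> (sq f < +oo)%E ->
  correl f (moll r) q - f q = \int[leb]_y ((f y - f q) * moll r ((y : X) - q)).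
Proof.
move=> r0 mf foo.
have im : leb.-integrable setT (EFin \o (fun y : X => moll r (y - q))).
  apply: ge0_integrable_EFin.
  - by apply: measurable_tauN; exact: measurable_moll.
  - by move=> x; exact: moll_ge0.
  - have := @ge0_integral_shift R n (- q) (fun y => (moll r y)%:E).
    move=> ->; first by rewrite integral_moll ?ltry.
      by apply/measurable_EFinP; exact: measurable_moll.
    by move=> x; rewrite lee_fin moll_ge0.
have m1 : \int[leb]_y (moll r ((y : X) - q)) = 1.
  rewrite (@Rintegral_shift R n (- q) (moll r)); last exact: measurable_moll.
  by rewrite /Rintegral integral_moll.
under eq_Rintegral do rewrite mulrBl.
rewrite RintegralB//; last 2 first.
- by apply: integrable_correl => //; exact: is_kern_moll.
- exact: integrableZ_EFin.
by rewrite RintegralZl// m1 mulr1.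
Qed.

Lemma integral_moll_shift r (q : X) : 0 < r -> (\int[leb]_y (moll r ((y : X) - q)%R)%:E = 1)%E.
Proof.
move=> r0; have := @ge0_integral_shift R n (- q) (fun y => (moll r y)%:E).
move=> ->; first exact: integral_moll.
  by apply/measurable_EFinP; exact: measurable_moll.
by move=> x; rewrite lee_fin moll_ge0.
Qed.

(** Jensen at each point q: the error is the mean of f y - f q against a probability density. *)
Lemma sq_correl_moll_sub r (f : X -> R) : 0 < r -> measurable_fun setT f -> (sq f < +oo)%E ->
  (sq (fun q => correl f (moll r) q - f q)%R <= moll_variation r f)%E.
Proof.
move=> r0 mf foo; have mm := @measurable_moll R n r.
have m0 (p : X * X) : 0 <= (f p.2 - f p.1) ^+ 2 * moll r (p.2 - p.1).
  by apply: mulr_ge0; [exact: sqr_ge0|exact: moll_ge0].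
have m1 : measurable_fun setT (fun p : X * X => (f p.2 - f p.1) ^+ 2 * moll r (p.2 - p.1)).
  apply: measurable_funM; last exact: measurable_comp_subr.
  apply: measurable_funX; apply: measurable_funB; [exact: measurableT_comp mf measurable_snd|
    exact: measurableT_comp mf measurable_fst].
apply: ge0_le_integral => //.
- by move=> q _; rewrite lee_fin sqr_ge0.
- by apply: measurable_sq; apply: measurable_funB => //; exact: measurable_correl.
- apply: (@measurable_fun_fubini_tonelli_F _ _ X X R leb (fun p => ((f p.2 - f p.1) ^+ 2 * moll r (p.2 - p.1))%:E)).
    exact/measurable_EFinP.
  by move=> p; rewrite lee_fin; exact: m0.
move=> q _; rewrite correl_moll_sub//.
apply: (@jensen_sq R n (fun y => f y - f q) (fun y => moll r (y - q))).
- exact: measurable_funB.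
- exact: measurable_tauN.
- by move=> x; exact: moll_ge0.
- exact: integral_moll_shift.
Qed.

(** Tonelli, then evenness of the mollifier: it has integral 1 in q as well as in y. *)
Lemma integral_correl_moll r (h : X -> R) : 0 < r -> measurable_fun setT h -> (forall x, 0 <= h x) ->
  (\int[leb]_q \int[leb]_y (h y * moll r ((y : X) - q))%:E = \int[leb]_y (h y)%:E)%E.
Proof.
move=> r0 mh h0; have mm := @measurable_moll R n r.
have m0 (p : X * X) : 0 <= h p.2 * moll r (p.2 - p.1).
  by apply: mulr_ge0; [exact: h0|exact: moll_ge0].
have m1 : measurable_fun setT (fun p : X * X => h p.2 * moll r (p.2 - p.1)).
  by apply: measurable_funM; [exact: measurableT_comp mh measurable_snd|exact: measurable_comp_subr].
rewrite (@fubini_tonelli _ _ X X R leb leb (fun p => (h p.2 * moll r (p.2 - p.1))%:E)); last 2 first.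
- exact/measurable_EFinP.
- by move=> p; rewrite lee_fin; exact: m0.
apply: eq_integral => y _ /=.
rewrite integralZl_EFin//; last 2 first.
- have := measurable_tauN y mm.
  by under [X in _ -> measurable_fun _ X]eq_fun do rewrite -mollN opprB.
- by move=> x; exact: moll_ge0.
rewrite [X in (_ * X)%E](_ : _ = 1%E) ?mule1//.
rewrite -(integral_moll_shift y r0); apply: eq_integral => q _.
by rewrite -mollN opprB.
Qed.

Lemma sq_correl_moll r (f : X -> R) : 0 < r -> measurable_fun setT f ->
  (sq (correl f (moll r)) <= sq f)%E.
Proof.
move=> r0 mf; have mm := @measurable_moll R n r.
rewrite /sq -[leRHS](@integral_correl_moll r (fun x => f x ^+ 2))//; last 2 first.
- exact: measurable_funX.
- by move=> x; exact: sqr_ge0.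
have m0 (p : X * X) : 0 <= f p.2 ^+ 2 * moll r (p.2 - p.1).
  by apply: mulr_ge0; [exact: sqr_ge0|exact: moll_ge0].
have m1 : measurable_fun setT (fun p : X * X => f p.2 ^+ 2 * moll r (p.2 - p.1)).
  apply: measurable_funM; last exact: measurable_comp_subr.
  by apply: measurable_funX; exact: measurableT_comp mf measurable_snd.
apply: ge0_le_integral => //.
- by move=> q _; rewrite lee_fin sqr_ge0.
- by apply: measurable_sq; exact: measurable_correl.
- apply: (@measurable_fun_fubini_tonelli_F _ _ X X R leb (fun p => (f p.2 ^+ 2 * moll r (p.2 - p.1))%:E)).
    exact/measurable_EFinP.
  by move=> p; rewrite lee_fin; exact: m0.
move=> q _; apply: (@jensen_sq R n f (fun y => moll r (y - q))) => //.
- exact: measurable_tauN.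
- by move=> x; exact: moll_ge0.
- exact: integral_moll_shift.
Qed.

End mollification.

(** * Mollification estimates for H1 functions *)

Section translation_estimate.
Context (R : realType) (n : nat).
Local Notation X := 'rV[R]_n.
Local Notation leb := (lebesgue_rV R n).

Lemma integrable_cube (N : R) (f : X -> R) (M : R) : measurable_fun setT f ->
  (forall x, cube N x -> `|f x| <= M) -> leb.-integrable (cube N) (EFin \o f).
Proof.
move=> mf fM; apply: measurable_bounded_integrable.
- exact: measurable_cube.
- exact: lebesgue_ocbox_lty.
- exact: measurable_funTS.
- exists M; split; first exact: num_real.
  by move=> m Mm x Nx /=; exact: le_trans (fM x Nx) (ltW Mm).
Qed.

(** A cube has finite measure, so the constant |M| is an integrable dominating function. *)
Lemma is_derive_integral_cube (N M : R) (phi dphi : R -> X -> R) (s : R) :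
  (forall t, measurable_fun setT (phi t)) ->
  (forall t, exists M', forall x, cube N x -> `|phi t x| <= M') ->
  (forall t x, cube N x -> is_derive t (1 : R) (phi^~ x) (dphi t x)) ->
  (forall t x, cube N x -> `|dphi t x| <= M) ->
  is_derive s (1 : R) (fun t => \int[leb]_(x in cube N) phi t x)
    (\int[leb]_(x in cube N) dphi s x).
Proof.
move=> mphi bphi dp bd.
pose G (x : X) := `|M|.
have iG : leb.-integrable (cube N) (EFin \o G).
  by apply: (@integrable_cube _ _ `|M|); [exact: measurable_cst|move=> x _; rewrite normr_id].
have d1E t x : cube N x -> partial1of2 phi t x = dphi t x.
  by move=> Nx; have h := dp t x Nx; rewrite /partial1of2 derive1E derive_val.
have GF (t : R) (x : X) : `](s - 1), (s + 1)[%classic t -> cube N x -> `|partial1of2 phi t x| <= G x.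
  by move=> _ Nx; rewrite d1E// (le_trans (bd t x Nx))// ler_norm.
have iphi (t : R) : `](s - 1), (s + 1)[%classic t -> leb.-integrable (cube N) (EFin \o phi t).
  by move=> _; have [M' HM'] := bphi t; exact: integrable_cube HM'.
have I0 : (`](s - 1), (s + 1)[%classic : set R) s by rewrite /= in_itv/=; lra.
have dphi1 (t : R) (x : X) : `](s - 1), (s + 1)[%classic t -> cube N x -> derivable (phi^~ x) t 1.
  by move=> _ Nx; have h := dp t x Nx; apply: ex_derive.
have G0 x : 0 <= G x by rewrite /G normr_ge0.
have mN := @measurable_cube R n N.
have D1 := derivable_under_integral mN I0 iphi dphi1 G0 iG GF.
have D2 := differentiation_under_integral mN I0 iphi dphi1 G0 iG GF.
apply: DeriveDef; first exact: D1.
rewrite -derive1E; apply: etrans D2 _.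
by apply: eq_Rintegral => x /set_mem; exact: d1E.
Qed.

Lemma MVT_bound (f df : R -> R) (K t : R) : (forall s, is_derive s (1 : R) f (df s)) ->
  (forall s, `|df s| <= K) -> `|f t - f 0| <= K * `|t|.
Proof.
move=> dff dK.
have cf (a b : R) : {within `[a, b], continuous f}.
  apply: derivable_within_continuous => x _; exact: ex_derive.
have [t0|t0|->] := ltgtP t 0; last by rewrite subrr !normr0 mulr0.
- have [c _ E] := MVT t0 (fun x _ => dff x) (cf _ _).
  by rewrite distrC E normrM sub0r normrN ler_wpM2r.
- have [c _ E] := MVT t0 (fun x _ => dff x) (cf _ _).
  by rewrite E normrM subr0 ler_wpM2r.
Qed.

Lemma line_derive (f : X -> R) (v x : X) (s df : R) : is_derive (x + s *: v) v f df ->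
  is_derive s (1 : R) (fun t : R => f (x + t *: v)) df.
Proof.
move=> [H E].
have fE : (fun h : R => h^-1 *: (((fun t : R => f (x + t *: v)) \o shift s) (h *: 1) - f (x + s *: v)))
     = (fun h : R => h^-1 *: ((f \o shift (x + s *: v)) (h *: v) - f (x + s *: v))).
  apply/funext => h /=; rewrite [_%:A]mulr1 scalerDl.
  by congr (_ *: (f _ - _)); rewrite addrCA.
by apply: DeriveDef; [rewrite /derivable fE|rewrite /derive fE].
Qed.

Lemma correl_bound k (A : R) : is_kern k -> exists M, forall (f : X -> R) (q : X),
  measurable_fun setT f -> (sq f <= A%:E)%E -> `|correl f k q| <= M.
Proof.
move=> kk; have kfin : sq k \is a fin_num by rewrite ge0_fin_numE ?sq_ge0// sq_kern_lty.
exists ((1 * A + 1^-1 * fine (sq k)) / 2) => f q mf fA.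
by apply: correl_bounded => //; rewrite fineK.
Qed.

Lemma sq_fin (f : X -> R) : (sq f < +oo)%E -> sq f = (fine (sq f))%:E.
Proof. by move=> foo; rewrite fineK// ge0_fin_numE ?sq_ge0. Qed.

Lemma sq_restrict_cube (N : R) (f : X -> R) :
  sq (fun x : X => f x * \1_(cube N) x) = (\int[leb]_(x in cube N) (f x ^+ 2)%:E)%E.
Proof.
rewrite [RHS]integral_mkcond; apply: eq_integral => x _.
by rewrite patchE indicE; case: (_ \in _); rewrite ?mulr1// mulr0 expr0n.
Qed.

Lemma sq_cvg_cube (f : X -> R) (K : \bar R) : measurable_fun setT f ->
  (forall N : nat, sq (fun x : X => (f x * \1_(cube N%:R) x)%R) <= K)%E -> (sq f <= K)%E.
Proof.
move=> mf H.
have : (\int[leb]_(x in cube k%:R) (f x ^+ 2)%:E @[k --> \oo] -->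
    \int[leb]_(x in \bigcup_k (@cube R n k%:R)) (f x ^+ 2)%:E)%E.
  apply: ge0_nondecreasing_set_cvg_integral => //.
  - exact: cube_nd.
  - by move=> k; exact: measurable_cube.
  - by move=> k; apply: measurable_funTS; exact: measurable_sq.
  - by move=> k x _; rewrite lee_fin sqr_ge0.
rewrite bigcup_cube -[X in _ --> X]/(sq f) => /cvg_lim <-//.
apply: lime_le.
  apply: ereal_nondecreasing_is_cvgn; apply: ge0_nondecreasing_set_nondecreasing_integral => //.
  - exact: cube_nd.
  - by move=> k; exact: measurable_cube.
  - by move=> k; apply: measurable_funTS; exact: measurable_sq.
  - by move=> k x _; rewrite lee_fin sqr_ge0.
by apply: nearW => k; rewrite -sq_restrict_cube.
Qed.

(** A duality argument: the increment w is paired on a cube with F translated by s v. Between s = 0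
    and s = t the pairing changes by W, the integral of w^2, while its derivative in s pairs w with
    the mollified g. The mean value theorem and the weight 1/|t| give W <= W/2 + t^2 S/2, and W is
    finite on the cube, so it can be absorbed. *)
Lemma sq_tau_correl (f g : X -> R) (S : R) (j : 'I_n) (t d : R) : 0 < d ->
  measurable_fun setT f -> (sq f < +oo)%E -> measurable_fun setT g -> (sq g <= S%:E)%E ->
  is_weak_partial j f g ->
  (sq (fun q : X => correl f (moll d) (q + t *: delta_mx ord0 j) - correl f (moll d) q)%R
    <= (t ^+ 2 * S)%:E)%E.
Proof.
move=> d0 mf foo mg gS fg; set v : X := delta_mx ord0 j.
have kk := @is_kern_moll R n d d0.
set F := correl f (moll d).
have mF : measurable_fun setT F by apply: measurable_correl => //; exact: measurable_moll.
have mG : measurable_fun setT (correl g (moll d)) by apply: measurable_correl => //; exact: measurable_moll.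
have goo : (sq g < +oo)%E by rewrite (le_lt_trans gS)// ltry.
have S0 : 0 <= S by rewrite -lee_fin; apply: le_trans gS; exact: sq_ge0.
have [->|t0] := eqVneq t 0.
  rewrite /sq integral0_eq ?lee_fin ?mulr_ge0 ?sqr_ge0// => x _.
  by rewrite scale0r addr0 subrr expr0n.
have [MF HF] := correl_bound (fine (sq f)) kk.
have {}HF q : `|F q| <= MF by apply: HF => //; rewrite -sq_fin.
have [MG HG] := correl_bound S kk.
have {}HG q : `|correl g (moll d) q| <= MG by exact: HG.
pose w (x : X) := F (x + t *: v) - F x.
have mw : measurable_fun setT w by apply: measurable_funB; [exact: (measurable_tau _ mF)|exact: mF].
have wB x : `|w x| <= MF *+ 2.
  by rewrite /w (le_trans (ler_normB _ _))// mulr2n lerD.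
apply: sq_cvg_cube => // N.
pose phi (s : R) (x : X) := w x * F (x + s *: v).
pose dphi (s : R) (x : X) := w x * correl g (moll d) (x + s *: v).
have mphi s : measurable_fun setT (phi s).
  by apply: measurable_funM; [exact: mw|exact: (measurable_tau _ mF)].
have bphi s : exists M', forall x, cube N%:R x -> `|phi s x| <= M'.
  by exists (MF *+ 2 * MF) => x _; rewrite normrM ler_pM.
have dp s x : cube N%:R x -> is_derive s (1 : R) (phi^~ x) (dphi s x).
  move=> _; have h := is_derive_correl j (x + s *: v) mf foo kk.
  rewrite (correl_weak_partial _ fg kk) opprK in h.
  exact: (is_deriveZ (w x) (line_derive h)).
have bd s x : cube N%:R x -> `|dphi s x| <= MF *+ 2 * MG.
  by move=> _; rewrite normrM ler_pM.
pose W := \int[leb]_(x in cube N%:R) (w x ^+ 2).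
have mi : measurable_fun setT (\1_(cube N%:R) : X -> R) by apply: measurable_indic; exact: measurable_cube.
have mwi : measurable_fun setT (fun x => w x * \1_(cube N%:R) x) by exact: measurable_funM.
have iw2 : leb.-integrable (cube N%:R) (EFin \o (fun x => w x ^+ 2)).
  apply: (@integrable_cube _ _ ((MF *+ 2) ^+ 2)); first exact: measurable_funX.
  by move=> x _; rewrite normrX lerXn2r ?nnegrE// (le_trans (normr_ge0 _) (wB x)).
have WE : sq (fun x => w x * \1_(cube N%:R) x) = W%:E.
  rewrite sq_restrict_cube /W /Rintegral fineK//.
  by apply: integrable_fin_num => //; exact: measurable_cube.
rewrite WE lee_fin.
have a0 : 0 < `|t|^-1 by rewrite invr_gt0 normr_gt0.
pose K := (`|t|^-1 * W + `|t| * S) / 2.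
have dK s : `|\int[leb]_(x in cube N%:R) dphi s x| <= K.
  rewrite Rintegral_mkcond (_ : \int[leb]_x _ =
    \int[leb]_x ((w x * \1_(cube N%:R) x) * correl g (moll d) ((x : X) + s *: v))); last first.
    apply: eq_Rintegral => x _; rewrite patchE indicE /dphi.
    by case: (_ \in _); rewrite ?mulr1// mulr0 mul0r.
  rewrite /K [X in _ + X * S](_ : _ = (`|t|^-1)^-1); last by rewrite invrK.
  apply: Rintegral_AMGM => //.
  - exact: measurable_tau.
  - by rewrite WE.
  - by rewrite sq_shift//; apply: le_trans gS; exact: sq_correl_moll.
have := MVT_bound t (fun s => is_derive_integral_cube s mphi bphi dp bd) dK.
rewrite (_ : _ - _ = W); last first.
  rewrite -RintegralB; last 3 first.
  - exact: measurable_cube.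
  - by have [M' HM'] := bphi t; exact: integrable_cube HM'.
  - by have [M' HM'] := bphi 0; exact: integrable_cube HM'.
  by apply: eq_Rintegral => x _; rewrite /phi scale0r addr0 -mulrBr expr2.
move=> /(le_trans (ler_norm _)).
rewrite /K mulrAC mulrDl mulrAC mulVf ?normr_eq0// mul1r mulrAC -expr2 real_normK ?num_real//.
lra.
Qed.

End translation_estimate.

Section H1_estimates.
Context (R : realType) (n : nat).
Local Notation X := 'rV[R]_n.
Local Notation leb := (lebesgue_rV R n).

(** One number S bounds the squared norms of the function and of all its first derivatives;
    estimates uniform over such data become uniform in time for the solution. *)
Definition H1_data (f : X -> R) (g : 'I_n -> X -> R) (S : R) :=
  [/\ measurable_fun setT f, forall j, measurable_fun setT (g j), (sq f <= S%:E)%E,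
    forall j, (sq (g j) <= S%:E)%E & forall j, is_weak_partial j f (g j)].

Lemma H1_data_ge0 f g S : H1_data f g S -> 0 <= S.
Proof. by move=> [_ _ fS _ _]; rewrite -lee_fin; apply: le_trans fS; exact: sq_ge0. Qed.

Lemma H1_data_lty f g S : H1_data f g S -> (sq f < +oo)%E.
Proof. by move=> [_ _ fS _ _]; rewrite (le_lt_trans fS)// ltry. Qed.

Lemma sq_correl_cvg (f : X -> R) (e : R) : measurable_fun setT f -> (sq f < +oo)%E -> 0 < e ->
  exists2 d, 0 < d & (sq (fun q : X => correl f (moll d) q - f q)%R <= e%:E)%E.
Proof.
move=> mf foo e0; have [_ H] := L2_translation_continuousE mf foo.
have [d d0 Hd] := H e e0; exists d => //.
by apply: le_trans (sq_correl_moll_sub d0 mf foo) _; exact: moll_variation_le.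
Qed.

(** The bound for the mollification passes to f, since mollifications converge to f in L2; the
    factor 2 is the price of [sqB]. *)
Lemma sq_tau_coord f g S (j : 'I_n) (t : R) : H1_data f g S ->
  (sq (fun x : X => f (x + t *: delta_mx ord0 j) - f x)%R <= (2 * (t ^+ 2 * S))%:E)%E.
Proof.
move=> D; have foo := H1_data_lty D; have [mf mg fS gS fg] := D.
set v : X := delta_mx ord0 j.
apply/lee_addgt0Pr => e e0.
have e80 : 0 < e / 8 by rewrite divr_gt0.
have [d d0 Hd] := sq_correl_cvg mf foo e80.
set F := correl f (moll d).
have mF : measurable_fun setT F by apply: measurable_correl => //; exact: measurable_moll.
have mD : measurable_fun setT (fun x => F x - f x) by exact: measurable_funB.
rewrite (_ : (fun x : X => _) = (fun x : X => (F (x + t *: v) - F x) -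
   ((F (x + t *: v) - f (x + t *: v)) - (F x - f x)))); last by apply/funext => x; ring.
apply: le_trans; first apply: sqB.
- by apply: measurable_funB; [exact: (measurable_tau _ mF)|exact: mF].
- by apply: measurable_funB; [exact: (measurable_tau _ mD)|exact: mD].
apply: (@le_trans _ _ (2%:E * (t ^+ 2 * S)%:E + 2%:E * (2%:E * (e / 8)%:E + 2%:E * (e / 8)%:E))%E).
  apply: leeD.
    by rewrite lee_pmul2l//; exact: (sq_tau_correl _ d0 mf foo (mg j) (gS j) (fg j)).
  rewrite lee_pmul2l//; apply: le_trans; first exact: (sqB (measurable_tau _ mD) mD).
  by rewrite (sq_shift _ mD); apply: leeD; rewrite lee_pmul2l.
by rewrite -!(EFinM, EFinD) lee_fin; lra.
Qed.

(** The coordinates are shifted one at a time; each additional one replaces C by 4 + 2 C. *)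
Lemma sq_tau : exists2 C, 0 <= C & forall f g S r (z : X), H1_data f g S ->
  (forall i, `|z ord0 i| <= r) -> (sq (fun x : X => f (x + z) - f x)%R <= (C * (r ^+ 2 * S))%:E)%E.
Proof.
suff [C C0 H] : exists2 C, 0 <= C & forall f g S r (z : X), H1_data f g S ->
  (forall i, `|z ord0 i| <= r) ->
  (sq (fun x : X => f (x + \sum_(i <- index_enum 'I_n) z ord0 i *: delta_mx ord0 i) - f x)%R
    <= (C * (r ^+ 2 * S))%:E)%E.
  by exists C => // f g S r z D zr; have := H f g S r z D zr; rewrite -row_sum_delta.
elim: (index_enum 'I_n) => [|i s [C C0 H]].
  exists 0 => // f g S r z D zr; rewrite /sq integral0_eq ?mul0r// => x _.
  by rewrite big_nil addr0 subrr expr0n.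
exists (4 + 2 * C); first lra.
move=> f g S r z D zr; have [mf mg fS gS fg] := D.
under eq_fun do rewrite big_cons.
set w := \sum_(i <- s) _; set v := z ord0 i *: _.
rewrite (_ : (fun x : X => _) = (fun x : X => (f ((x + w) + v) - f (x + w)) + (f (x + w) - f x))); last first.
  by apply/funext => x; rewrite (addrC v) addrA; ring.
have m1 : measurable_fun setT (fun x : X => f (x + v) - f x).
  by apply: measurable_funB; [exact: (measurable_tau _ mf)|exact: mf].
have m2 : measurable_fun setT (fun x : X => f (x + w) - f x).
  by apply: measurable_funB; [exact: (measurable_tau _ mf)|exact: mf].
apply: le_trans; first exact: (sqD (measurable_tau w m1) m2).
rewrite (sq_shift w m1).
have S0 := H1_data_ge0 D.
apply: (@le_trans _ _ (2%:E * (2 * (r ^+ 2 * S))%:E + 2%:E * (C * (r ^+ 2 * S))%:E)%E).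
  apply: leeD; rewrite lee_pmul2l//; last exact: H.
  apply: le_trans (sq_tau_coord _ _ D) _; rewrite lee_fin ler_wpM2l// ler_wpM2r//.
  have zi := zr i; rewrite -[z ord0 i ^+ 2]real_normK ?num_real// lerXn2r ?nnegrE//.
  exact: le_trans zi.
by rewrite -!(EFinM, EFinD) lee_fin; lra.
Qed.

Lemma moll_variation_H1 : exists2 C, 0 <= C & forall f g S r, H1_data f g S -> 0 < r ->
  (moll_variation r f <= (C * (r ^+ 2 * S))%:E)%E.
Proof.
have [C C0 H] := sq_tau; exists C => // f g S r D r0.
have [mf mg fS gS fg] := D.
by apply: moll_variation_le => // z zr; exact: H zr.
Qed.

End H1_estimates.

Lemma integralD_EFin_ge0 d (T : measurableType d) (R : realType)
    (mu : {measure set T -> \bar R}) (p q : T -> R) :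
  measurable_fun setT p -> measurable_fun setT q ->
  (forall x, 0 <= p x) -> (forall x, 0 <= q x) ->
  (\int[mu]_x (p x)%:E + \int[mu]_x (q x)%:E = \int[mu]_x (p x + q x)%:E)%E.
Proof.
move=> mp mq p0 q0; rewrite -ge0_integralD//.
all: try exact/measurable_EFinP.
all: by move=> x _; rewrite lee_fin.
Qed.

(** * Growth of mollifications along the scales 4^-k *)

Section dyadic.
Context (R : realType) (n : nat) (n3 : (n <= 3)%N).
Local Notation X := 'rV[R]_n.
Local Notation leb := (lebesgue_rV R n).

(* In dimension n <= 3 the mollifier at scale 4^-k has square norm at most
   C 64^k, so that going from scale 4^-k to 4^-(k+1) changes a mollified H1
   function by at most a multiple of 4^-k 8^k = 2^k in sup norm. *)
Definition scale (k : nat) : R := (4^-1) ^+ k.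

Lemma scale_gt0 k : 0 < scale k.
Proof. by rewrite exprn_gt0// invr_gt0. Qed.

Lemma scale_le1 k : scale k <= 1.
Proof. by rewrite exprn_ile1 ?invr_ge0// invf_le1// ler1n. Qed.

Lemma sq_moll_scale k : (sq (@moll R n (scale k)) <= (expR 1 ^+ n * 64 ^+ k)%:E)%E.
Proof.
apply: le_trans (sq_moll_le n (scale_gt0 k)) _; rewrite lee_fin ler_wpM2l ?exprn_ge0 ?expR_ge0//.
apply: (@le_trans _ _ (scale k ^+ 3)^-1).
  rewrite lef_pV2 ?posrE ?exprn_gt0 ?scale_gt0//.
  exact: (ler_wiXn2l (ltW (scale_gt0 k)) (scale_le1 k) n3).
by rewrite /scale exprAC (_ : (4^-1 : R) ^+ 3 = 64^-1) ?exprVn ?invrK//; field.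
Qed.

Lemma correl_moll_sup (h : X -> R) (B r : R) q : 0 < r -> measurable_fun setT h ->
  (forall x, `|h x| <= B) -> `|correl h (moll r) q| <= B.
Proof.
move=> r0 mh hB; have mm := @measurable_moll R n r.
have im : leb.-integrable setT (EFin \o (fun y : X => moll r (y - q))).
  apply: ge0_integrable_EFin.
  - exact: (measurable_tauN _ mm).
  - by move=> x; exact: moll_ge0.
  - by rewrite (integral_moll_shift q r0) ltry.
have hm y : `|h y * moll r (y - q)| <= B * moll r (y - q).
  by rewrite normrM (ger0_norm (moll_ge0 _ r0)); apply: ler_wpM2r; [exact: moll_ge0|exact: hB].
have iBm := integrableZ_EFin B im.
have ih : leb.-integrable setT (EFin \o (fun y : X => h y * moll r (y - q))).
  apply: (integrable_le _ iBm hm).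
  by apply: measurable_funM; [exact: mh|exact: (measurable_tauN _ mm)].
apply: le_trans (le_normr_Rintegral measurableT ih) _.
apply: (@le_trans _ _ (\int[leb]_y (B * moll r ((y : X) - q)))).
  apply: le_Rintegral; [exact: measurableT| |exact: iBm|by move=> y _; exact: hm].
  exact: integrable_norm ih.
rewrite RintegralZl; [|exact: measurableT|exact: im].
by rewrite /Rintegral (integral_moll_shift q r0) /= mulr1.
Qed.

(** Induction on k, writing f = (f - F) + F with F the mollification at scale k. Mollifying F again
    does not raise its sup norm, and f - F is small in L2, which compensates the large norm of the
    finer mollifier. *)
Lemma correl_sup_scale (S : R) : exists2 D, 0 <= D & forall (f : X -> R) g k q, H1_data f g S ->
  `|correl f (moll (scale k)) q| <= D * 2 ^+ k.
Proof.
have [C1 C10 HC1] := @moll_variation_H1 R n.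
(* No function satisfies [H1_data] with S negative, so any constant does in that case. *)
have [S0|S0] := ltP S 0.
  by exists 0 => // f g k q /H1_data_ge0; rewrite leNgt S0.
set E1 : R := expR 1 ^+ n; have E10 : 0 <= E1 by rewrite exprn_ge0// expR_ge0.
exists (S + C1 * S + 64 * E1); first by rewrite !addr_ge0// mulr_ge0.
have Q0 : 0 <= C1 * S by rewrite mulr_ge0.
move=> f g k q D; have foo := H1_data_lty D; have [mf mg fS gS fg] := D.
have kk j := is_kern_moll n (scale_gt0 j).
elim: k q => [|k IH] q.
  rewrite expr0 mulr1; have fS' : (sq f <= S%:E)%E by [].
  have := correl_bounded q mf (kk 0%N) fS' (sq_moll_scale 0) (ltr01).
  rewrite -/E1 => /le_trans; apply; rewrite invr1 !mul1r expr0 mulr1.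
  lra.
set F := correl f (moll (scale k)).
have mF : measurable_fun setT F by apply: measurable_correl => //; exact: measurable_moll.
have mD : measurable_fun setT (fun x => f x - F x) by exact: measurable_funB.
have dS : (sq (fun x => f x - F x)%R <= (C1 * S * 16^-1 ^+ k)%:E)%E.
  rewrite sqBC; apply: le_trans (sq_correl_moll_sub (scale_gt0 k) mf foo) _.
  apply: le_trans (HC1 _ _ _ _ D (scale_gt0 k)) _.
  have -> : scale k ^+ 2 = 16^-1 ^+ k by rewrite /scale exprAC; congr (_ ^+ k); field.
  by rewrite lee_fin -mulrA (mulrC S).
have doo : (sq (fun x => f x - F x)%R < +oo)%E by rewrite (le_lt_trans dS)// ltry.
have Foo : (sq F < +oo)%E by apply: le_lt_trans foo; apply: sq_correl_moll => //; exact: scale_gt0.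
have -> : correl f (moll (scale k.+1)) q =
    correl (fun x => f x - F x) (moll (scale k.+1)) q + correl F (moll (scale k.+1)) q.
  rewrite /correl -RintegralD//.
  - by apply: eq_Rintegral => y _; rewrite -mulrDl subrK.
  - exact: integrable_correl (kk _).
  - exact: integrable_correl (kk _).
have h2 := correl_moll_sup q (scale_gt0 k.+1) mF IH.
(* The weight 32^k balances the two squared norms: 32^k 16^-k = 2^k and 32^-k 64^(k+1) = 64 2^k. *)
have a0 : 0 < (32 : R) ^+ k by rewrite exprn_gt0.
have h1 := correl_bounded q mD (kk k.+1) dS (sq_moll_scale k.+1) a0.
apply: le_trans (ler_normD _ _) _; apply: le_trans (lerD h1 h2) _.
have e1 : (32 : R) ^+ k * (C1 * S * 16^-1 ^+ k) = C1 * S * 2 ^+ k.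
  rewrite mulrCA; congr (_ * _); rewrite -exprMn; congr (_ ^+ k); lra.
have e2 : ((32 : R) ^+ k)^-1 * (E1 * 64 ^+ k.+1) = 64 * E1 * 2 ^+ k.
  rewrite exprS mulrCA [X in E1 * X]mulrCA [RHS]mulrAC [RHS]mulrC; congr (_ * (_ * _)).
  by rewrite -exprVn -exprMn; congr (_ ^+ k); lra.
rewrite e1 e2 exprS; have : 0 <= (2 : R) ^+ k by rewrite exprn_ge0.
set P := 2 ^+ k => P0.
move: Q0; set Q := C1 * S => Q0.
rewrite -subr_ge0 (_ : _ - _ = (S + Q / 2 + 32 * E1) * P); last by field.
by rewrite mulr_ge0// !addr_ge0 ?mulr_ge0.
Qed.

Definition cub (f : X -> R) : \bar R := (\int[leb]_x (`|f x| ^+ 3)%:E)%E.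

(** The difference of the cubes is at most 2 M |x - y| (|x| + |y|), which is split with weight e
    between the two sizes and the increment. *)
Lemma cub_pointwise (x y M e : R) : 0 < e -> `|x| <= M -> `|y| <= M ->
  `|x| ^+ 3 <= `|y| ^+ 3 + (2 * e * M * x ^+ 2 + (2 * e * M * y ^+ 2 + e^-1 * M * (x - y) ^+ 2)).
Proof.
move=> e0 xM yM; have M0 : 0 <= M by apply: le_trans xM.
have : `|x| - `|y| <= `|x - y| by exact: lerB_dist.
rewrite -[x ^+ 2]real_normK ?num_real// -[y ^+ 2]real_normK ?num_real//.
rewrite -[(x - y) ^+ 2]real_normK ?num_real//.
set u := `|x|; set v := `|y|; set w := `|x - y| => uvw.
have u0 : 0 <= u by exact: normr_ge0.
have v0 : 0 <= v by exact: normr_ge0.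
have w0 : 0 <= w by exact: normr_ge0.
have h1 : u ^+ 3 - v ^+ 3 <= w * (2 * M * (u + v)).
  rewrite (_ : u ^+ 3 - v ^+ 3 = (u - v) * (u ^+ 2 + u * v + v ^+ 2)); last by ring.
  apply: (@le_trans _ _ (w * (u ^+ 2 + u * v + v ^+ 2))).
    by rewrite ler_wpM2r// !addr_ge0 ?mulr_ge0 ?sqr_ge0.
  rewrite ler_wpM2l//; rewrite -/u in xM; rewrite -/v in yM; nra.
have h2 : w * (2 * M * (u + v)) <= M * (e * (u + v) ^+ 2 + e^-1 * w ^+ 2).
  rewrite -subr_ge0 (_ : _ - _ = M * e * (u + v - e^-1 * w) ^+ 2).
    by rewrite mulr_ge0 ?sqr_ge0// mulr_ge0// ltW.
  by field; rewrite gt_eqF.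
have h3 : M * (e * (u + v) ^+ 2) <= M * (e * (2 * u ^+ 2 + 2 * v ^+ 2)).
  rewrite ler_wpM2l// ler_wpM2l ?(ltW e0)//; have := sqr_ge0 (u - v); nra.
have h4 : M * (e * (u + v) ^+ 2 + e^-1 * w ^+ 2) = M * (e * (u + v) ^+ 2) + e^-1 * M * w ^+ 2 by ring.
have h5 : M * (e * (2 * u ^+ 2 + 2 * v ^+ 2)) = 2 * e * M * u ^+ 2 + 2 * e * M * v ^+ 2 by ring.
rewrite h4 in h2; rewrite h5 in h3; lra.
Qed.

(* Telescoping over the scales replaces the Sobolev embedding of H1 in L3: the
   sup norms grow like 2^k but the L2 increments decay like 4^-k. *)
Lemma cub_scale (S : R) : exists2 K, 0 <= K & forall (f : X -> R) g k, H1_data f g S ->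
  (cub (correl f (moll (scale k))) <= K%:E)%E.
Proof.
have [C1 C10 HC1] := @moll_variation_H1 R n.
have [D D0 HD] := correl_sup_scale S.
have [S0|S0] := ltP S 0.
  by exists 0 => // f g k /H1_data_ge0; rewrite leNgt S0.
pose C2 := 8 * D * (S + C1 * S).
have C20 : 0 <= C2 by rewrite !mulr_ge0// addr_ge0// mulr_ge0.
exists (D * S + C2 * 2); first by rewrite addr_ge0// mulr_ge0.
move=> f g k Dt; have foo := H1_data_lty Dt; have [mf mg fS gS fg] := Dt.
pose F j := correl f (moll (scale j)).
have mF j : measurable_fun setT (F j) by apply: measurable_correl => //; exact: measurable_moll.
have FS j : (sq (F j) <= S%:E)%E by apply: le_trans fS; apply: sq_correl_moll => //; exact: scale_gt0.
have mF3 j : measurable_fun setT (fun x => `|F j x| ^+ 3).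
  by apply: measurable_funX; exact: measurableT_comp.
(* The bracket is the sum of 2^-i over i < k; passing from scale k to k + 1 costs C2 2^-k. *)
suff H : (cub (F k) <= (D * S + C2 * (2 - 2 * (2^-1) ^+ k))%:E)%E.
  apply: le_trans H _; rewrite lee_fin lerD2l ler_wpM2l// lerBlDr lerDl mulr_ge0// exprn_ge0//.
have bF j x : `|F j x| <= D * 2 ^+ j by exact: HD Dt.
have dj j : (sq (fun x => F j x - f x)%R <= (C1 * (scale j ^+ 2 * S))%:E)%E.
  apply: le_trans (sq_correl_moll_sub (scale_gt0 j) mf foo) _.
  exact: HC1 Dt (scale_gt0 j).
clearbody F.
elim: k => [|k IH].
  rewrite expr0 mulr1 subrr mulr0 addr0.
  apply: (@le_trans _ _ (D%:E * sq (F 0%N))%E).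
    rewrite -integralZl_EFin; [|exact: measurable_funX|by move=> x; exact: sqr_ge0|exact: D0].
    apply: le_integral_EFin; [exact: mF3|by apply: measurable_funM => //; exact: measurable_funX|by move=> x; rewrite exprn_ge0|].
    move=> x; rewrite exprS -[F 0%N x ^+ 2]real_normK ?num_real// ler_wpM2r ?sqr_ge0//.
    by have := bF 0%N x; rewrite expr0 mulr1.
  by rewrite EFinM; apply: lee_wpmul2l; [rewrite lee_fin|exact: FS].
(* M bounds the mollifications at both scales. With the scale itself as weight, e M is of order
   2^-k, and so is e^-1 M e^2, which comes from the increment. *)
pose M := D * 2 ^+ k.+1; pose e := scale k.
have e0 : 0 < e by exact: scale_gt0.
have M0 : 0 <= M by rewrite mulr_ge0// exprn_ge0.
have dS : (sq (fun x => F k.+1 x - F k x)%R <= (4 * (C1 * S * e ^+ 2))%:E)%E.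
  rewrite (_ : (fun x => _) = (fun x => (F k.+1 x - f x) - (F k x - f x))); last first.
    by apply/funext => x; rewrite opprB addrA subrK.
  apply: le_trans; first by apply: sqB; exact: measurable_funB.
  apply: (@le_trans _ _ (2%:E * (C1 * (e ^+ 2 * S))%:E + 2%:E * (C1 * (e ^+ 2 * S))%:E)%E).
    apply: leeD; rewrite lee_pmul2l//; apply: le_trans (dj _) _ => //.
    rewrite lee_fin ler_wpM2l// ler_wpM2r// lerXn2r ?nnegrE ?(ltW (scale_gt0 _))//.
    by rewrite /e /scale exprS ler_piMl ?exprn_ge0 ?invr_ge0// invf_le1// ler1n.
  by rewrite -!(EFinM, EFinD) lee_fin; lra.
have mX2 j : measurable_fun setT (fun x => F j x ^+ 2) by exact: measurable_funX.
have mB2 : measurable_fun setT (fun x => (F k.+1 x - F k x) ^+ 2).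
  by apply: measurable_funX; exact: measurable_funB.
have eM : 0 <= 2 * e * M by rewrite !mulr_ge0// ltW.
have eM' : 0 <= e^-1 * M by rewrite mulr_ge0// invr_ge0 ltW.
pose h2 x := 2 * e * M * F k.+1 x ^+ 2; pose h3 x := 2 * e * M * F k x ^+ 2.
pose h4 x := e^-1 * M * (F k.+1 x - F k x) ^+ 2.
have mh2 : measurable_fun setT h2 by exact: measurable_funM.
have mh3 : measurable_fun setT h3 by exact: measurable_funM.
have mh4 : measurable_fun setT h4 by exact: measurable_funM.
have h20 x : 0 <= h2 x by rewrite mulr_ge0 ?sqr_ge0.
have h30 x : 0 <= h3 x by rewrite mulr_ge0 ?sqr_ge0.
have h40 x : 0 <= h4 x by rewrite mulr_ge0 ?sqr_ge0.
have addE := @integralD_EFin_ge0 _ X R leb.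
apply: (@le_trans _ _ (cub (F k) + (\int[leb]_x (h2 x)%:E + (\int[leb]_x (h3 x)%:E + \int[leb]_x (h4 x)%:E)))%E).
  have m34 : measurable_fun setT (fun x => h3 x + h4 x) by exact: measurable_funD.
  have m234 : measurable_fun setT (fun x => h2 x + (h3 x + h4 x)) by exact: measurable_funD.
  rewrite (addE h3 h4)// addE//; last by move=> x; rewrite addr_ge0.
  rewrite addE; [|exact: mF3|exact: m234|by move=> x; exact: exprn_ge0|by move=> x; rewrite !addr_ge0].
  apply: le_integral_EFin => //.
  - exact: measurable_funD.
  - move=> x; apply: cub_pointwise; [exact: e0|exact: bF|].
    by apply: le_trans (bF k x) _; rewrite ler_wpM2l// exprS ler_peMl ?exprn_ge0// ler1n.
rewrite !integralZl_EFin//; [|by move=> x; exact: sqr_ge0|by move=> x; exact: sqr_ge0|by move=> x; exact: sqr_ge0].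
apply: (@le_trans _ _ ((D * S + C2 * (2 - 2 * (2^-1) ^+ k))%:E +
   ((2 * e * M)%:E * S%:E + ((2 * e * M)%:E * S%:E + (e^-1 * M)%:E * (4 * (C1 * S * e ^+ 2))%:E)))%E).
  apply: leeD; first exact: IH.
  apply: leeD; first by apply: lee_wpmul2l; [rewrite lee_fin|exact: FS].
  apply: leeD; first by apply: lee_wpmul2l; [rewrite lee_fin|exact: FS].
  by apply: lee_wpmul2l; [rewrite lee_fin|exact: dS].
rewrite -!(EFinM, EFinD) lee_fin -addrA lerD2l.
have eMk : e * M = 2 * D * (2^-1) ^+ k.
  rewrite /e /M /scale exprS (_ : (2^-1 : R) ^+ k = 4^-1 ^+ k * 2 ^+ k); first by ring.
  by rewrite -exprMn; congr (_ ^+ k); lra.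
rewrite (exprS 2^-1 k) -subr_ge0.
rewrite (_ : _ - _ = 0)//; rewrite /C2.
have -> : e^-1 * M * (4 * (C1 * S * e ^+ 2)) = e * M * (4 * (C1 * S)) by field; rewrite gt_eqF.
by rewrite -(mulrA 2 e M) eMk; move: (2^-1 ^+ k) => p; field.
Qed.

End dyadic.

(** * The dispersive term *)

Section integration_by_parts_kern.
Context (R : realType) (n : nat).
Local Notation X := 'rV[R]_n.
Local Notation leb := (lebesgue_rV R n).

(** A bookkeeping class for integration by parts: it is stable under products, and its bounds make
    every product with a kernel integrable. *)
Definition bounded_diff (j : 'I_n) (A dA : X -> R) :=
  [/\ measurable_fun setT A, measurable_fun setT dA, exists M, forall q, `|A q| <= M,
    exists M, forall q, `|dA q| <= M & forall q, is_derive q (delta_mx ord0 j : X) A (dA q)].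

Lemma bounded_diffM j A dA B dB : bounded_diff j A dA -> bounded_diff j B dB ->
  bounded_diff j (fun q => A q * B q) (fun q => A q * dB q + B q * dA q).
Proof.
move=> [mA mdA [MA HA] [MdA HdA] DA] [mB mdB [MB HB] [MdB HdB] DB]; split.
- exact: measurable_funM.
- by apply: measurable_funD; exact: measurable_funM.
- by exists (MA * MB) => q; rewrite normrM ler_pM.
- exists (MA * MdB + MB * MdA) => q; apply: le_trans (ler_normD _ _) _.
  by rewrite !normrM lerD// ler_pM.
- by move=> q; exact: is_deriveM (DA q) (DB q).
Qed.

Lemma bounded_diff_kern j k : is_kern k -> bounded_diff j k (partial j k).
Proof.
move=> kk; have kk' := is_kern_partial j kk.
have [M [r [M0 r0 H]]] := is_kern_bound kk; have [M' [r' [M0' r0' H']]] := is_kern_bound kk'.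
split; [exact: is_kern_measurable|exact: is_kern_measurable|by exists M => q; case: (H q)
  |by exists M' => q; case: (H' q)|by move=> q; exact: is_kern_derive].
Qed.

(** The integral of G(. + s v) does not depend on s, and its derivative at s = 0 is the integral of
    dG. *)
Lemma integral_partial0 j (G dG : X -> R) (r : R) : 0 < r -> bounded_diff j G dG ->
  (forall q, G q != 0 -> forall i, `|q ord0 i| < r) ->
  (forall q, dG q != 0 -> forall i, `|q ord0 i| < r) -> \int[leb]_q dG q = 0.
Proof.
move=> r0 [mG mdG [MG HG] [M HM] DG] suppG suppdG.
set v : X := delta_mx ord0 j.
have in_cube q s : `|s| <= 1 -> (forall i, `|(q + s *: v) ord0 i| < r) -> q \in cube (r + 1).
  move=> s1 H; apply: mem_set => i /=; rewrite in_itv/=.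
  have := H i; rewrite !mxE; have : `|s * (delta_mx ord0 j : X) ord0 i| <= 1.
    by rewrite normrM mxE; case: (_ && _); rewrite ?normr1 ?normr0 ?mulr1 ?mulr0.
  rewrite mxE; set u := s * _; rewrite ler_norml ltr_norml => /andP[h1 h2] /andP[h3 h4].
  by apply/andP; split; lra.
have restrict (h : X -> R) : (forall q, h q != 0 -> q \in cube (r + 1)) ->
    \int[leb]_(q in cube (r + 1)) h q = \int[leb]_q h q.
  move=> H; rewrite Rintegral_mkcond; apply: eq_Rintegral => q _; rewrite patchE.
  by case: ifPn => // qn; apply/esym/eqP; apply: contraNT qn; exact: H.
pose phi (s : R) (q : X) := G (q + s *: v); pose dphi (s : R) (q : X) := dG (q + s *: v).
have D1 : is_derive (0 : R) (1 : R) (fun t => \int[leb]_(q in cube (r + 1)) phi t q)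
    (\int[leb]_(q in cube (r + 1)) dphi 0 q).
  apply: (@is_derive_integral_cube R n (r + 1) M phi dphi 0).
  - by move=> t; exact: (measurable_tau _ mG).
  - by move=> t; exists MG => q _; exact: HG.
  - by move=> t q _; apply: line_derive; exact: DG.
  - by move=> t q _; exact: HM.
(* For |t| < 1 the translated support stays inside the cube, so near 0 the integral equals that of G
   over the whole space. *)
have D2 : is_derive (0 : R) (1 : R) (fun t => \int[leb]_(q in cube (r + 1)) phi t q) 0.
  apply: (@near_eq_is_derive _ _ _ (cst (\int[leb]_q G q))).
  have : \forall t \near (0 : R), `|t| < 1.
    by apply: (@cvgr_norm_lt R R R (nbhs (0 : R)) _ id 0 cvg_id 1); rewrite normr0.
  apply: filterS => t /ltW t1; rewrite restrict.
    by apply/esym; exact: (@Rintegral_shift R n (t *: v) G).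
  by move=> q qn; apply: (in_cube q t t1); exact: suppG.
rewrite -(restrict dG); last first.
  move=> q qn; apply: (in_cube q 0); first by rewrite normr0.
  by rewrite scale0r addr0; exact: suppdG.
have e1 := @derive_val _ _ _ _ _ _ _ D1; have e2 := @derive_val _ _ _ _ _ _ _ D2.
rewrite e2 in e1; rewrite e1; apply: eq_Rintegral => q _.
by rewrite /dphi scale0r addr0.
Qed.

Lemma integrable_kern_bounded k (A : X -> R) : is_kern k -> measurable_fun setT A ->
  (exists M, forall q, `|A q| <= M) -> leb.-integrable setT (EFin \o (fun q => k q * A q)).
Proof.
move=> kk mA [M HM]; have [Mk [r [Mk0 r0 H]]] := is_kern_bound kk.
have mi : measurable_fun setT (\1_(ball_box 0 r) : X -> R).
  by apply: measurable_indic; exact: measurable_ball_box.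
have ii : leb.-integrable setT (EFin \o (\1_(ball_box 0 r) : X -> R)).
  apply: ge0_integrable_EFin => //.
  rewrite integral_indic//; last exact: measurable_ball_box.
  by rewrite setIT; exact: (lebesgue_ocbox_lty (fun i => (0 : X) ord0 i - r) (fun i => (0 : X) ord0 i + r)).
apply: (integrable_le _ (integrableZ_EFin (Mk * M) ii)).
  by apply: measurable_funM => //; exact: is_kern_measurable.
move=> x; have [kM kr] := H x.
have M0 : 0 <= M by apply: le_trans (HM x).
rewrite normrM; have [->|k0] := eqVneq (k x) 0; first by rewrite normr0 mul0r !mulr_ge0// indicE.
rewrite indicE mem_ball_box ?mulr1 ?ler_pM// => i.
by rewrite subr0; exact: kr.
Qed.

Lemma integral_partial_kern j k A dA : is_kern k -> bounded_diff j A dA ->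
  \int[leb]_q (partial j k q * A q) = - \int[leb]_q (k q * dA q).
Proof.
move=> kk HA; have kk' := is_kern_partial j kk.
have [M [r [M0 r0 H]]] := is_kern_bound kk; have [M' [r' [M0' r0' H']]] := is_kern_bound kk'.
have [mA mdA bA bdA DA] := HA.
have i1 := integrable_kern_bounded kk mdA bdA.
have i2 := integrable_kern_bounded kk' mA bA.
have rr : 0 < r + r' by rewrite addr_gt0.
have := integral_partial0 rr (bounded_diffM (bounded_diff_kern j kk) HA).
move=> /(_ _ _)/wrap[]; last first.
- move=> E; apply/eqP; rewrite -addr_eq0 -RintegralD//; apply/eqP; rewrite -[RHS]E.
  by apply: eq_Rintegral => q _; rewrite addrC [A q * _]mulrC.
- move=> q qn i; have [kq|k'q] := eqVneq (k q) 0; last first.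
    by have := (H q).2 k'q i; lra.
  move: qn; rewrite kq mul0r add0r mulf_eq0 negb_or => /andP[_ pn].
  by have := (H' q).2 pn i; lra.
- move=> q; rewrite mulf_eq0 negb_or => /andP[kn _] i.
  by have := (H q).2 kn i; lra.
Qed.

Lemma bounded_diff_correl j (f g k : X -> R) : measurable_fun setT f -> (sq f < +oo)%E ->
  is_kern k -> measurable_fun setT g -> (forall q, g q = - correl f (partial j k) q) ->
  bounded_diff j (correl f k) g.
Proof.
move=> mf foo kk mg gE; have kk' := is_kern_partial j kk.
have fA : (sq f <= (fine (sq f))%:E)%E by rewrite -sq_fin.
have [M HM] := correl_bound (fine (sq f)) kk; have [M' HM'] := correl_bound (fine (sq f)) kk'.
split=> //.
- by apply: measurable_correl => //; exact: is_kern_measurable.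
- by exists M => q; exact: HM.
- by exists M' => q; rewrite gE normrN; exact: HM'.
- by move=> q; rewrite gE; exact: is_derive_correl.
Qed.

(** The weight w goes with B, whose squared norm becomes c^2 S, and AM-GM is used with parameter
    c. *)
Lemma weighted_AMGM (w A B : X -> R) (c S : R) : 0 < c -> measurable_fun setT w ->
  measurable_fun setT A -> measurable_fun setT B -> (forall q, `|w q| <= c) ->
  (sq A <= S%:E)%E -> (sq B <= S%:E)%E -> `|\int[leb]_q (w q * (A q * B q))| <= c * S.
Proof.
move=> c0 mw mA mB wc AS BS.
have -> : \int[leb]_q (w q * (A q * B q)) = \int[leb]_q (A q * (w q * B q)).
  by apply: eq_Rintegral => q _; rewrite mulrCA.
have mwB : measurable_fun setT (fun q => w q * B q) by exact: measurable_funM.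
have wBS : (sq (fun q => w q * B q)%R <= (c ^+ 2 * S)%:E)%E.
  apply: (@le_trans _ _ (sq (fun q => c * B q))).
    apply: sq_le => //; first exact: measurable_funM.
    by move=> q; rewrite !normrM ler_wpM2r// (gtr0_norm c0).
  rewrite sqZ// (EFinM (c ^+ 2) S); apply: lee_wpmul2l => //.
  by rewrite lee_fin sqr_ge0.
apply: le_trans (Rintegral_AMGM mA mwB c0 AS wBS) _.
rewrite (_ : c^-1 * (c ^+ 2 * S) = c * S); first lra.
by field; rewrite gt_eqF.
Qed.

End integration_by_parts_kern.

Lemma three_bounds (R : realType) (t x1 x2 x3 : R) : `|x1| <= t -> `|x2| <= t -> `|x3| <= t ->
  `|- x3 - x2 - 2^-1 * x1| <= 3 * t.
Proof.
rewrite !ler_norml => /andP[? ?] /andP[? ?] /andP[? ?].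
by apply/andP; split; lra.
Qed.

Section virial_bounds.
Context (R : realType) (n : nat) (n3 : (n <= 3)%N) (j0 : 'I_n).
Local Notation X := 'rV[R]_n.
Local Notation leb := (lebesgue_rV R n).

Lemma bounded_diff_mollified f g (S : R) (k : X -> R) j : H1_data f g S -> is_kern k ->
  bounded_diff j (correl f k) (correl (g j) k).
Proof.
move=> D kk; have foo := H1_data_lty D; have [mf mg fS gS fg] := D.
apply: bounded_diff_correl => //.
  by apply: measurable_correl => //; exact: is_kern_measurable.
by move=> q; rewrite (correl_weak_partial _ (fg j) kk) opprK.
Qed.

Lemma bounded_diff_correlN (f k : X -> R) j : measurable_fun setT f -> (sq f < +oo)%E ->
  is_kern k -> bounded_diff j (correl f k) (fun q => - correl f (partial j k) q).
Proof.
move=> mf foo kk; apply: bounded_diff_correl => //.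
apply: measurable_funN; apply: measurable_correl => //.
by apply: is_kern_measurable; exact: is_kern_partial.
Qed.

Lemma cutoff_derivatives_le : exists2 C, 0 < C & forall (L : R), 1 <= L ->
  (forall i q, `|partial i (@cutoff R n L) q| <= C / L) /\
  (forall i j q, `|partial i (partial j (@cutoff R n L)) q| <= C / L).
Proof.
have [C1 C10 H1] := @partial_cutoff_le R n; have [C2 C20 H2] := @partial2_cutoff_le R n.
exists (C1 + C2 + 1); first lra.
move=> L L1; have L0 : 0 < L by exact: lt_le_trans L1.
have Li : 0 <= L^-1 by rewrite invr_ge0 ltW.
split=> [i q|i j q].
  by apply: le_trans (H1 i L q L0) _; rewrite ler_wpM2r//; lra.
by apply: le_trans (H2 i j L q L1) _; rewrite ler_wpM2r//; lra.
Qed.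

(* With F = correl f (moll r) and subscripts for derivatives, integrating by
   parts gives, up to sign, the integrals of chi_(0i) F F_i, chi_i F_i F_0 and
   1/2 chi_0 F_i^2: each one carries a derivative of the cutoff. *)
Lemma dispersive_bound : exists2 C, 0 <= C & forall f g (S : R) r L i, H1_data f g S ->
  0 < r -> 1 <= L ->
  `|\int[leb]_q (cutoff L q * (correl f (moll r) q *
      correl f (partial j0 (partial i (partial i (moll r)))) q))| <= C / L * S.
Proof.
have [C C0 HC] := cutoff_derivatives_le.
exists (3 * C); first by rewrite mulr_ge0// ltW.
move=> f g S r L i D r0 L1; have foo := H1_data_lty D; have [mf mg fS gS fg] := D.
have L0 : 0 < L by exact: lt_le_trans L1.
have goo j : (sq (g j) < +oo)%E by rewrite (le_lt_trans (gS j))// ltry.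
have [{}HC HC2] := HC L L1.
have kr := @is_kern_moll R n r r0; have kL := @is_kern_cutoff R n L L0.
set rho := moll r in kr *; set chi := cutoff L in kL HC HC2 *.
pose F := correl f rho; pose Fd j := correl (g j) rho.
(* [A2] is the derivative of [Fd i] in direction j0, and [dA2] that of [A2] in direction i. One of
   the three derivatives is carried by f as its weak gradient, the other two stay on the
   mollifier. *)
pose A2 q := - correl (g i) (partial j0 rho) q.
pose dA2 q := correl (g i) (partial i (partial j0 rho)) q.
have bF j : bounded_diff j F (Fd j) := bounded_diff_mollified j D kr.
have bFi : bounded_diff j0 (Fd i) A2 := bounded_diff_correlN j0 (mg i) (goo i) kr.
have bA2 : bounded_diff i A2 dA2.
  have [mA mdA [M HM] [M' HM'] DA] := bounded_diff_correlN i (mg i) (goo i) (is_kern_partial j0 kr).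
  split.
  - exact: measurable_funN.
  - by have := measurable_funN mdA; congr (measurable_fun _ _); apply/funext => q /=; rewrite opprK.
  - by exists M => q; rewrite normrN.
  - by exists M' => q; have := HM' q; rewrite normrN.
  - by move=> q; have := is_deriveN (DA q); rewrite opprK.
have E0 q : correl f (partial j0 (partial i (partial i rho))) q = - dA2 q.
  rewrite (is_kern_partialC j0 i (is_kern_partial i kr)).
  rewrite (correl_weak_partial _ (fg i)); last exact: (is_kern_partial _ (is_kern_partial _ kr)).
  by rewrite (is_kern_partialC j0 i kr).
have bFF j : bounded_diff j (fun q => F q * F q) (fun q => F q * Fd j q + F q * Fd j q).
  exact: bounded_diffM.
have [mF _ HF _ _] := bF i.
have mFd j : measurable_fun setT (Fd j) by case: (bF j).
have HFd j : exists M, forall q, `|Fd j q| <= M by case: (bF j).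
have [mA2 mdA2 HA2 HdA2 _] := bA2.
have bM (u v : X -> R) : (exists M, forall q, `|u q| <= M) -> (exists M, forall q, `|v q| <= M) ->
    exists M, forall q, `|u q * v q| <= M.
  by move=> [M HM] [M' HM']; exists (M * M') => q; rewrite normrM ler_pM.
have intk (k u v : X -> R) : is_kern k -> measurable_fun setT u -> measurable_fun setT v ->
    (exists M, forall q, `|u q| <= M) -> (exists M, forall q, `|v q| <= M) ->
    leb.-integrable setT (EFin \o (fun q => k q * (u q * v q))).
  move=> kk mu mv bu bv; apply: integrable_kern_bounded => //; first exact: measurable_funM.
  exact: bM.
have splitk (k u v u' v' : X -> R) : is_kern k -> measurable_fun setT u -> measurable_fun setT v ->
    measurable_fun setT u' -> measurable_fun setT v' ->
    (exists M, forall q, `|u q| <= M) -> (exists M, forall q, `|v q| <= M) ->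
    (exists M, forall q, `|u' q| <= M) -> (exists M, forall q, `|v' q| <= M) ->
    \int[leb]_q (k q * (u q * v q + u' q * v' q)) =
    \int[leb]_q (k q * (u q * v q)) + \int[leb]_q (k q * (u' q * v' q)).
  move=> kk mu mv mu' mv' bu bv bu' bv'.
  rewrite -RintegralD//; [|exact: intk|exact: intk].
  by apply: eq_Rintegral => q _; rewrite mulrDr.
(* [I1] takes the outer derivative off [dA2]; [I2] recognizes [Fd i * A2] as half the derivative of
   the square of [Fd i]; [I3] removes the second derivative left in the boundary term of [I1]. *)
have I1 := integral_partial_kern kL (bounded_diffM (bF i) bA2).
have I2 := integral_partial_kern kL (bounded_diffM bFi bFi).
have I3 := integral_partial_kern (is_kern_partial i kL) (bounded_diffM (bF j0) bFi).
rewrite splitk// in I1; rewrite splitk// in I2.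
rewrite splitk// in I3; last exact: is_kern_partial.
set T := \int[leb]_q _.
have TE : T = - \int[leb]_q (chi q * (F q * dA2 q)).
  rewrite /T -mulN1r -RintegralZl//; last exact: intk.
  by apply: eq_Rintegral => q _; rewrite E0 mulN1r mulrN mulrN.
have comm : \int[leb]_q (chi q * (A2 q * Fd i q)) = \int[leb]_q (chi q * (Fd i q * A2 q)).
  by apply: eq_Rintegral => q _; rewrite [A2 q * _]mulrC.
have c0 : 0 < C / L by rewrite divr_gt0.
have FS : (sq F <= S%:E)%E by apply: le_trans fS; exact: sq_correl_moll.
have FdS j : (sq (Fd j) <= S%:E)%E by apply: le_trans (gS j); exact: sq_correl_moll.
have mk (k : X -> R) : is_kern k -> measurable_fun setT k by exact: is_kern_measurable.
have b1 := weighted_AMGM c0 (mk _ (is_kern_partial j0 kL)) (mFd i) (mFd i) (HC j0) (FdS i) (FdS i).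
have b2 := weighted_AMGM c0 (mk _ (is_kern_partial i kL)) (mFd i) (mFd j0) (HC i) (FdS i) (FdS j0).
have b3 := weighted_AMGM c0 (mk _ (is_kern_partial j0 (is_kern_partial i kL))) mF (mFd i)
  (HC2 j0 i) FS (FdS i).
rewrite (_ : T = - (\int[leb]_q (partial j0 (partial i chi) q * (F q * Fd i q)))
   - (\int[leb]_q (partial i chi q * (Fd i q * Fd j0 q)))
   - 2^-1 * (\int[leb]_q (partial j0 chi q * (Fd i q * Fd i q)))).
  rewrite (_ : 3 * C / L * S = 3 * (C / L * S)); last by ring.
  exact: (three_bounds b1 b2 b3).
rewrite TE; rewrite comm in I1; move: I1 I2 I3.
set a := \int[leb]_q (chi q * (F q * dA2 q)); set b := \int[leb]_q (chi q * (Fd i q * A2 q)).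
set c := \int[leb]_q (_ * (F q * A2 q)).
move: a b c => a b c -> -> -> {TE}; by field.
Qed.

End virial_bounds.

(** * The nonlinear term *)

Section nonlinear.
Context (R : realType) (n : nat).
Local Notation X := 'rV[R]_n.
Local Notation leb := (lebesgue_rV R n).

(** The mollified product; in the equation f is the solution and h its weak derivative in x_1. *)
Definition nonlin (f h k : X -> R) (q : X) : R := \int[leb]_y (f y * h y * k ((y : X) - q)).

Lemma measurable_nonlin f h k : measurable_fun setT f -> measurable_fun setT h ->
  measurable_fun setT k -> measurable_fun setT (nonlin f h k).
Proof.
move=> mf mh mk; apply: (@measurable_Rintegral2 R n (fun p => f p.2 * h p.2 * k (p.2 - p.1))).
apply: measurable_funM; last exact: measurable_comp_subr.
by apply: measurable_funM; [exact: measurableT_comp mf measurable_snd|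
  exact: measurableT_comp mh measurable_snd].
Qed.

Lemma sq_mul_kern (h k : X -> R) (M S : R) (q : X) : measurable_fun setT h -> is_kern k ->
  (forall x, `|k x| <= M) -> (sq h <= S%:E)%E ->
  (sq (fun y : X => h y * k (y - q))%R <= (M ^+ 2 * S)%:E)%E.
Proof.
move=> mh kk kM hS; have mk := is_kern_measurable kk.
apply: (@le_trans _ _ (sq (fun y => M * h y))).
  apply: sq_le.
  - by apply: measurable_funM; [exact: mh|exact: (measurable_tauN _ mk)].
  - exact: measurable_funM.
  - move=> x; rewrite !normrM mulrC ler_wpM2r//.
    by apply: le_trans (kM _) (ler_norm _).
rewrite sqZ// (EFinM (M ^+ 2) S); apply: lee_wpmul2l => //.
by rewrite lee_fin sqr_ge0.
Qed.

Lemma nonlinE f h k q : nonlin f h k q = \int[leb]_y (f y * (h y * k ((y : X) - q))).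
Proof. by apply: eq_Rintegral => y _; rewrite mulrA. Qed.

Lemma nonlin_bound k (S : R) : is_kern k -> exists M, forall (f h : X -> R) (q : X),
  measurable_fun setT f -> measurable_fun setT h -> (sq f <= S%:E)%E -> (sq h <= S%:E)%E ->
  `|nonlin f h k q| <= M.
Proof.
move=> kk; have [M [r [M0 r0 HM]]] := is_kern_bound kk; have mk := is_kern_measurable kk.
exists ((1 * S + 1^-1 * (M ^+ 2 * S)) / 2) => f h q mf mh fS hS; rewrite nonlinE.
apply: Rintegral_AMGM => //.
- by apply: measurable_funM; [exact: mh|exact: (measurable_tauN _ mk)].
- by apply: sq_mul_kern => // x; case: (HM x).
Qed.

(** The constant c will be the mollified value of f at q, which turns the left side into the
    commutator at q. *)
Lemma nonlin_sub (f h : X -> R) (S r c : R) q : 0 < r -> measurable_fun setT f ->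
  measurable_fun setT h -> (sq f <= S%:E)%E -> (sq h <= S%:E)%E ->
  nonlin f h (moll r) q - c * correl h (moll r) q =
  \int[leb]_y ((f y - c) * (h y * moll r ((y : X) - q))).
Proof.
move=> r0 mf mh fS hS; have kk := @is_kern_moll R n r r0; have mk := @measurable_moll R n r.
have [M [r' [M0 _ HM]]] := is_kern_bound kk.
have foo : (sq f < +oo)%E by rewrite (le_lt_trans fS)// ltry.
have hoo : (sq h < +oo)%E by rewrite (le_lt_trans hS)// ltry.
rewrite nonlinE.
have i1 : leb.-integrable setT (EFin \o (fun y : X => h y * moll r (y - q))).
  exact: integrable_correl.
have i2 : leb.-integrable setT (EFin \o (fun y : X => f y * (h y * moll r (y - q)))).
  apply: integrable_mul => //.
  - by apply: measurable_funM; [exact: mh|exact: (measurable_tauN _ mk)].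
  - have H := sq_mul_kern q mh kk (fun x => (HM x).1) hS.
    by apply: le_lt_trans H _; rewrite ltry.
rewrite /correl -RintegralZl// -RintegralB//; last exact: integrableZ_EFin.
by apply: eq_Rintegral => y _; rewrite mulrBl.
Qed.

(** The density in q of [moll_variation]. *)
Definition moll_deviation (r : R) (f : X -> R) (q : X) : \bar R :=
  (\int[leb]_y ((f y - f q) ^+ 2 * moll r ((y : X) - q))%:E)%E.

Definition moll_square (r : R) (h : X -> R) (q : X) : \bar R :=
  (\int[leb]_y (h y ^+ 2 * moll r ((y : X) - q))%:E)%E.

(* AM-GM with weight a; a will be the inverse of the mollification scale. *)
Lemma product_pointwise (a u v w : R) : 0 < a -> `|(u + v) * w| <= a * u ^+ 2 + (a * v ^+ 2 + a^-1 * w ^+ 2).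
Proof.
move=> a0; rewrite normrM.
have h1 : `|u + v| * `|w| <= (a / 2) * `|u + v| ^+ 2 + (a^-1 / 2) * `|w| ^+ 2.
  rewrite -subr_ge0 (_ : _ - _ = a / 2 * (`|u + v| - a^-1 * `|w|) ^+ 2).
    by rewrite mulr_ge0 ?sqr_ge0// divr_ge0// ltW.
  by field; rewrite gt_eqF.
rewrite !real_normK ?num_real// in h1; apply: le_trans h1 _.
have h2 : (a / 2) * (u + v) ^+ 2 <= a * u ^+ 2 + a * v ^+ 2.
  rewrite -subr_ge0 (_ : _ - _ = a / 2 * (u - v) ^+ 2); last by field.
  by rewrite mulr_ge0 ?sqr_ge0// divr_ge0// ltW.
have h3 : (a^-1 / 2) * w ^+ 2 <= a^-1 * w ^+ 2.
  rewrite ler_wpM2r ?sqr_ge0// ler_pdivrMr// ler_peMr ?invr_ge0 ?ler1n// ltW//.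
by rewrite addrA lerD.
Qed.

(** The factor f y - c is split as (f y - f q) + (f q - c): a local oscillation and the
    mollification error at q. Each resulting term integrates in q to a known quantity. *)
Lemma nonlin_sub_pointwise (f h : X -> R) (S r a c : R) q : 0 < r -> 0 < a -> measurable_fun setT f ->
  measurable_fun setT h -> (sq f <= S%:E)%E -> (sq h <= S%:E)%E ->
  (`|nonlin f h (moll r) q - c * correl h (moll r) q|%:E <=
   a%:E * moll_deviation r f q + (a%:E * ((f q - c) ^+ 2)%:E + (a^-1)%:E * moll_square r h q))%E.
Proof.
move=> r0 a0 mf mh fS hS; rewrite (nonlin_sub c q r0 mf mh fS hS).
have mk := @measurable_moll R n r.
have mt : measurable_fun setT (fun y : X => moll r (y - q)) := measurable_tauN q mk.
have m0 (y : X) : 0 <= moll r (y - q) by exact: moll_ge0.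
set G := fun y : X => (f y - c) * (h y * moll r (y - q)).
have mG : measurable_fun setT G.
  by apply: measurable_funM; [exact: measurable_funB|exact: measurable_funM].
apply: (@le_trans _ _ (\int[leb]_y `|G y|%:E)%E).
  have := @le_abse_integral _ X R leb setT (EFin \o G) measurableT.
  have mEG : measurable_fun setT (EFin \o G) by exact/measurable_EFinP.
  move=> /(_ mEG); apply: le_trans.
  (* An infinite integral is sent to 0 by [fine], while the right side is then +oo. *)
  have [fin|] := boolP (\int[leb]_x (G x)%:E \is a fin_num)%E.
    by rewrite /Rintegral /= -[in leRHS](fineK fin).
  rewrite /Rintegral; case: (\int[leb]_x _)%E => [t| |]//= _; rewrite normr0.
    by rewrite leey.
  by rewrite leey.
have m1 : measurable_fun setT (fun y => (f y - f q) ^+ 2 * moll r ((y : X) - q)).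
  by apply: measurable_funM; [apply: measurable_funX; exact: measurable_funB|exact: mt].
have m3 : measurable_fun setT (fun y => h y ^+ 2 * moll r ((y : X) - q)).
  by apply: measurable_funM; [exact: measurable_funX|exact: mt].
have a1 : 0 <= a^-1 by rewrite invr_ge0 ltW.
have p1 y : 0 <= (f y - f q) ^+ 2 * moll r ((y : X) - q) by apply: mulr_ge0; [exact: sqr_ge0|exact: m0].
have p3 y : 0 <= h y ^+ 2 * moll r ((y : X) - q) by apply: mulr_ge0; [exact: sqr_ge0|exact: m0].
have E2 : ((((f q - c) ^+ 2)%:E : \bar R) = \int[leb]_y ((f q - c) ^+ 2 * moll r ((y : X) - q))%:E)%E.
  rewrite integralZl_EFin; [|exact: mt|exact: m0|exact: sqr_ge0].
  by rewrite (integral_moll_shift q r0) mule1.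
rewrite E2 /moll_deviation /moll_square.
have m2 : measurable_fun setT (fun y => (f q - c) ^+ 2 * moll r ((y : X) - q)) by exact: measurable_funM.
have p2 y : 0 <= (f q - c) ^+ 2 * moll r ((y : X) - q) by apply: mulr_ge0; [exact: sqr_ge0|exact: m0].
rewrite -(integralZl_EFin leb m1 p1 (ltW a0)) -(integralZl_EFin leb m2 p2 (ltW a0)) -(integralZl_EFin leb m3 p3 a1).
have M1 := measurable_funM (measurable_cst a) m1; have M2 := measurable_funM (measurable_cst a) m2.
have M3 := measurable_funM (measurable_cst a^-1) m3.
have P1 y := mulr_ge0 (ltW a0) (p1 y); have P2 y := mulr_ge0 (ltW a0) (p2 y); have P3 y := mulr_ge0 a1 (p3 y).
rewrite (integralD_EFin_ge0 leb M2 M3 P2 P3).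
have M23 := measurable_funD M2 M3; have P23 y := addr_ge0 (P2 y) (P3 y).
rewrite (integralD_EFin_ge0 leb M1 M23 P1 P23).
apply: le_integral_EFin.
- exact: measurableT_comp.
- exact: measurable_funD M1 M23.
- by move=> y; exact: normr_ge0.
- move=> y; rewrite /G.
  suff : `|(f y - c) * (h y * moll r ((y : X) - q))| <= a * ((f y - f q) ^+ 2 * moll r ((y : X) - q)) +
      (a * ((f q - c) ^+ 2 * moll r ((y : X) - q)) + a^-1 * (h y ^+ 2 * moll r ((y : X) - q))) by [].
  rewrite mulrA normrM (ger0_norm (m0 y)) 3!(mulrA _ _ (moll r _)) -!mulrDl.
  apply: ler_wpM2r; first exact: m0.
  have := @product_pointwise a (f y - f q) (f q - c) (h y) a0.
  by rewrite (_ : f y - f q + (f q - c) = f y - c)//; ring.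
Qed.

End nonlinear.

Section nonlinear_bound.
Context (R : realType) (n : nat).
Local Notation X := 'rV[R]_n.
Local Notation leb := (lebesgue_rV R n).

Lemma weighted_integral_le (w A : X -> R) (c K : R) : measurable_fun setT w ->
  measurable_fun setT A -> (forall q, `|w q| <= c) -> 0 <= c ->
  (\int[leb]_q `|A q|%:E <= K%:E)%E -> `|\int[leb]_q (w q * A q)| <= c * K.
Proof.
move=> mw mA wc c0 AK.
have mN : measurable_fun setT (fun q => `|A q|) by exact: measurableT_comp.
have iN : leb.-integrable setT (EFin \o (fun q => `|A q|)).
  apply: ge0_integrable_EFin; [exact: mN|by move=> q; exact: normr_ge0|].
  by apply: le_lt_trans AK _; rewrite ltry.
have le q : `|w q * A q| <= c * `|A q| by rewrite normrM ler_wpM2r.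
have iwA : leb.-integrable setT (EFin \o (fun q => w q * A q)).
  by apply: (integrable_le _ (integrableZ_EFin c iN) le); exact: measurable_funM.
apply: le_trans (le_normr_Rintegral measurableT iwA) _.
apply: (@le_trans _ _ (\int[leb]_q (c * `|A q|))).
  apply: le_Rintegral; [exact: measurableT| |exact: (integrableZ_EFin c iN)|by move=> q _; exact: le].
  exact: integrable_norm iwA.
rewrite RintegralZl; [|exact: measurableT|exact: iN].
rewrite ler_wpM2l//= -lee_fin /Rintegral fineK//.
have fin := integrable_fin_num measurableT iN; exact: fin.
Qed.

Lemma measurable_moll_deviation r (f : X -> R) : 0 < r -> measurable_fun setT f -> measurable_fun setT (moll_deviation r f).
Proof.
move=> r0 mf; have mm := @measurable_moll R n r.
apply: (@measurable_fun_fubini_tonelli_F _ _ X X R leb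
  (fun p => ((f p.2 - f p.1) ^+ 2 * moll r (p.2 - p.1))%:E)).
  apply/measurable_EFinP; apply: measurable_funM; last exact: measurable_comp_subr.
  by apply: measurable_funX; apply: measurable_funB; [exact: measurableT_comp mf measurable_snd|
    exact: measurableT_comp mf measurable_fst].
by move=> p; rewrite lee_fin; apply: mulr_ge0; [exact: sqr_ge0|exact: moll_ge0].
Qed.

Lemma measurable_moll_square r (h : X -> R) : 0 < r -> measurable_fun setT h -> measurable_fun setT (moll_square r h).
Proof.
move=> r0 mh; have mm := @measurable_moll R n r.
apply: (@measurable_fun_fubini_tonelli_F _ _ X X R leb
  (fun p => (h p.2 ^+ 2 * moll r (p.2 - p.1))%:E)).
  apply/measurable_EFinP; apply: measurable_funM; last exact: measurable_comp_subr.
  by apply: measurable_funX; exact: measurableT_comp mh measurable_snd.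
by move=> p; rewrite lee_fin; apply: mulr_ge0; [exact: sqr_ge0|exact: moll_ge0].
Qed.

(* The error of mollifying a product is small of the order of the scale, as
   soon as one of the factors has a gradient in L2. *)
Lemma integral_commutator (f h : X -> R) (S T r : R) : 0 < r -> measurable_fun setT f ->
  measurable_fun setT h -> (sq f <= S%:E)%E -> (sq h <= S%:E)%E ->
  (moll_variation r f <= (T * r ^+ 2)%:E)%E ->
  (\int[leb]_q `|nonlin f h (moll r) q - correl f (moll r) q * correl h (moll r) q|%:E <=
    ((2 * T + S) * r)%:E)%E.
Proof.
move=> r0 mf mh fS hS V; have mm := @measurable_moll R n r.
have foo : (sq f < +oo)%E by rewrite (le_lt_trans fS)// ltry.
have a0 : 0 < r^-1 by rewrite invr_gt0.
have mF : measurable_fun setT (correl f (moll r)) by exact: measurable_correl.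
have mH : measurable_fun setT (correl h (moll r)) by exact: measurable_correl.
have mN := measurable_nonlin mf mh mm.
have J10 q : (0 <= moll_deviation r f q)%E.
  by apply: integral_ge0 => y _; rewrite lee_fin; apply: mulr_ge0; [exact: sqr_ge0|exact: moll_ge0].
have J30 q : (0 <= moll_square r h q)%E.
  by apply: integral_ge0 => y _; rewrite lee_fin; apply: mulr_ge0; [exact: sqr_ge0|exact: moll_ge0].
have mJ1 := measurable_moll_deviation r0 mf; have mJ3 := measurable_moll_square r0 mh.
set F := correl f (moll r) in mF *; set H := correl h (moll r) in mH *.
have mD : measurable_fun setT (fun q => ((f q - F q) ^+ 2)%:E : \bar R).
  by apply/measurable_EFinP; apply: measurable_funX; exact: measurable_funB.
have D0 q : (0 <= ((f q - F q) ^+ 2)%:E)%E by rewrite lee_fin; exact: sqr_ge0.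
have e0 : (0 <= (r^-1)%:E)%E by rewrite lee_fin ltW.
have e1 : (0 <= (r^-1^-1)%:E)%E by rewrite lee_fin invrK ltW.
have mcJ1 : measurable_fun setT (fun q => (r^-1)%:E * moll_deviation r f q)%E by exact: measurable_funeM.
have mcJ3 : measurable_fun setT (fun q => (r^-1^-1)%:E * moll_square r h q)%E by exact: measurable_funeM.
have mcD : measurable_fun setT (fun q => (r^-1)%:E * ((f q - F q) ^+ 2)%:E)%E by exact: measurable_funeM.
apply: (@le_trans _ _ (\int[leb]_q ((r^-1)%:E * moll_deviation r f q +
    ((r^-1)%:E * ((f q - F q) ^+ 2)%:E + (r^-1^-1)%:E * moll_square r h q)))%E).
  apply: ge0_le_integral; first exact: measurableT.
  - by move=> q _; rewrite lee_fin; exact: normr_ge0.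
  - apply/measurable_EFinP; apply: measurableT_comp => //.
    by apply: measurable_funB; [exact: mN|exact: measurable_funM].
  - by apply: emeasurable_funD; [exact: mcJ1|exact: emeasurable_funD].
  - by move=> q _; exact: (nonlin_sub_pointwise (F q) q r0 a0 mf mh fS hS).
rewrite ge0_integralD; [|exact: measurableT|by move=> q _; exact: mule_ge0|exact: mcJ1
  |by move=> q _; apply: adde_ge0; exact: mule_ge0|exact: emeasurable_funD].
rewrite ge0_integralD; [|exact: measurableT|by move=> q _; exact: mule_ge0|exact: mcD
  |by move=> q _; exact: mule_ge0|exact: mcJ3].
rewrite ge0_integralZl; [|exact: measurableT|exact: mJ1|by move=> q _; exact: J10|exact: e0].
rewrite ge0_integralZl; [|exact: measurableT|exact: mD|by move=> q _; exact: D0|exact: e0].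
rewrite ge0_integralZl; [|exact: measurableT|exact: mJ3|by move=> q _; exact: J30|exact: e1].
have b2 : (\int[leb]_q ((f q - F q) ^+ 2)%:E <= (T * r ^+ 2)%:E)%E.
  have := sq_correl_moll_sub r0 mf foo; rewrite sqBC => b.
  by apply: le_trans b V.
have b3 : (\int[leb]_q moll_square r h q <= S%:E)%E.
  rewrite /moll_square (@integral_correl_moll R n r (fun y => h y ^+ 2) r0)//.
    exact: measurable_funX.
  by move=> x; exact: sqr_ge0.
(* With weight 1/r both quadratic errors T r^2 and the bounded term S contribute at order r. *)
apply: (@le_trans _ _ ((r^-1)%:E * (T * r ^+ 2)%:E + ((r^-1)%:E * (T * r ^+ 2)%:E + (r^-1^-1)%:E * S%:E))%E).
  apply: leeD; first exact: lee_wpmul2l.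
  by apply: leeD; exact: lee_wpmul2l.
rewrite -!(EFinM, EFinD) lee_fin invrK.
by rewrite (_ : r^-1 * (T * r ^+ 2) = T * r); [lra|field; rewrite gt_eqF].
Qed.

End nonlinear_bound.

Section cubic_bound.
Context (R : realType) (n : nat) (n3 : (n <= 3)%N) (j0 : 'I_n).
Local Notation X := 'rV[R]_n.
Local Notation leb := (lebesgue_rV R n).

(* F^2 F_0 is the derivative of F^3 / 3. *)
Lemma integral_kern_cub (k F F0 : X -> R) : is_kern k -> bounded_diff j0 F F0 ->
  \int[leb]_q (k q * (F q * (F q * F0 q))) =
  - (3^-1 * \int[leb]_q (partial j0 k q * (F q * (F q * F q)))).
Proof.
move=> kk bF; have bFF := bounded_diffM bF bF.
have [mF mF0 [M HM] [M' HM'] _] := bF.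
have i1 : leb.-integrable setT (EFin \o (fun q => k q * (F q * (F q * F0 q)))).
  apply: integrable_kern_bounded => //.
    by apply: measurable_funM => //; exact: measurable_funM.
  exists (M * (M * M')) => q; rewrite normrM; apply: ler_pM => //.
  by rewrite normrM; apply: ler_pM.
rewrite (integral_partial_kern kk (bounded_diffM bF bFF)) mulrN opprK.
rewrite (_ : \int[leb]_q (k q * (F q * (F q * F0 q + F q * F0 q) + F q * F q * F0 q)) =
  3 * \int[leb]_q (k q * (F q * (F q * F0 q)))).
  by rewrite mulrA mulVf ?mul1r.
rewrite -RintegralZl//; apply: eq_Rintegral => q _; ring.
Qed.

(** The mollified product is F F_0 plus the commutator E. The first part gives chi F^2 F_0, hence a
    derivative of the cutoff against F^3, bounded uniformly in k by [cub_scale]; the second gives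
    the sup norm 2^k of F times the L1 norm 4^-k of E. *)
Lemma nonlinear_bound (S : R) : exists2 C, 0 <= C & forall f g L k, H1_data f g S -> 1 <= L ->
  `|\int[leb]_q (cutoff L q * (correl f (moll (scale R k)) q *
      nonlin f (g j0) (moll (scale R k)) q))| <= C / L + C * (2^-1) ^+ k.
Proof.
have [C1 C10 HC1] := @moll_variation_H1 R n.
have [D D0 HD] := @correl_sup_scale R n n3 S.
have [K K0 HK] := @cub_scale R n n3 S.
have [C0 C00 HC0] := @cutoff_derivatives_le R n.
have [S0|S0] := ltP S 0.
  by exists 0 => // f g L k /H1_data_ge0; rewrite leNgt S0.
pose Q := D * (2 * (C1 * S) + S).
have Q0 : 0 <= Q by rewrite mulr_ge0// addr_ge0// !mulr_ge0.
exists (C0 * K + Q); first by rewrite addr_ge0// mulr_ge0// ltW.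
move=> f g L k Dt L1; have foo := H1_data_lty Dt; have [mf mg fS gS fg] := Dt.
have L0 : 0 < L by exact: lt_le_trans L1.
have r0 := scale_gt0 R k; have kr := is_kern_moll n r0.
have kL := @is_kern_cutoff R n L L0.
have [HC _] := HC0 L L1.
have bF := bounded_diff_mollified j0 Dt kr.
have bK := HK f g k Dt; have bD q := HD f g k q Dt.
have V := HC1 f g S _ Dt r0.
rewrite (_ : C1 * _ = (C1 * S) * scale R k ^+ 2) in V; last by rewrite (mulrC _ S) mulrA.
have bE := integral_commutator r0 mf (mg j0) fS (gS j0) V.
have mN := measurable_nonlin mf (mg j0) (@measurable_moll R n (scale R k)).
have [MN HMN] := nonlin_bound S kr.
have bN q := HMN f (g j0) q mf (mg j0) fS (gS j0).
set F := correl f _ in bF bK bD bE *; set F0 := correl (g j0) _ in bF bE.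
set N := nonlin f _ _ in mN bN bE *.
have [mF mF0 bdF bdF0 _] := bF.
have chi1 q : `|cutoff L q| <= 1 by rewrite (ger0_norm (cutoff_ge0 _ _)); exact: cutoff_le1.
clearbody F F0 N.
have mchi := @measurable_cutoff R n L.
pose E q := N q - F q * F0 q.
have mE : measurable_fun setT E by apply: measurable_funB => //; exact: measurable_funM.
have bdN : exists M, forall q, `|N q| <= M by exists MN.
have bM (u v : X -> R) : (exists M, forall q, `|u q| <= M) -> (exists M, forall q, `|v q| <= M) ->
    exists M, forall q, `|u q * v q| <= M.
  by move=> [M HM] [M' HM']; exists (M * M') => q; rewrite normrM ler_pM.
have bB (u v : X -> R) : (exists M, forall q, `|u q| <= M) -> (exists M, forall q, `|v q| <= M) ->
    exists M, forall q, `|u q - v q| <= M.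
  move=> [M HM] [M' HM']; exists (M + M') => q.
  by apply: le_trans (ler_normB _ _) _; exact: lerD.
rewrite (_ : \int[leb]_q _ = \int[leb]_q (cutoff L q * (F q * (F q * F0 q))) +
   \int[leb]_q (cutoff L q * F q * E q)); last first.
  rewrite -RintegralD//.
  - by apply: eq_Rintegral => q _; rewrite /E; ring.
  - apply: integrable_kern_bounded => //.
      by apply: measurable_funM => //; exact: measurable_funM.
    by apply: (bM) => //; exact: bM.
  - rewrite (_ : (fun q => _) = (fun q => cutoff L q * (F q * E q))); last by apply/funext => q; rewrite mulrA.
    apply: integrable_kern_bounded => //; first exact: measurable_funM.
    by apply: (bM) => //; apply: bB => //; exact: bM.
have b2 : `|\int[leb]_q (cutoff L q * F q * E q)| <= Q * (2^-1) ^+ k.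
  have w0 : 0 <= D * 2 ^+ k by rewrite mulr_ge0// exprn_ge0.
  have wb q : `|cutoff L q * F q| <= D * 2 ^+ k.
    by rewrite normrM -[leRHS]mul1r; apply: ler_pM.
  have mw : measurable_fun setT (fun q => cutoff L q * F q) by exact: measurable_funM.
  apply: le_trans (weighted_integral_le mw mE wb w0 bE) _.
  rewrite /Q (_ : (2^-1 : R) ^+ k = 2 ^+ k * scale R k).
    by rewrite le_eqVlt; apply/orP; left; apply/eqP; ring.
  by rewrite /scale -exprMn; congr (_ ^+ k); lra.
have b1 : `|\int[leb]_q (cutoff L q * (F q * (F q * F0 q)))| <= C0 * K / L.
  rewrite (integral_kern_cub kL bF) normrN normrM.
  have mF3 : measurable_fun setT (fun q => F q * (F q * F q)).
    by apply: measurable_funM => //; exact: measurable_funM.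
  have c0 : 0 <= C0 / L by rewrite divr_ge0// ltW.
  have bK' : (\int[leb]_q `|(F q * (F q * F q))%R|%:E <= K%:E)%E.
    apply: le_trans bK; rewrite le_eqVlt; apply/orP; left; apply/eqP.
    by apply: eq_integral => q _; rewrite !normrM.
  have mk := is_kern_measurable (is_kern_partial j0 kL).
  have := weighted_integral_le mk mF3 (HC j0) c0 bK'.
  set I := `|\int[leb]_q _| => H.
  have I0 : 0 <= I by exact: normr_ge0.
  rewrite ger0_norm// (_ : C0 * K / L = C0 / L * K); last by rewrite mulrAC.
  by apply: le_trans H; rewrite ler_piMl// invf_le1// ler1n.
apply: le_trans (ler_normD _ _) _; apply: lerD.
  apply: le_trans b1 _; rewrite ler_wpM2r// ?invr_ge0 ?(ltW L0)//.
  by rewrite lerDl.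
apply: le_trans b2 _; rewrite ler_wpM2r ?exprn_ge0 ?invr_ge0//.
by rewrite lerDr mulr_ge0// ltW.
Qed.

End cubic_bound.

(** * Evolution of the localized mass *)

Section evolution.
Context (R : realType) (d : nat) (n3 : (d.+1 <= 3)%N).
Local Notation n := d.+1.
Local Notation X := 'rV[R]_n.
Local Notation leb := (lebesgue_rV R n).

Lemma Rintegral_sum_ord (m : nat) (F : 'I_m -> X -> R) :
  (forall i, leb.-integrable setT (EFin \o F i)) ->
  leb.-integrable setT (EFin \o (fun x => \sum_i F i x)) /\
  \int[leb]_x (\sum_i F i x) = \sum_i \int[leb]_x F i x.
Proof.
elim: m F => [|m IH] F iF.
  split; last by rewrite big_ord0 /Rintegral integral0_eq// => x _; rewrite big_ord0.
  rewrite (_ : _ \o _ = cst 0%E); first exact: integrable0.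
  by apply/funext => x /=; rewrite big_ord0.
have [i1 E1] := IH (fun i => F (lift ord0 i)) (fun i => iF _).
rewrite (_ : (fun x => \sum_i F i x) = (fun x => F ord0 x + \sum_(i < m) F (lift ord0 i) x)); last first.
  by apply/funext => x; rewrite big_ord_recl.
split; first exact: integrableD_EFin.
by rewrite RintegralD// big_ord_recl E1.
Qed.

(** Derivatives commute with translations, so the dispersive term tested on a translated kernel is a
    sum of correlations with third derivatives of the kernel. *)
Lemma correl_dispersion (f k : X -> R) q : measurable_fun setT f -> (sq f < +oo)%E -> is_kern k ->
  \int[leb]_x (f x * partial ord0 (laplacian (fun y => k (y - q))) x) =
  \sum_i correl f (partial ord0 (partial i (partial i k))) q.
Proof.
move=> mf foo kk.
have kii i : is_kern (partial i (partial i k)) by do 2 apply: is_kern_partial.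
have -> : laplacian (fun y => k (y - q)) = \sum_i (fun y : X => partial i (partial i k) (y - q)).
  by apply/funext => x; rewrite /laplacian fct_sumE; apply: eq_bigr => i _; rewrite !partial_shift.
have E x : partial ord0 (\sum_i (fun y : X => partial i (partial i k) (y - q))) x =
    \sum_i partial ord0 (partial i (partial i k)) (x - q).
  have H i : is_derive x (delta_mx ord0 ord0 : X) (fun y : X => partial i (partial i k) (y - q))
      (partial ord0 (partial i (partial i k)) (x - q)).
    have [tst _] := is_kern_test q (kii i).
    have df := tst [::] x.
    apply: DeriveDef; first exact: diff_derivable.
    exact: (f_equal (fun F => F x) (partial_shift ord0 (partial i (partial i k)) q)).
  exact: (@derive_val _ _ _ _ _ _ _ (is_derive_sum H)).
rewrite (@eq_Rintegral _ _ _ _ _ (fun x => \sum_i f x * partial ord0 (partial i (partial i k)) (x - q))); last first.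
  by move=> x _; rewrite E mulr_sumr.
have [_ ->] := @Rintegral_sum_ord n (fun i x => f x * partial ord0 (partial i (partial i k)) ((x : X) - q))
  (fun i => integrable_correl q mf foo (is_kern_partial ord0 (kii i))).
by [].
Qed.

End evolution.

Section virial.
Context (R : realType) (d : nat) (n3 : (d.+1 <= 3)%N).
Local Notation n := d.+1.
Local Notation X := 'rV[R]_n.
Local Notation leb := (lebesgue_rV R n).

(** The time derivative at q of the mollified solution, as a functional of the solution f and of its
    weak derivative h at that time. *)
Definition zk_rhs (f h k : X -> R) (q : X) : R :=
  \sum_i correl f (partial ord0 (partial i (partial i k))) q - nonlin f h k q.

Lemma is_derive_correl_time (u : X -> R -> R) (k : X -> R) (q : X) (t : R) : ZK_equation u ->
  measurable_fun setT (u^~ t) -> (sq (u^~ t) < +oo)%E -> is_kern k ->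
  is_derive t (1 : R) (fun s => correl (u^~ s) k q) (zk_rhs (u^~ t) (wpartial ord0 (u^~ t)) k q).
Proof.
move=> zk mf foo kk; have := zk _ (is_kern_test q kk) t.
by rewrite (correl_dispersion q mf foo kk).
Qed.

Lemma measurable_zk_rhs (f h k : X -> R) : measurable_fun setT f -> measurable_fun setT h ->
  is_kern k -> measurable_fun setT (zk_rhs f h k).
Proof.
move=> mf mh kk; apply: measurable_funB.
  have := @measurable_sum _ X R setT 'I_n (index_enum 'I_n)
    (fun i => correl f (partial ord0 (partial i (partial i k)))).
  apply=> i; apply: measurable_correl => //.
  by apply: is_kern_measurable; do 3 apply: is_kern_partial.
by apply: measurable_nonlin => //; exact: is_kern_measurable.
Qed.

Lemma zk_rhs_bound (S : R) k : is_kern k -> exists M, forall (f h : X -> R) (q : X),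
  measurable_fun setT f -> measurable_fun setT h -> (sq f <= S%:E)%E -> (sq h <= S%:E)%E ->
  `|zk_rhs f h k q| <= M.
Proof.
move=> kk; have [M0 H0] := nonlin_bound S kk.
have kiii i : is_kern (partial ord0 (partial i (partial i k))) by do 3 apply: is_kern_partial.
have [M1 H1] : exists M, forall (f : X -> R) (q : X), measurable_fun setT f -> (sq f <= S%:E)%E ->
    `|\sum_i correl f (partial ord0 (partial i (partial i k))) q| <= M.
  elim: (index_enum 'I_n) => [|i s [M IH]].
    by exists 0 => f q _ _; rewrite big_nil normr0.
  have [Mi Hi] := correl_bound S (kiii i).
  exists (Mi + M) => f q mf fS; rewrite big_cons; apply: le_trans (ler_normD _ _) _.
  by apply: lerD; [exact: Hi|exact: IH].
exists (M1 + M0) => f h q mf mh fS hS; apply: le_trans (ler_normB _ _) _.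
by apply: lerD; [exact: H1|exact: H0].
Qed.

(** With time frozen, the bound combines one dispersive term per coordinate with the nonlinear term;
    it depends on the data through S alone. *)
Lemma zk_static_bound (S : R) : exists2 C, 0 <= C & forall f g L k, H1_data f g S -> 1 <= L ->
  `|\int[leb]_q (cutoff L q * (correl f (moll (scale R k)) q *
      zk_rhs f (g ord0) (moll (scale R k)) q))| <= C / L + C * (2^-1) ^+ k.
Proof.
have [C1 C10 HC1] := @dispersive_bound R n ord0.
have [C2 C20 HC2] := @nonlinear_bound R n n3 ord0 S.
have [S0|S0] := ltP S 0.
  by exists 0 => // f g L k /H1_data_ge0; rewrite leNgt S0.
have nS : 0 <= n%:R * (C1 * S) by rewrite !mulr_ge0.
exists (n%:R * (C1 * S) + C2); first by rewrite addr_ge0.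
move=> f g L k D L1; have foo := H1_data_lty D; have [mf mg fS gS fg] := D.
have L0 : 0 < L by exact: lt_le_trans L1.
have r0 := scale_gt0 R k; have kr := is_kern_moll n r0; have kL := @is_kern_cutoff R n L L0.
have B2 := HC2 f g L k D L1.
have B1 i := HC1 f g S (scale R k) L i D r0 L1.
have kiii i : is_kern (partial ord0 (partial i (partial i (@moll R n (scale R k))))).
  by do 3 apply: is_kern_partial.
have mF : measurable_fun setT (correl f (moll (scale R k))) by apply: measurable_correl => //; exact: measurable_moll.
have mN := measurable_nonlin mf (mg ord0) (@measurable_moll R n (scale R k)).
have mG i : measurable_fun setT (correl f (partial ord0 (partial i (partial i (moll (scale R k)))))).
  by apply: measurable_correl => //; exact: is_kern_measurable.
have [MF HMF] := correl_bound S kr.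
have bF q := HMF f q mf fS.
have [MN HMN] := nonlin_bound S kr.
have bN q := HMN f (g ord0) q mf (mg ord0) fS (gS ord0).
have bG i : exists M, forall q, `|correl f (partial ord0 (partial i (partial i (moll (scale R k))))) q| <= M.
  by have [M HM] := correl_bound S (kiii i); exists M => q; exact: HM.
rewrite /zk_rhs; move: B1 B2 mF mN mG bF bN bG.
set F := correl f (moll _); set N := nonlin f _ _.
set G := fun i => correl f (partial ord0 (partial i (partial i (moll (scale R k))))).
move=> B1 B2 mF mN mG bF bN bG.
have {}mG i : measurable_fun setT (G i) by exact: mG.
have {}bG i : exists M, forall q, `|G i q| <= M by exact: bG.
have {}B1 i : `|\int[leb]_q (cutoff L q * (F q * G i q))| <= C1 / L * S by exact: B1.
change (`|\int[leb]_q (cutoff L q * (F q * (\sum_i G i q - N q)))| <=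
  (n%:R * (C1 * S) + C2) / L + (n%:R * (C1 * S) + C2) * (2^-1) ^+ k).
clearbody F N G.
have iN : leb.-integrable setT (EFin \o (fun q => cutoff L q * (F q * N q))).
  apply: (integrable_kern_bounded kL); first exact: (measurable_funM mF mN).
  by exists (MF * MN) => q; rewrite normrM ler_pM.
have iG i : leb.-integrable setT (EFin \o (fun q => cutoff L q * (F q * G i q))).
  apply: (integrable_kern_bounded kL); first exact: (measurable_funM mF (mG i)).
  by have [M HM] := bG i; exists (MF * M) => q; rewrite normrM ler_pM.
have [isum sumE] := Rintegral_sum_ord iG.
rewrite (_ : \int[leb]_q _ = \sum_i \int[leb]_q (cutoff L q * (F q * G i q)) -
   \int[leb]_q (cutoff L q * (F q * N q))); last first.
  rewrite -sumE -RintegralB//; apply: eq_Rintegral => q _.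
  by rewrite mulrBr mulrBr mulr_sumr mulr_sumr.
apply: le_trans (ler_normB _ _) _.
have B3 : `|\sum_i \int[leb]_q (cutoff L q * (F q * G i q))| <= n%:R * (C1 * S) / L.
  apply: le_trans (ler_norm_sum _ _ _) _.
  apply: le_trans (ler_sum _ (fun i _ => B1 i)) _.
  rewrite sumr_const card_ord -(mulr_natl (C1 / L * S)) (_ : n%:R * (C1 * S) / L = n%:R * (C1 / L * S))//.
  by ring.
apply: le_trans (lerD B3 B2) _.
have p0 : 0 <= (2^-1 : R) ^+ k by rewrite exprn_ge0// invr_ge0.
move: (2^-1 ^+ k) p0 => p p0; set A := n%:R * _ in nS *.
rewrite -subr_ge0 (_ : _ - _ = A * p); first by rewrite mulr_ge0.
by ring.
Qed.

(** The time derivative of the localized mass is twice the integral bounded in [zk_static_bound],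
    and the mean value theorem integrates it. Differentiation under the integral is possible because
    the cutoff lives in a cube and F and its time derivative are bounded uniformly in time at fixed
    k. *)
Lemma virial_estimate (S : R) : exists2 C, 0 <= C & forall (u : X -> R -> R) L k t, ZK_equation u ->
  (forall s, H1_data (u^~ s) (fun j => wpartial j (u^~ s)) S) -> 1 <= L ->
  `|\int[leb]_q (cutoff L q * correl (u^~ t) (moll (scale R k)) q ^+ 2) -
    \int[leb]_q (cutoff L q * correl (u^~ 0) (moll (scale R k)) q ^+ 2)| <=
  (C / L + C * (2^-1) ^+ k) * `|t|.
Proof.
have [C C0 HC] := zk_static_bound S.
exists (2 * C); first by rewrite mulr_ge0.
move=> u L k t zk D L1.
have L0 : 0 < L by exact: lt_le_trans L1.
have r0 := scale_gt0 R k; have kr := is_kern_moll n r0; have kL := @is_kern_cutoff R n L L0.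
have mr := @measurable_moll R n (scale R k).
have HB s := HC _ _ L k (D s) L1.
have mu s : measurable_fun setT (u^~ s) by case: (D s).
have mg s : measurable_fun setT (wpartial ord0 (u^~ s)) by case: (D s).
have uS s : (sq (u^~ s) <= S%:E)%E by case: (D s).
have gS s : (sq (wpartial ord0 (u^~ s)) <= S%:E)%E by case: (D s).
have foo s : (sq (u^~ s) < +oo)%E := H1_data_lty (D s).
have dF s q := is_derive_correl_time q zk (mu s) (foo s) kr.
have [MF HMF] := correl_bound S kr.
have bF s q := HMF _ q (mu s) (uS s).
have [ML HML] := zk_rhs_bound S kr.
have bL s q := HML _ _ q (mu s) (mg s) (uS s) (gS s).
have mF s : measurable_fun setT (correl (u^~ s) (moll (scale R k))) by exact: measurable_correl.
have mL s := measurable_zk_rhs (mu s) (mg s) kr.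
have chi1 q : `|cutoff L q| <= 1 by rewrite (ger0_norm (cutoff_ge0 _ _)); exact: cutoff_le1.
have chi0 (q : X) : cutoff L q != 0 -> q \in cube L.
  move=> q0; apply: mem_set => i /=; rewrite in_itv/=.
  have : `|q ord0 i| < L.
    rewrite ltNge; apply: contra_neqN q0 => Lq; rewrite cutoffE; exact: kern_support Lq.
  by rewrite ltr_norml => /andP[-> /ltW].
have mchi := @measurable_cutoff R n L.
pose F s := correl (u^~ s) (moll (scale R k)).
pose G s := zk_rhs (u^~ s) (wpartial ord0 (u^~ s)) (moll (scale R k)).
have {}HB s : `|\int[leb]_q (cutoff L q * (F s q * G s q))| <= C / L + C * (2^-1) ^+ k by exact: HB.
have {}dF s q : is_derive s (1 : R) (F^~ q) (G s q) by exact: dF.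
have {}bF s q : `|F s q| <= MF by exact: bF.
have {}bL s q : `|G s q| <= ML by exact: bL.
have {}mF s : measurable_fun setT (F s) by exact: mF.
have {}mL s : measurable_fun setT (G s) by exact: mL.
change (`|\int[leb]_q (cutoff L q * F t q ^+ 2) - \int[leb]_q (cutoff L q * F 0 q ^+ 2)| <=
  (2 * C / L + 2 * C * (2^-1) ^+ k) * `|t|).
clearbody F G; clear D zk mu mg uS gS foo kr mr HML HMF HC.
have restrict (h : X -> R) :
    \int[leb]_(q in cube L) (cutoff L q * h q) = \int[leb]_q (cutoff L q * h q).
  rewrite Rintegral_mkcond; apply: eq_Rintegral => q _; rewrite patchE.
  case: ifPn => // qn; apply/esym/eqP; rewrite mulf_eq0; apply/orP; left.
  by apply: contraNT qn; exact: chi0.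
have bFF s q : `|cutoff L q * F s q ^+ 2| <= 1 * MF ^+ 2.
  by rewrite normrM; apply: ler_pM => //; rewrite normrX; apply: lerXn2r; rewrite ?nnegrE//;
    apply: le_trans (bF s q).
have bFG s q : `|cutoff L q * (2 * (F s q * G s q))| <= 1 * (2 * (MF * ML)).
  rewrite normrM; apply: ler_pM => //; rewrite normrM (ger0_norm (ler0n R 2)).
  by rewrite ler_pM2l// normrM; apply: ler_pM.
have dB s : is_derive s (1 : R) (fun t => \int[leb]_(q in cube L) (cutoff L q * F t q ^+ 2))
    (\int[leb]_(q in cube L) (cutoff L q * (2 * (F s q * G s q)))).
  apply: (@is_derive_integral_cube R n L (1 * (2 * (MF * ML))) (fun t q => cutoff L q * F t q ^+ 2)
     (fun s q => cutoff L q * (2 * (F s q * G s q))) s).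
  - by move=> s'; apply: measurable_funM => //; exact: measurable_funX.
  - by move=> s'; exists (1 * MF ^+ 2) => q _; exact: bFF.
  - move=> s' q _; have := is_deriveM (dF s' q) (dF s' q).
    move=> /(fun H => is_deriveZ (cutoff L q) H).
    rewrite (_ : _ *: (_ + _) = cutoff L q * (2 * (F s' q * G s' q))).
      by apply.
    by rewrite /GRing.scale/=; ring.
  - by move=> s' q _; exact: bFG.
have := @MVT_bound R _ _ (2 * C / L + 2 * C * (2^-1) ^+ k) t dB.
rewrite !restrict; apply=> s.
rewrite restrict (_ : \int[leb]_q _ = 2 * \int[leb]_q (cutoff L q * (F s q * G s q))).
  rewrite normrM (ger0_norm (ler0n R 2)) -!mulrA -mulrDr ler_pM2l//; exact: HB.
have bb : exists M, forall q, `|F s q * G s q| <= M.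
  by exists (MF * ML) => q; rewrite normrM; apply: ler_pM.
rewrite -RintegralZl; [|exact: measurableT|].
  by apply: eq_Rintegral => q _; rewrite mulrCA.
by apply: integrable_kern_bounded => //; exact: measurable_funM.
Qed.

End virial.

(** * Removing the mollification *)

Section mass_transport.
Context (R : realType) (n : nat).
Local Notation X := 'rV[R]_n.
Local Notation leb := (lebesgue_rV R n).

Lemma integrable_cutoff_sq (f : X -> R) (L : R) : measurable_fun setT f -> (sq f < +oo)%E ->
  leb.-integrable setT (EFin \o (fun q => cutoff L q * f q ^+ 2)).
Proof.
move=> mf foo; apply: (integrable_le _ (integrable_sq mf foo)).
  by apply: measurable_funM; [exact: measurable_cutoff|exact: measurable_funX].
move=> q; rewrite normrM (ger0_norm (cutoff_ge0 _ _)) (ger0_norm (sqr_ge0 _)).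
by rewrite ler_piMl ?sqr_ge0// cutoff_le1.
Qed.

(** F^2 - f^2 = (F - f)(F + f), where F - f has squared norm of order r^2; the weight 1/r gives
    order r. *)
Lemma cutoff_sq_sub (S : R) : exists2 C, 0 <= C & forall (f : X -> R) g L r, H1_data f g S ->
  0 < L -> 0 < r -> `|\int[leb]_q (cutoff L q * correl f (moll r) q ^+ 2) -
    \int[leb]_q (cutoff L q * f q ^+ 2)| <= C * r.
Proof.
have [C1 C10 HC1] := @moll_variation_H1 R n.
have [S0|S0] := ltP S 0.
  by exists 0 => // f g L r /H1_data_ge0; rewrite leNgt S0.
exists ((C1 * S + 4 * S) / 2); first by rewrite divr_ge0// addr_ge0// mulr_ge0.
move=> f g L r D L0 r0; have foo := H1_data_lty D; have [mf mg fS gS fg] := D.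
have mF : measurable_fun setT (correl f (moll r)) by apply: measurable_correl => //; exact: measurable_moll.
have FS : (sq (correl f (moll r)) <= S%:E)%E by apply: le_trans fS; exact: sq_correl_moll.
have V := le_trans (sq_correl_moll_sub r0 mf foo) (HC1 f g S r D r0).
have mchi := @measurable_cutoff R n L.
set F := correl f _ in mF FS V *; clearbody F.
have Foo : (sq F < +oo)%E by rewrite (le_lt_trans FS)// ltry.
rewrite -RintegralB; [|exact: measurableT|exact: integrable_cutoff_sq|exact: integrable_cutoff_sq].
rewrite (@eq_Rintegral _ _ _ _ _ (fun q => (cutoff L q * (F q - f q)) * (F q + f q))); last first.
  by move=> q _; ring.
have mD : measurable_fun setT (fun q => F q - f q) by exact: measurable_funB.
have mcD : measurable_fun setT (fun q => cutoff L q * (F q - f q)) by exact: measurable_funM.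
have mS : measurable_fun setT (fun q => F q + f q) by exact: measurable_funD.
have bD : (sq (fun q => cutoff L q * (F q - f q))%R <= (C1 * (r ^+ 2 * S))%:E)%E.
  apply: le_trans V; apply: sq_le => // q.
  by rewrite normrM (ger0_norm (cutoff_ge0 _ _)) ler_piMl// cutoff_le1.
have bS : (sq (fun q => F q + f q)%R <= (4 * S)%:E)%E.
  apply: le_trans (sqD mF mf) _; apply: (@le_trans _ _ (2%:E * S%:E + 2%:E * S%:E)%E).
    by apply: leeD; rewrite lee_pmul2l.
  by rewrite -!(EFinM, EFinD) lee_fin; lra.
have ri : 0 < r^-1 by rewrite invr_gt0.
apply: le_trans (Rintegral_AMGM mcD mS ri bD bS) _.
rewrite invrK (_ : r^-1 * (C1 * (r ^+ 2 * S)) = C1 * S * r); last by field; rewrite gt_eqF.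
by rewrite le_eqVlt; apply/orP; left; apply/eqP; field.
Qed.

End mass_transport.

Section localized_mass.
Context (R : realType) (d : nat) (n3 : (d.+1 <= 3)%N).
Local Notation n := d.+1.
Local Notation X := 'rV[R]_n.
Local Notation leb := (lebesgue_rV R n).

Lemma norm_sub_le (a b a' b' K c : R) : `|a - a'| <= c -> `|b - b'| <= c -> `|a - b| <= K ->
  `|a' - b'| <= K + 2 * c.
Proof.
rewrite !ler_norml => /andP[? ?] /andP[? ?] /andP[? ?].
by apply/andP; split; lra.
Qed.

Lemma half_expn_small (D e : R) : 0 < e -> exists k, D * (2^-1) ^+ k < e.
Proof.
move=> e0; have : (fun k => D * (2^-1) ^+ k) @ \oo --> (D * 0 : R).
  by apply: cvgMr; apply: cvg_expr; rewrite ger0_norm ?invf_lt1 ?ltr1n.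
rewrite mulr0 => /cvgr_lt/(_ e e0)[k _ H]; exists k; exact: H k (leqnn k).
Qed.

Lemma localized_mass (S : R) : exists2 C, 0 <= C & forall (u : X -> R -> R) L t, ZK_equation u ->
  (forall s, H1_data (u^~ s) (fun j => wpartial j (u^~ s)) S) -> 1 <= L ->
  `|\int[leb]_q (cutoff L q * u q t ^+ 2) - \int[leb]_q (cutoff L q * u q 0 ^+ 2)| <= C / L * `|t|.
Proof.
have [C C0 HC] := @virial_estimate R d n3 S.
have [C1 C10 HC1] := @cutoff_sq_sub R n S.
exists C => // u L t zk D L1; have L0 : 0 < L by exact: lt_le_trans L1.
apply/ler_addgt0Pr => e e0.
(* L and t are fixed while k grows. The two mollification errors, of order 4^-k <= 2^-k, and the
   commutator drift C 2^-k |t| fall below e together. *)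
have [k ke] := half_expn_small (2 * C1 + C * `|t|) e0.
have r0 := scale_gt0 R k.
have h1 := HC1 _ _ L _ (D t) L0 r0; have h2 := HC1 _ _ L _ (D 0) L0 r0.
have h3 := HC u L k t zk D L1.
have rk : scale R k <= (2^-1) ^+ k.
  by rewrite /scale lerXn2r ?nnegrE ?invr_ge0// lef_pV2 ?posrE// ler_nat.
apply: le_trans (norm_sub_le h1 h2 h3) _; move: ke rk C10; clear.
move: (C / L) ((2^-1) ^+ k) (scale R k) (normr_ge0 t) => K p r t0 ke rp C10.
have : C1 * r <= C1 * p by rewrite ler_wpM2l.
move: ke; rewrite (_ : (2 * C1 + C * `|t|) * p = 2 * (C1 * p) + C * p * `|t|); last by ring.
by rewrite mulrDl; lra.
Qed.

End localized_mass.

(** * From the Sobolev norm to squared integrals *)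

Section sobolev_data.
Context (R : realType) (n : nat).
Local Notation X := 'rV[R]_n.
Local Notation leb := (lebesgue_rV R n).
Local Open Scope ereal_scope.

Lemma Lnorm_sq (f : X -> R) : 'N[leb]_2%:E[EFin \o f] `^ 2 = sq f.
Proof.
rewrite poweR_Lnorm//; apply: eq_integral => x _ /=.
by rewrite (powR_mulrn 2)// real_normK// num_real.
Qed.

Lemma L2_sq (f : X -> R) : L2 f -> measurable_fun setT f /\ sq f < +oo.
Proof.
move=> Lf; have /set_mem mf := sub_Lfun_mfun Lf; have /set_mem ff := sub_Lfun_finLfun Lf.
by split; [exact: mf|rewrite -Lnorm_sq; apply: poweR_lty; exact: ff].
Qed.

Lemma H1norm_sq (f : X -> R) (M : R) : H1norm f <= M%:E ->
  sq f <= (M ^+ 2)%:E /\ forall j, sq (wpartial j f) <= (M ^+ 2)%:E.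
Proof.
rewrite /H1norm Lnorm_sq; under eq_bigr do rewrite Lnorm_sq.
have T0 : 0 <= \sum_(j < n) sq (wpartial j f) by apply: sume_ge0 => j _; exact: sq_ge0.
set T := _ + _ => TM.
have TT0 : 0 <= T by apply: adde_ge0 => //; exact: sq_ge0.
have M0 : (0 <= M)%R by rewrite -lee_fin; apply: le_trans TM; exact: poweR_ge0.
have {}TM : T <= (M ^+ 2)%:E.
  have -> : T = (T `^ 2^-1) `^ 2 by rewrite -poweRrM mulVf ?poweRe1// pnatr_eq0.
  rewrite -(powR_mulrn 2 M0) -poweR_EFin; apply: gt0_ler_poweR => //.
  - by rewrite in_itv/= poweR_ge0 leey.
  - by rewrite in_itv/= lee_fin M0 leey.
split; first by apply: le_trans TM; rewrite leeDl.
move=> j; apply: le_trans TM; rewrite /T (bigD1 j)//= addeCA leeDl//.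
by apply: adde_ge0; [exact: sq_ge0|apply: sume_ge0 => i _; exact: sq_ge0].
Qed.

(** Membership in H1 provides a witness, so the representative chosen by [wpartial] is a genuine
    weak derivative rather than the default 0. *)
Lemma H1_H1_data (f : X -> R) (M : R) : H1 f -> H1norm f <= M%:E ->
  H1_data f (fun j => wpartial j f) (M ^+ 2).
Proof.
move=> [Lf Hf] fM; have [fS gS] := H1norm_sq fM.
have W j : L2 (wpartial j f) /\ is_weak_partial j f (wpartial j f).
  have [g Lg wg] := Hf j.
  by apply: (@xgetPex _ (cst 0%R : X -> R) [set g | L2 g /\ is_weak_partial j f g]); exists g.
split=> //.
- by have [] := L2_sq Lf.
- by move=> j; have [/L2_sq[]] := W j.
- by move=> j; have [] := W j.
Qed.

End sobolev_data.

(** * Escape of the shells *)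

Section growth.
Context (R : realType) (p eps c0 : R) (p1 : 1 <= p) (eps0 : 0 < eps) (c00 : 0 < c0).

Lemma ln_cvg_pinfty : ln t @[t --> +oo] --> (+oo : set_system R).
Proof.
apply/cvgryPge => A; near=> t.
have At : expR A <= t by near: t; exact: nbhs_pinfty_ge (num_real _).
by rewrite -(expRK A) ler_ln ?posrE ?expR_gt0// (lt_le_trans _ At)// expR_gt0.
Unshelve. all: by end_near. Qed.

Definition shell_radius (t : R) := c0 * (t `^ p * ln t `^ (1 + eps)).

(** For t >= e both bases t and ln t are at least 1, so lowering the exponents p and 1 + eps to 1
    decreases the powers. *)
Lemma shell_radius_ge t : expR 1 <= t -> c0 * (t * ln t) <= shell_radius t.
Proof.
move=> et; have t1 : 1 <= t by apply: le_trans et; rewrite -[leLHS]expR0 ler_expR.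
have t0 : 0 < t by exact: lt_le_trans t1.
have l1 : 1 <= ln t by rewrite -(expRK 1) ler_ln ?posrE ?expR_gt0.
have l0 : 0 < ln t by exact: lt_le_trans l1.
rewrite /shell_radius ler_pM2l//; apply: ler_pM; [exact: ltW|exact: ltW| |].
- by rewrite -[leLHS](powRr1 (ltW t0)); exact: ler_powR.
- by rewrite -[leLHS](powRr1 (ltW l0)); apply: ler_powR => //; rewrite lerDl ltW.
Qed.

Lemma shell_radius_cvg : shell_radius t @[t --> +oo] --> (+oo : set_system R).
Proof.
apply/cvgryPge => A; near=> t.
have At : A / c0 <= t by near: t; exact: nbhs_pinfty_ge (num_real _).
have et : expR 1 <= t by near: t; exact: nbhs_pinfty_ge (num_real _).
apply: le_trans (shell_radius_ge et).
have l1 : 1 <= ln t by rewrite -(expRK 1) ler_ln ?posrE ?(lt_le_trans (expR_gt0 1))// expR_gt0.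
have t0 : 0 < t by apply: lt_le_trans et; exact: expR_gt0.
rewrite -ler_pdivrMl// mulrC; apply: le_trans At _.
by rewrite ler_peMr// ltW.
Unshelve. all: by end_near. Qed.

End growth.

Section cutoff_limit.
Context (R : realType) (n : nat).
Local Notation X := 'rV[R]_n.
Local Notation leb := (lebesgue_rV R n).

(** Dominated convergence along every sequence of widths tending to infinity, with f^2
    dominating. *)
Lemma cutoff_mass_cvg (f : X -> R) : measurable_fun setT f -> (sq f < +oo)%E ->
  \int[leb]_q (cutoff L q * f q ^+ 2) @[L --> +oo] --> fine (sq f).
Proof.
move=> mf foo; apply/cvg_pinftyP => v voo.
have cv q : cutoff (v m) q * f q ^+ 2 @[m --> \oo] --> f q ^+ 2.
  rewrite -[X in _ --> X]mul1r; apply: cvgMl.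
  exact: (cvg_comp _ _ voo (cutoff_cvg1 q)).
have [] := @dominated_convergence _ X R leb setT measurableT
  (fun m q => (cutoff (v m) q * f q ^+ 2)%:E) (fun q => (f q ^+ 2)%:E) (fun q => (f q ^+ 2)%:E).
- by move=> m; have /measurable_int := integrable_cutoff_sq (v m) mf foo.
- exact: measurable_sq.
- by apply: aeW => q _; apply: cvg_EFin; [exact: nearW|exact: cv].
- exact: integrable_sq.
- apply: aeW => q m _ /=; rewrite lee_fin normrM (ger0_norm (cutoff_ge0 _ _)) (ger0_norm (sqr_ge0 _)).
  by rewrite ler_piMl ?sqr_ge0// cutoff_le1.
move=> _ _ cvi; apply: fine_cvg; rewrite -sq_fin//.
Qed.

(** On D the integrand equals (1 - chi) f^2, which is nonnegative everywhere, so the integral may be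
    extended to the whole space. *)
Lemma integral_off_cutoff (f : X -> R) (D : set X) (L : R) : measurable_fun setT f ->
  (sq f < +oo)%E -> measurable D -> (forall x, D x -> cutoff L x = 0) ->
  (\int[leb]_(x in D) (f x ^+ 2)%:E <= (fine (sq f) - \int[leb]_q (cutoff L q * f q ^+ 2))%:E)%E.
Proof.
move=> mf foo mD D0; have isq := integrable_sq mf foo.
have ichi := integrable_cutoff_sq L mf foo.
have m1 : measurable_fun setT (fun x => f x ^+ 2 - cutoff L x * f x ^+ 2).
  by apply/measurable_EFinP; exact: measurable_int (integrableB_EFin isq ichi).
have p1 x : 0 <= f x ^+ 2 - cutoff L x * f x ^+ 2.
  by rewrite subr_ge0 ler_piMl ?sqr_ge0// cutoff_le1.
rewrite (_ : (_ - _)%:E = \int[leb]_x (f x ^+ 2 - cutoff L x * f x ^+ 2)%:E)%E; last first.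
  rewrite (_ : fine (sq f) = \int[leb]_q (f q ^+ 2))// -RintegralB//.
  by rewrite /Rintegral fineK//; exact: integrable_fin_num (integrableB_EFin isq ichi).
rewrite (@eq_integral _ _ _ _ _ (fun x => (f x ^+ 2 - cutoff L x * f x ^+ 2)%:E)); last first.
  by move=> x /set_mem Dx; rewrite (D0 x Dx) mul0r subr0.
apply: ge0_subset_integral => //; first exact/measurable_EFinP.
by move=> x _; rewrite lee_fin.
Qed.

End cutoff_limit.

Section shell.
Context (R : realType) (d : nat) (c0 C0 p eps : R) (j : 'I_d.+1).
Local Notation X := 'rV[R]_d.+1.

Lemma measurable_Omega t : measurable (Omega c0 C0 p eps j t : set X).
Proof.
have mc : measurable_fun [set: X] (fun x : X => `|x ord0 j|).
  by apply: measurableT_comp; [exact: normr_measurable|exact: measurable_coord].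
rewrite /Omega; set a := c0 * _; set b := C0 * _.
have := mc measurableT `[a, b]%classic (measurable_itv _).
by rewrite setTI; congr (measurable _); apply/seteqP; split=> x /=; rewrite in_itv.
Qed.

(** The cutoff lives in the open cube of half-side the inner radius, and on the shell the j-th
    coordinate is at least that radius. *)
Lemma cutoff_Omega t x : 0 < shell_radius p eps c0 t -> Omega c0 C0 p eps j t x ->
  cutoff (shell_radius p eps c0 t) x = 0.
Proof. by move=> r0 /andP[xj _]; rewrite cutoffE; exact: kern_support xj. Qed.

End shell.

Theorem theorem1p16 (R : realType) (d : nat) (hd : d.+1 = 2%N \/ d.+1 = 3%N)
    (p eps c0 C0 : R) (hp : 1 <= p) (heps : 0 < eps)
    (hc0 : 0 < c0) (hcC0 : c0 <= C0)
    (u0 : 'rV[R]_d.+1 -> R) (hu0 : H1 u0)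
    (u : 'rV[R]_d.+1 -> R -> R) (hu : ZK_solution u0 u)
    (hmass : L2_conserved u0 u) (hbound : H1_bounded u) (j : 'I_d.+1) :
  (\int[lebesgue_rV R d.+1]_(x in Omega c0 C0 p eps j t) ((u x t) ^+ 2)%:E)%E
    @[t --> +oo] --> 0%E.
Proof.
have n3 : (d.+1 <= 3)%N by case: hd => ->.
have [[contH1 _] zk _] := hu; have [M HM] := hbound.
have D s := H1_H1_data (contH1 s) (HM s).
have [C C0' HC] := localized_mass n3 (M ^+ 2).
have mu s : measurable_fun setT (u^~ s) by case: (D s).
have uoo s : (sq (u^~ s) < +oo)%E := H1_data_lty (D s).
have massE s : sq (u^~ s) = sq (u^~ 0).
  by rewrite -!Lnorm_sq hmass [in RHS]hmass.
set I0 := fun L : R => \int[lebesgue_rV R d.+1]_q (cutoff L q * u q 0 ^+ 2).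
(* The majorant: the part of the initial mass that the cutoff misses, plus the drift of the
   localized mass up to time t. *)
pose h t := (fine (sq (u^~ 0)) - I0 (shell_radius p eps c0 t)) + C / c0 * (ln t)^-1.
have hcvg : h t @[t --> +oo] --> (0 : R).
  rewrite -[X in _ --> X]addr0; apply: cvgD.
    rewrite -[X in _ --> X](subrr (fine (sq (u^~ 0)))); apply: cvgB; first exact: cvg_cst.
    exact: (cvg_comp _ _ (shell_radius_cvg hp heps hc0) (cutoff_mass_cvg (mu 0) (uoo 0))).
  rewrite -[X in _ --> X](mulr0 (C / c0)); apply: cvgMr.
  apply/gtr0_cvgV0; last exact: ln_cvg_pinfty.
  near=> t; apply: ln_gt0; near: t; exact: nbhs_pinfty_gt (num_real _).
apply: (@squeeze_cvge _ _ _ _ (cst 0%E) _ (fun t => (h t)%:E)); last 2 first.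
- exact: cvg_cst.
- by apply: cvg_EFin; [exact: nearW|exact: hcvg].
have /cvgryPge/(_ 1) Linf := shell_radius_cvg hp heps hc0.
near=> t.
have et : expR 1 <= t by near: t; exact: nbhs_pinfty_ge (num_real _).
have L1 : 1 <= shell_radius p eps c0 t.
  by near: t; exact: Linf.
have t0 : 0 < t := lt_le_trans (expR_gt0 1) et.
have lt0 : 0 < ln t.
  by apply: ln_gt0; apply: lt_le_trans et; rewrite -[ltLHS]expR0 ltr_expR.
have L0 : 0 < shell_radius p eps c0 t := lt_le_trans ltr01 L1.
apply/andP; split; first by apply: integral_ge0 => x _; rewrite lee_fin sqr_ge0.
apply: le_trans (integral_off_cutoff (mu t) (uoo t) (measurable_Omega c0 C0 p eps j t)
  (fun x => cutoff_Omega L0)) _.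
rewrite lee_fin massE /h -addrA lerD2l.
have := HC u (shell_radius p eps c0 t) t zk D L1; rewrite (gtr0_norm t0) ler_norml => /andP[B _].
(* The width is at least c0 t ln t, so the factor t from the elapsed time cancels. *)
have B' : C / shell_radius p eps c0 t * t <= C / c0 * (ln t)^-1.
  have e : C / c0 * (ln t)^-1 = C * (c0 * (t * ln t))^-1 * t by field; rewrite !gt_eqF.
  rewrite e ler_wpM2r ?(ltW t0)// ler_wpM2l// lef_pV2; [|exact: L0|].
    exact: shell_radius_ge.
  by rewrite posrE !mulr_gt0.
rewrite addrC -lerBlDr opprK addrC -opprB lerNl.
by apply: le_trans B; rewrite lerN2.
Unshelve. all: by end_near. Qed.
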